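(* Let $L=(L_t)_{t\in\mathbb{R}}$ be a two-sided one-dimensional L\'evy process with expectation zero and finite variance $\sigma^2=E L_1^2$, let $\mu\in\mathbb{R}$, $\Delta>0$, and let $f:\mathbb{R}\to\mathbb{R}$ be in $L^2(\mathbb{R})$. Let $X_t=\mu+\int_{\mathbb{R}} f(t-s)\,dL_s$, $t\in\mathbb{R}$, with autocovariance function $\gamma$, and let $\overline{X}_{n;\Delta}=n^{-1}\sum_{i=1}^n X_{i\Delta}$. Suppose that the function $$F_\Delta:[0,\Delta]\to[0,\infty],\quad u\mapsto F_\Delta(u)=\sum_{j=-\infty}^\infty |f(u+j\Delta)|$$ belongs to $L^2([0,\Delta])$. Then $\sum_{j=-\infty}^\infty|\gamma(\Delta j)|<\infty$, $$\sum_{j=-\infty}^\infty\gamma(\Delta j)=\sigma^2\int_0^\Delta\Big(\sum_{j=-\infty}^\infty f(u+j\Delta)\Big)^2\,du,$$ and the sample mean of $X_\Delta,\ldots,X_{n\Delta}$ is asymptotically normal as $n\to\infty$; more precisely, $$\sqrt{n}\,\big(\overline{X}_{n;\Delta}-\mu\big)\stackrel{d}{\to}N\Big(0,\ \sigma^2\int_0^\Delta\Big(\sum_{j=-\infty}^\infty f(u+\Delta j)\Big)^2\,du\Big)\quad\text{as } n\to\infty.$$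
   Context: A two-sided L\'evy process $L=(L_t)_{t\in\mathbb{R}}$ is a stochastic process indexed by $\mathbb{R}$ with independent and stationary increments, c\`adl\`ag sample paths and $L_0=0$. For $f\in L^2(\mathbb{R})$ and $L$ with mean zero and finite variance, the integral $\int_{\mathbb{R}}f(t-s)\,dL_s$ is defined in the $L^2(P)$ sense (It\^o isometry), and $(X_t)$ is strictly stationary. The autocovariance function is $\gamma(h)=\operatorname{Cov}(X_0,X_h)=\sigma^2\int_{\mathbb{R}}f(-s)f(h-s)\,ds$, $h\in\mathbb{R}$. The symbol $\stackrel{d}{\to}$ denotes convergence in distribution; a normal distribution with variance $0$ is a point mass. *)

(* Defs.v *)
From HB Require Import structures.
From mathcomp Require Import all_boot all_order all_algebra.
From mathcomp Require Import all_classical all_reals all_analysis.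

Set Implicit Arguments.
Unset Strict Implicit.
Unset Printing Implicit Defensive.

Import Order.TTheory GRing.Theory Num.Theory.
Import numFieldNormedType.Exports.

Local Open Scope classical_set_scope.
Local Open Scope ring_scope.

(* Only measurable sets are tested: a measure is a total function on [set T]
   whose values off the sigma-algebra are meaningless.  Subfamilies are covered
   by taking [A i := setT]. *)
Definition mutually_independent d (T : measurableType d) (R : realType)
    (P : probability T R) (n : nat) (X : 'I_n -> T -> R) : Prop :=
  forall A : 'I_n -> set R, (forall i, measurable (A i)) ->
    P (\bigcap_i (X i @^-1` A i)) = (\prod_(i < n) P (X i @^-1` A i))%E.

Definition identically_distributed d (T : measurableType d) (R : realType)
    (P : probability T R) (X Y : T -> R) : Prop :=
  forall A : set R, measurable A -> P (X @^-1` A) = P (Y @^-1` A).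

Definition cadlag (R : realType) (x : R -> R) : Prop :=
  forall t : R, x s @[s --> t^'+] --> x t /\ cvg (x s @[s --> t^'-]).

Section levy.
Context d (T : measurableType d) (R : realType) (P : probability T R).

Definition increment (L : R -> {RV P >-> R}) (s t : R) (w : T) : R :=
  L t w - L s w.

Record two_sided_levy_process (L : R -> {RV P >-> R}) : Prop := {
  levy_start : {ae P, forall w, L 0 w = 0} ;
  levy_independent_increments : forall (n : nat) (t : nat -> R),
    {homo t : i j / (i < j)%N >-> i < j} ->
    mutually_independent P (fun i : 'I_n => increment L (t i) (t i.+1)) ;
  levy_stationary_increments : forall s t h : R, s <= t ->
    identically_distributed P (increment L s t) (increment L (s + h) (t + h)) ;
  levy_cadlag_paths : {ae P, forall w, cadlag (fun t => L t w)}
}.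

Definition step_integral (L : R -> {RV P >-> R}) (g : R -> R) (I : T -> R)
    : Prop :=
  exists (n : nat) (a b c : 'I_n -> R),
    [/\ forall i, a i <= b i,
        forall x, g x = \sum_(i < n) c i * \1_(`]a i, b i]%classic) x &
        forall w, I w = \sum_(i < n) c i * increment L (a i) (b i) w].

(* [Y] is a version of the integral of [f] with respect to [L]: the L^2(P)-limit
   of the integrals of step functions converging to [f] in L^2(R).  By the Ito
   isometry such a [Y] exists and is almost surely unique when [L] is a Levy
   process with mean zero and finite variance and [f] is in L^2(R). *)
Definition levy_integral (L : R -> {RV P >-> R}) (f : R -> R) (Y : T -> R)
    : Prop :=
  Y \in Lfun P 2%:E /\
  exists (g : (R -> R)^nat) (I : (T -> R)^nat),
    [/\ forall n, step_integral L (g n) (I n),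
        ('N[@lebesgue_measure R]_2%:E[EFin \o (g n \- f)%R])%E @[n --> \oo] --> 0%E &
        ('N[P]_2%:E[EFin \o (I n \- Y)%R])%E @[n --> \oo] --> 0%E].

Definition autocovariance (X : R -> {RV P >-> R}) (h : R) : \bar R :=
  covariance P (X 0) (X h).

Definition sample_mean (X : R -> {RV P >-> R}) (Delta : R) (n : nat) (w : T)
    : R :=
  n%:R^-1 * \sum_(1 <= i < n.+1) X (i%:R * Delta) w.

Definition cvg_in_distribution (Y : (T -> R)^nat) (nu : probability (measurableTypeR R) R)
    : Prop :=
  (forall n, measurable_fun [set: T] (Y n)) /\
  forall g : R -> R, continuous g -> (exists M, forall x, `|g x| <= M) ->
    ('E_P[g \o Y n])%E @[n --> \oo] --> (\int[nu]_x (g x)%:E)%E.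

End levy.

(* [normal_prob] takes the standard deviation, and for standard deviation 0 it
   is the uniform law on [0, 1]; hence the case distinction. *)
Definition normal_law (R : realType) (m v : R) : probability (measurableTypeR R) R :=
  if v == 0 then [the probability (measurableTypeR R) R of \d_(m : measurableTypeR R)]
  else [the probability (measurableTypeR R) R of normal_prob m (Num.sqrt v)].

(* [Posz] and [Negz] enumerate the integers j >= 0 and j < 0, respectively. *)
Definition bilateral_sum (R : realType) (a : int -> R) : R :=
  limn (series (fun n => a (Posz n))) + limn (series (fun n => a (Negz n))).

Definition periodized_abs (R : realType) (f : R -> R) (Delta u : R) : \bar R :=
  (\esum_(j in [set: int]) `|f (u + j%:~R * Delta)|%:E)%E.

Definition periodized (R : realType) (f : R -> R) (Delta u : R) : R :=
  bilateral_sum (fun j => f (u + j%:~R * Delta)).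

(* Main.v *)
Require Import Defs.
From HB Require Import structures.
From mathcomp Require Import all_boot all_order all_algebra.
From mathcomp Require Import all_classical all_reals all_analysis.
From mathcomp Require Import measurable_realfun ring lra zify.

(** Let G be the periodization of f with period Delta, and for a square-integrable
    kernel h let r_h(j) be the integral over the line of h(x) h(x + j Delta).

    By the isometry of the integral ([ito_isometry]) the covariance of X_0 and
    X_(j Delta) is sigma^2 r_f(j).  Cutting the line into translates of [0, Delta[
    and exchanging sums and integrals, one gets that the sum of the r_f(j) is the
    integral of G^2 over [0, Delta[ ([esum_correlation] for nonnegative kernels,
    [correlation_sum] in general); the hypothesis that F_Delta is square-integrable
    makes all these exchanges absolutely convergent.  The formula holds for other
    kernels h as well, and Cesaro summation ([cesaro_bilateral]) reads it as the
    limit of the variances of the normalized sums of the moving average with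
    kernel h: sigma^2 times the integral of the square of the periodization of h.

    Consequently the normalized sums of two kernels are asymptotically close in
    mean square as soon as the periodizations of the kernels are close in
    L^2([0, Delta[).  So f may be traded for a kernel q that vanishes off
    [0, Delta[ and is close to G there, although q need not be close to f:
    the kernel f - q has periodization G - q on the cell
    ([residual_correlation_sum]).  Such a q can be chosen constant on the cells of
    a regular grid of mesh Delta / r ([grid_norm_dense]).  The sum over k < n of the
    moving average with kernel q at the times (k + 1) Delta is a sum, with periodic
    weights, of n r independent and identically distributed increments of L, and an
    elementary central limit theorem applies ([central_limit_cos],
    [grid_integral_central_limit]).  Letting q tend to G concludes
    ([cvg_approximation]).

    The limits are taken for the expectations of cos (l Y + th), which contain the
    real and imaginary parts of the characteristic function of Y but only involve
    real functions; [levy_continuity] converts them into convergence of E g(Y) for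
    bounded continuous g.  Its proof uses that gaussian bumps are mixtures of
    cosines and that bounded functions are, up to a small error, mixtures of
    gaussian bumps; the bounded second moments of the normalized sums provide
    tightness.

    The hypotheses on L only concern the moments of L_1.  That every increment is
    square-integrable and centred, with variance proportional to its duration, is
    [increment_moments].  Its mean is the delicate part: it is an additive function
    of the duration, and additive functions are linear only under some regularity,
    which is here drawn from the right-continuity of the paths ([m_eq0]). *)

Set Implicit Arguments.
Unset Strict Implicit.
Unset Printing Implicit Defensive.

Import Order.TTheory GRing.Theory Num.Theory.
Import numFieldNormedType.Exports.

Local Open Scope classical_set_scope.
Local Open Scope ring_scope.

(** * Square-integrable functions and integrals of real functions *)

Section square_integrable.
Context d (T : measurableType d) (R : realType) (mu : {measure set T -> \bar R}).
Implicit Types f g h : T -> R.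

(** Square integrability of a function, not of its class: the kernels and random
    variables below are always given as functions. *)
Definition sqint h :=
  measurable_fun setT h /\ mu.-integrable setT (fun x => (h x ^+ 2)%:E).

(** The inner product of L^2(mu) between square-integrable functions, real-valued
    so that bilinear computations stay in the field. *)
Definition ip g h : R := \int[mu]_x (g x * h x).

Lemma sqint_mul g h : sqint g -> sqint h ->
  mu.-integrable setT (EFin \o (fun x => g x * h x)).
Proof.
move=> [mg ig] [mh ih]; apply: (le_integrable measurableT _ _ (integrableD measurableT ig ih)).
  by apply/measurable_EFinP; exact: measurable_funM.
move=> x _ /=; rewrite lee_fin [leRHS]ger0_norm ?addr_ge0 ?sqr_ge0//.
rewrite ler_norml; apply/andP; split; have := sqr_ge0 (g x + h x); have := sqr_ge0 (g x - h x); nra.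
Qed.

Lemma sqintD g h : sqint g -> sqint h -> sqint (fun x => g x + h x).
Proof.
move=> [mg ig] [mh ih]; split; first exact: measurable_funD.
have i2 := integrableZl measurableT 2 (integrableD measurableT ig ih).
apply: (le_integrable measurableT _ _ i2).
  by apply/measurable_EFinP; apply: measurable_funX; exact: measurable_funD.
move=> x _ /=; rewrite lee_fin (ger0_norm (sqr_ge0 _)).
have g0 := sqr_ge0 (g x); have h0 := sqr_ge0 (h x).
have d0 := sqr_ge0 (g x - h x).
by rewrite ger0_norm; nra.
Qed.

Lemma sqintZ (a : R) h : sqint h -> sqint (fun x => a * h x).
Proof.
move=> [mh ih]; split; first exact: measurable_funM.
have := integrableZl measurableT (a ^+ 2) ih.
by apply: eq_integrable => // x _; rewrite exprMn EFinM.
Qed.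

Lemma sqintB g h : sqint g -> sqint h -> sqint (fun x => g x - h x).
Proof.
move=> sg sh; have := sqintD sg (sqintZ (-1) sh).
by under [X in sqint X]eq_fun do rewrite mulN1r.
Qed.

Lemma sqint0 : sqint (fun=> 0).
Proof.
split => //; have := @integrable0 _ _ _ mu setT.
by apply: eq_integrable => // x _; rewrite expr0n.
Qed.

Lemma sqint_sum (I : Type) (s : seq I) (F : I -> T -> R) :
  (forall i, sqint (F i)) -> sqint (fun x => \sum_(i <- s) F i x).
Proof.
move=> sF; elim: s => [|i s IHs].
  by under eq_fun do rewrite big_nil; exact: sqint0.
by under eq_fun do rewrite big_cons; exact: sqintD.
Qed.

Lemma le_sqint g h : measurable_fun setT g -> sqint h ->
  (forall x, `|g x| <= `|h x|) -> sqint g.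
Proof.
move=> mg [mh ih] gh; split => //; apply: (le_integrable measurableT _ _ ih).
  by apply/measurable_EFinP; exact: measurable_funX.
by move=> x _ /=; rewrite lee_fin !normrX lerXn2r ?nnegrE.
Qed.

Lemma ipC g h : ip g h = ip h g.
Proof. by rewrite /ip; under eq_Rintegral do rewrite mulrC. Qed.

Lemma ipDl f g h : sqint f -> sqint g -> sqint h ->
  ip (fun x => f x + g x) h = ip f h + ip g h.
Proof.
move=> sf sg sh; rewrite /ip; under eq_Rintegral do rewrite mulrDl.
by rewrite RintegralD//; exact: sqint_mul.
Qed.

Lemma ipZl a g h : sqint g -> sqint h -> ip (fun x => a * g x) h = a * ip g h.
Proof.
move=> sg sh; rewrite /ip; under eq_Rintegral do rewrite -mulrA.
by rewrite RintegralZl//; exact: sqint_mul.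
Qed.

Lemma ipBl f g h : sqint f -> sqint g -> sqint h ->
  ip (fun x => f x - g x) h = ip f h - ip g h.
Proof.
move=> sf sg sh; rewrite /ip; under eq_Rintegral do rewrite mulrBl.
by rewrite RintegralB//; exact: sqint_mul.
Qed.

Lemma ipDr f g h : sqint f -> sqint g -> sqint h ->
  ip h (fun x => f x + g x) = ip h f + ip h g.
Proof. by move=> sf sg sh; rewrite ipC ipDl// !(ipC h). Qed.

Lemma ipBr f g h : sqint f -> sqint g -> sqint h ->
  ip h (fun x => f x - g x) = ip h f - ip h g.
Proof. by move=> sf sg sh; rewrite ipC ipBl// !(ipC h). Qed.

Lemma ipZr a g h : sqint g -> sqint h -> ip h (fun x => a * g x) = a * ip h g.
Proof. by move=> sg sh; rewrite ipC ipZl// ipC. Qed.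

Lemma ip_suml (I : Type) (s : seq I) (F : I -> T -> R) h :
  (forall i, sqint (F i)) -> sqint h ->
  ip (fun x => \sum_(i <- s) F i x) h = \sum_(i <- s) ip (F i) h.
Proof.
move=> sF sh; elim: s => [|i s IHs].
  rewrite big_nil /ip; under eq_Rintegral do rewrite big_nil mul0r.
  by rewrite Rintegral_cst// mul0r.
rewrite big_cons -IHs -ipDl//; last exact: sqint_sum.
by rewrite /ip; under eq_Rintegral do rewrite big_cons.
Qed.

Lemma ip_sumr (I : Type) (s : seq I) (F : I -> T -> R) h :
  (forall i, sqint (F i)) -> sqint h ->
  ip h (fun x => \sum_(i <- s) F i x) = \sum_(i <- s) ip h (F i).
Proof.
by move=> sF sh; rewrite ipC ip_suml//; apply: eq_bigr => i _; rewrite ipC.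
Qed.

Lemma ip_ge0 h : 0 <= ip h h.
Proof. by apply: Rintegral_ge0 => x _; rewrite -expr2 sqr_ge0. Qed.

Lemma ip_sqrD g h : sqint g -> sqint h ->
  ip (fun x => g x + h x) (fun x => g x + h x) = ip g g + 2 * ip g h + ip h h.
Proof.
move=> sg sh; have sgh := sqintD sg sh.
by rewrite ipDl// !ipDr// (ipC h g); ring.
Qed.

Lemma ip_sqrB g h : sqint g -> sqint h ->
  ip (fun x => g x - h x) (fun x => g x - h x) = ip g g - 2 * ip g h + ip h h.
Proof.
move=> sg sh; have sgh := sqintB sg sh.
by rewrite ipBl// !ipBr// (ipC h g); ring.
Qed.

(** The discriminant argument: t |-> ip (g + t h) (g + t h) is a nonnegative
    polynomial of degree two in t. *)
Lemma cauchy_schwarz g h : sqint g -> sqint h ->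
  ip g h ^+ 2 <= ip g g * ip h h.
Proof.
move=> sg sh.
have quad (t : R) : 0 <= ip g g + 2 * (t * ip g h) + t ^+ 2 * ip h h.
  have := ip_ge0 (fun x => g x + t * h x).
  have sth := sqintZ t sh.
  by rewrite ip_sqrD// ipZr// ipZl// ipZr// expr2 => H; lra.
have g0 := ip_ge0 g; have h0 := ip_ge0 h.
(* If h has norm 0 the polynomial is affine, and it can only be bounded below
   when its slope vanishes. *)
have [hh0|hh0] := eqVneq (ip h h) 0.
  rewrite hh0 mulr0.
  have {}quad t : 0 <= ip g g + 2 * (t * ip g h) by have := quad t; rewrite hh0 mulr0 addr0.
  have [->|gh0] := eqVneq (ip g h) 0; first by rewrite expr0n.
  have := quad (- (ip g g + 1) / (2 * ip g h)).
  have -> : 2 * (- (ip g g + 1) / (2 * ip g h) * ip g h) = - (ip g g + 1).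
    by field; rewrite gh0.
  lra.
have hp : 0 < ip h h by rewrite lt_def hh0.
have := quad (- ip g h / ip h h).
have -> : ip g g + 2 * (- ip g h / ip h h * ip g h) + (- ip g h / ip h h) ^+ 2 * ip h h
  = (ip g g * ip h h - ip g h ^+ 2) / ip h h by field.
by rewrite pmulr_lge0 ?invr_gt0// subr_ge0.
Qed.

Lemma cauchy_schwarz_norm g h : sqint g -> sqint h ->
  `|ip g h| <= Num.sqrt (ip g g) * Num.sqrt (ip h h).
Proof.
move=> sg sh; rewrite -sqrtrM ?ip_ge0// -sqrtr_sqr ler_wsqrtr//.
exact: cauchy_schwarz.
Qed.

(** Joint continuity: expand the product around the limits and bound each of the
    three error terms by Cauchy-Schwarz. *)
Lemma ip_cvg (g_ h_ : (T -> R)^nat) g h :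
  (forall n, sqint (g_ n)) -> (forall n, sqint (h_ n)) -> sqint g -> sqint h ->
  ip (fun x => g_ n x - g x) (fun x => g_ n x - g x) @[n --> \oo] --> 0 ->
  ip (fun x => h_ n x - h x) (fun x => h_ n x - h x) @[n --> \oo] --> 0 ->
  ip (g_ n) (h_ n) @[n --> \oo] --> ip g h.
Proof.
move=> sgn shn sg sh cg ch.
pose dg n x := g_ n x - g x; pose dh n x := h_ n x - h x.
have sdg n : sqint (dg n) by exact: sqintB.
have sdh n : sqint (dh n) by exact: sqintB.
have sqrt0 (u : R^nat) : u @ \oo --> (0 : R) -> Num.sqrt (u n) @[n --> \oo] --> (0 : R).
  move=> u0; rewrite -[X in _ --> X]sqrtr0.
  by apply: continuous_cvg => //; exact: sqrt_continuous.
have /(sqrt0 _) Cg := cg; have /(sqrt0 _) Ch := ch.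
apply/subr_cvg0; apply: norm_cvg0.
pose B n := Num.sqrt (ip (dg n) (dg n)) * Num.sqrt (ip (dh n) (dh n))
  + Num.sqrt (ip g g) * Num.sqrt (ip (dh n) (dh n))
  + Num.sqrt (ip (dg n) (dg n)) * Num.sqrt (ip h h).
have B0 : B n @[n --> \oo] --> (0 : R).
  rewrite [X in _ --> X](_ : 0 = 0 * 0 + Num.sqrt (ip g g) * 0 + 0 * Num.sqrt (ip h h)); last by ring.
  apply: cvgD; [apply: cvgD; apply: cvgM => //|apply: cvgM => //]; exact: cvg_cst.
apply: (squeeze_cvgr _ (cvg_cst 0) B0).
apply: nearW => n; rewrite /= normr_ge0/=.
have -> : ip (g_ n) (h_ n) - ip g h = ip (dg n) (dh n) + ip g (dh n) + ip (dg n) h.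
  have sdgn := sdg n; rewrite /dg in sdgn; rewrite /dg /dh (ipBr (shn n) sh sdgn) (ipBr (shn n) sh sg) !(ipBl (sgn n) sg)//; ring.
rewrite (le_trans (ler_normD _ _))// lerD ?cauchy_schwarz_norm//.
by rewrite (le_trans (ler_normD _ _))// lerD ?cauchy_schwarz_norm.
Qed.

Lemma Lfun2_sqint h : h \in Lfun mu 2%:E -> sqint h.
Proof.
move=> h2; split; last exact: Lfun2_integrable_sqr.
by move: h2; rewrite inE => /andP[]; rewrite inE.
Qed.

Lemma Lnorm2_ip h : sqint h -> ('N[mu]_2%:E[EFin \o h] = (Num.sqrt (ip h h))%:E)%E.
Proof.
move=> sh; have [mh ih] := sh.
have -> : (Num.sqrt (ip h h))%:E = ((ip h h)%:E `^ 2^-1)%E.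
  by rewrite poweR_EFin powR12_sqrt// ip_ge0.
have -> : (ip h h)%:E = (\int[mu]_x `|(EFin \o h) x| `^ 2)%E.
  rewrite /ip /Rintegral fineK; last exact: integrable_fin_num (sqint_mul sh sh).
  apply: eq_integral => x _ /=.
  by rewrite powR_mulrn// -normrX ger0_norm ?sqr_ge0// expr2.
by rewrite unlock.
Qed.

(** The bridge from convergence to 0 in L^2-norm to inner products. *)
Lemma Lnorm2_cvg0 (h : (T -> R)^nat) : (forall n, sqint (h n)) ->
  ('N[mu]_2%:E[EFin \o h n])%E @[n --> \oo] --> 0%E ->
  ip (h n) (h n) @[n --> \oo] --> (0 : R).
Proof.
move=> sh; under eq_fun do rewrite Lnorm2_ip//.
move=> /fine_cvgP[_]; under eq_fun do rewrite /=.
move=> c0; have <- : 0 * 0 = 0 :> R by rewrite mul0r.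
rewrite (_ : (fun n => ip (h n) (h n)) =
    (fun n => Num.sqrt (ip (h n) (h n)) * Num.sqrt (ip (h n) (h n)))).
  exact: (cvgM c0 c0).
by apply/funext => n; rewrite -expr2 sqr_sqrtr// ip_ge0.
Qed.

End square_integrable.

Section dominated.
Context d (T : measurableType d) (R : realType) (mu : {measure set T -> \bar R}).

Lemma RintegrableZl (D : set T) (k : R) (f : T -> R) : measurable D ->
  mu.-integrable D (EFin \o f) -> mu.-integrable D (EFin \o (fun x => k * f x)).
Proof.
move=> mD intf; have := integrableZl mD k intf.
by apply: eq_integrable => // x _; rewrite /= EFinM.
Qed.

Lemma RintegrableD (D : set T) (f g : T -> R) : measurable D ->
  mu.-integrable D (EFin \o f) -> mu.-integrable D (EFin \o g) ->
  mu.-integrable D (EFin \o (fun x => f x + g x)).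
Proof.
move=> mD intf intg; have := integrableD mD intf intg.
by apply: eq_integrable => // x _; rewrite /= EFinD.
Qed.

Lemma RintegrableB (D : set T) (f g : T -> R) : measurable D ->
  mu.-integrable D (EFin \o f) -> mu.-integrable D (EFin \o g) ->
  mu.-integrable D (EFin \o (fun x => f x - g x)).
Proof.
move=> mD intf intg; have := integrableB mD intf intg.
by apply: eq_integrable => // x _; rewrite /= EFinB.
Qed.

Lemma le_Rintegrable (D : set T) (f g : T -> R) : measurable D ->
  measurable_fun D f -> mu.-integrable D (EFin \o g) ->
  (forall x, D x -> `|f x| <= g x) -> mu.-integrable D (EFin \o f).
Proof.
move=> mD mf intg fg; apply: (le_integrable mD _ _ intg); first exact/measurable_EFinP.
by move=> x Dx; rewrite /= lee_fin (le_trans (fg _ Dx))// ler_norm.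
Qed.

Lemma Rintegral_sum (I : Type) (s : seq I) (F : I -> T -> R) (D : set T) :
  measurable D -> (forall i, mu.-integrable D (EFin \o F i)) ->
  mu.-integrable D (EFin \o (fun x => \sum_(i <- s) F i x)) /\
  \int[mu]_(x in D) (\sum_(i <- s) F i x) = \sum_(i <- s) \int[mu]_(x in D) F i x.
Proof.
move=> mD iF; elim: s => [|i s [IHi IHs]].
  split; last by rewrite big_nil; under eq_Rintegral do rewrite big_nil; rewrite Rintegral_cst// mul0r.
  by under [X in EFin \o X]eq_fun do rewrite big_nil; exact: integrable0.
under [X in EFin \o X]eq_fun do rewrite big_cons.
split; first exact: RintegrableD.
by under eq_Rintegral do rewrite big_cons; rewrite big_cons RintegralD// IHs.
Qed.

Lemma Rdominated_cvg (D : set T) (f_ : (T -> R)^nat) (f g : T -> R) :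
  measurable D -> (forall n, measurable_fun D (f_ n)) ->
  (forall x, D x -> f_ n x @[n --> \oo] --> f x) ->
  mu.-integrable D (EFin \o g) -> (forall n x, D x -> `|f_ n x| <= g x) ->
  mu.-integrable D (EFin \o f) /\
  (\int[mu]_(x in D) f_ n x @[n --> \oo] --> \int[mu]_(x in D) f x).
Proof.
move=> mD mf_ ff ig fg.
have mf : measurable_fun D (EFin \o f).
  apply: (@emeasurable_fun_cvg _ _ _ _ (fun n x => (f_ n x)%:E)) => [n|x Dx].
    exact/measurable_EFinP.
  by apply: cvg_EFin; [exact: nearW|exact: ff].
have mfe n : measurable_fun D (fun x => (f_ n x)%:E) by exact/measurable_EFinP.
have ffe : {ae mu, forall x, D x -> (f_ n x)%:E @[n --> \oo] --> (f x)%:E}.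
  by apply: aeW => x Dx; apply: cvg_EFin; [exact: nearW|exact: ff].
have fge : {ae mu, forall x n, D x -> (`|(f_ n x)%:E| <= (g x)%:E)%E}.
  by apply: aeW => x n Dx; rewrite lee_fin fg.
have [intf _ cv] := dominated_convergence mD mfe mf ffe ig fge.
split=> //; apply: fine_cvg; rewrite fineK//; exact: integrable_fin_num.
Qed.

Lemma Rdominated_cvg_ae (D : set T) (f_ : (T -> R)^nat) (f g : T -> R) :
  measurable D -> (forall n, measurable_fun D (f_ n)) -> measurable_fun D f ->
  {ae mu, forall x, D x -> f_ n x @[n --> \oo] --> f x} ->
  mu.-integrable D (EFin \o g) -> (forall n x, D x -> `|f_ n x| <= g x) ->
  \int[mu]_(x in D) f_ n x @[n --> \oo] --> \int[mu]_(x in D) f x.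
Proof.
move=> mD mf_ mf ff ig fg.
have mfe n : measurable_fun D (fun x => (f_ n x)%:E) by exact/measurable_EFinP.
have ffe : {ae mu, forall x, D x -> (f_ n x)%:E @[n --> \oo] --> (f x)%:E}.
  by apply: filterS ff => x fx Dx; apply: cvg_EFin; [exact: nearW|exact: fx].
have fge : {ae mu, forall x n, D x -> (`|(f_ n x)%:E| <= (g x)%:E)%E}.
  by apply: aeW => x n Dx; rewrite lee_fin fg.
have mfE : measurable_fun D (EFin \o f) by exact/measurable_EFinP.
have [intf _ cv] := dominated_convergence mD mfe mfE ffe ig fge.
by apply: fine_cvg; rewrite fineK//; exact: integrable_fin_num.
Qed.

End dominated.

Section probability_integrals.
Context d (T : measurableType d) (R : realType) (P : probability T R).

Lemma bounded_integrable (f : T -> R) (M : R) : measurable_fun setT f ->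
  (forall x, `|f x| <= M) -> P.-integrable setT (EFin \o f).
Proof.
move=> mf fM; apply: measurable_bounded_integrable => //.
  by rewrite (le_lt_trans (probability_le1 P _))// ltry.
exists M; split; first exact: num_real.
by move=> x Mx y _ /=; apply: (le_trans (fM y)); exact: ltW.
Qed.

Lemma Rintegral_cstP (r : R) : \int[P]_w r = r.
Proof.
rewrite Rintegral_cst// -[RHS]mulr1; congr (r * _).
by apply: (@congr1 _ _ fine _ 1%E); exact: probability_setT.
Qed.

Lemma sqint_cst (r : R) : sqint P (fun=> r).
Proof. by split=> //; exact: (@bounded_integrable _ `|r ^+ 2|). Qed.

Lemma sqint_integrable (f : T -> R) : sqint P f -> P.-integrable setT (EFin \o f).
Proof.
move=> sf; have := sqint_mul sf (sqint_cst 1).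
by under [X in _.-integrable _ (EFin \o X)]eq_fun do rewrite mulr1.
Qed.

Lemma Rintegral_le_ip (f : T -> R) : sqint P f ->
  `|\int[P]_w f w| <= Num.sqrt (ip P f f).
Proof.
move=> sf; have := cauchy_schwarz_norm sf (sqint_cst 1).
rewrite {1 3}/ip; under eq_Rintegral do rewrite mulr1.
by rewrite Rintegral_cstP mulr1 sqrtr1 mulr1.
Qed.

(** Cauchy-Schwarz against the constant 1, whose norm is 1 for a probability. *)
Lemma Rintegral_norm_le_ip (f : T -> R) : sqint P f ->
  \int[P]_w `|f w| <= Num.sqrt (ip P f f).
Proof.
move=> sf; have sn : sqint P (fun x => `|f x|).
  by apply: (le_sqint _ sf) => [|x]; [exact: measurableT_comp (proj1 sf)|rewrite normr_id].
have := Rintegral_le_ip sn; rewrite ger0_norm; last exact: Rintegral_ge0.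
have -> // : ip P (fun x => `|f x|) (fun x => `|f x|) = ip P f f.
by apply: eq_Rintegral => x _; rewrite -normrM ger0_norm// -expr2 sqr_ge0.
Qed.

End probability_integrals.

(** * Lebesgue measure under affine maps and the normal characteristic function *)

Section lebesgue_affine.
Context (R : realType).
Notation mu := (@lebesgue_measure R).

(** The translate of Lebesgue measure gives intervals their length, which
    characterizes Lebesgue measure. *)
Lemma lebesgue_measure_shift (c : R) (A : set R) : measurable A ->
  mu ((fun x => x + c) @^-1` A) = mu A.
Proof.
move=> mA.
have mphi : measurable_fun [set: measurableTypeR R] ((fun x => x + c) : measurableTypeR R -> measurableTypeR R).
  exact: measurable_funD.
pose phi : {mfun measurableTypeR R >-> measurableTypeR R} :=
  HB.pack ((fun x => x + c) : measurableTypeR R -> measurableTypeR R)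
    (isMeasurableFun.Build _ _ _ _ _ mphi).
apply/esym; apply: (@lebesgue_measure_unique _ (pushforward mu phi)) => //= _ [[a b]] _ <-.
rewrite /pushforward /=.
have -> : (fun x => x + c) @^-1` `]a, b]%classic = `]a - c, b - c]%classic.
  by apply/seteqP; split => x /=; rewrite !in_itv/=; lra.
by rewrite !lebesgue_measure_itv/= !lte_fin ltrD2r -!EFinD; case: ifP => // _; congr (_%:E); ring.
Qed.

Lemma ge0_integral_shift (c : R) (f : R -> \bar R) : measurable_fun setT f ->
  (forall x, (0 <= f x)%E) -> (\int[mu]_x f (x + c)%R = \int[mu]_x f x)%E.
Proof.
move=> mf f0.
have mphi : measurable_fun [set: measurableTypeR R] ((fun x => x + c) : measurableTypeR R -> measurableTypeR R).
  exact: measurable_funD.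
rewrite -[LHS](ge0_integral_pushforward mphi mu measurableT mf) ?preimage_setT//.
apply: eq_measure_integral => A mA _.
exact: lebesgue_measure_shift.
Qed.

Lemma ge0_integral_opp (f : R -> \bar R) : measurable_fun setT f ->
  (forall x, (0 <= f x)%E) -> (\int[mu]_x f (- x)%R = \int[mu]_x f x)%E.
Proof.
move=> mf f0.
have mphi : measurable_fun [set: measurableTypeR R] ((-%R) : measurableTypeR R -> measurableTypeR R).
  exact: oppr_measurable.
rewrite -[LHS](ge0_integral_pushforward mphi mu measurableT mf) ?preimage_setT//.
apply: eq_measure_integral => A mA _.
exact: lebesgue_measureN.
Qed.

Lemma integral_shift (c : R) (f : R -> \bar R) : measurable_fun setT f ->
  (\int[mu]_x f (x + c)%R = \int[mu]_x f x)%E.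
Proof.
move=> mf; rewrite integralE [RHS]integralE; congr (_ - _)%E.
- rewrite -[RHS](ge0_integral_shift c (measurable_funepos mf)); first by congr integral; apply/funext => x; rewrite ?funeposE ?funenegE.
  by move=> x; exact: funepos_ge0.
- rewrite -[RHS](ge0_integral_shift c (measurable_funeneg mf)); first by congr integral; apply/funext => x; rewrite ?funeposE ?funenegE.
  by move=> x; exact: funeneg_ge0.
Qed.

Lemma integral_opp (f : R -> \bar R) : measurable_fun setT f ->
  (\int[mu]_x f (- x)%R = \int[mu]_x f x)%E.
Proof.
move=> mf; rewrite integralE [RHS]integralE; congr (_ - _)%E.
- rewrite -[RHS](ge0_integral_opp (measurable_funepos mf)); first by congr integral; apply/funext => x; rewrite ?funeposE ?funenegE.
  by move=> x; exact: funepos_ge0.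
- rewrite -[RHS](ge0_integral_opp (measurable_funeneg mf)); first by congr integral; apply/funext => x; rewrite ?funeposE ?funenegE.
  by move=> x; exact: funeneg_ge0.
Qed.

Lemma Rintegral_shift (c : R) (f : R -> R) : measurable_fun setT f ->
  \int[mu]_x f (x + c) = \int[mu]_x f x.
Proof. by move=> mf; congr fine; apply: (@integral_shift c (EFin \o f)); exact/measurable_EFinP. Qed.

Lemma Rintegral_opp (f : R -> R) : measurable_fun setT f ->
  \int[mu]_x f (- x) = \int[mu]_x f x.
Proof. by move=> mf; congr fine; apply: (@integral_opp (EFin \o f)); exact/measurable_EFinP. Qed.

End lebesgue_affine.

Section measurable_trigonometric.
Context d (T : measurableType d) (R : realType).

Lemma measurable_fun_cos (D : set T) (f : T -> R) :
  measurable_fun D f -> measurable_fun D (fun x => cos (f x)).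
Proof.
by apply: measurableT_comp; apply: continuous_measurable_fun; exact: continuous_cos.
Qed.

Lemma measurable_fun_sin (D : set T) (f : T -> R) :
  measurable_fun D f -> measurable_fun D (fun x => sin (f x)).
Proof.
by apply: measurableT_comp; apply: continuous_measurable_fun; exact: continuous_sin.
Qed.

End measurable_trigonometric.

Section normal_characteristic_function.
Context (R : realType).
Notation mu := (@lebesgue_measure R).
Implicit Types m s x y l : R.

Let expR_bound x : x <= expR x.
Proof. by rewrite (le_trans _ (expR_ge1Dx x))// lerDr. Qed.

(** The factor (y - m)^2 is absorbed by doubling the standard deviation. This
    replaces the computation of the variance: an upper bound of the right order
    is enough for mollification. *)
Lemma normal_pdf_sqr_le m s y : 0 < s ->
  (y - m) ^+ 2 * normal_pdf m s y <= 8 * s ^+ 2 * normal_pdf m (2 * s) y.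
Proof.
move=> s0; have s20 : 2 * s != 0 by rewrite mulf_neq0// gt_eqF.
rewrite !normal_pdfE ?gt_eqF ?mulr_gt0// /normal_peak /normal_fun.
have -> : Num.sqrt ((2 * s) ^+ 2 * pi *+ 2) = 2 * Num.sqrt (s ^+ 2 * pi *+ 2).
  rewrite exprMn -mulrA -mulrnAr sqrtrM ?sqr_ge0// sqrtr_sqr gtr0_norm// mulr_gt0.
set c := Num.sqrt _; set z := (y - m) ^+ 2.
have c0 : 0 < c by rewrite sqrtr_gt0 mulrn_wgt0// mulr_gt0 ?pi_gt0// exprn_gt0.
have z0 : 0 <= z by exact: sqr_ge0.
have -> : - z / (s ^+ 2 *+ 2) = - z / ((2 * s) ^+ 2 *+ 2) + - (3 * z / (8 * s ^+ 2)).
  by field; rewrite gt_eqF.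
rewrite expRD [leRHS](_ : _ = (4 * s ^+ 2) * (c^-1 * expR (- z / ((2 * s) ^+ 2 *+ 2)))); last first.
  by field; rewrite gt_eqF.
rewrite mulrA [leLHS](_ : _ = (z * expR (- (3 * z / (8 * s ^+ 2)))) * (c^-1 * expR (- z / ((2 * s) ^+ 2 *+ 2)))); last by ring.
apply: ler_wpM2r; first by rewrite mulr_ge0 ?expR_ge0// invr_ge0 ltW.
rewrite expRN ler_pdivrMr ?expR_gt0//.
apply: (@le_trans _ _ (4 * s ^+ 2 * (3 * z / (8 * s ^+ 2)))).
  have -> : 4 * s ^+ 2 * (3 * z / (8 * s ^+ 2)) = 3 / 2 * z by field; rewrite gt_eqF.
  by lra.
by rewrite ler_wpM2l ?expR_bound// mulr_ge0 ?sqr_ge0.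
Qed.

Lemma integrable_normal_sqr m s : 0 < s ->
  mu.-integrable setT (EFin \o (fun y => (y - m) ^+ 2 * normal_pdf m s y)).
Proof.
move=> s0; apply: (le_integrable measurableT _ _
  (integrableZl measurableT (8 * s ^+ 2) (integrable_normal_pdf m (2 * s)))).
  apply/measurable_EFinP; apply: measurable_funM; last exact: measurable_normal_pdf.
  by apply: measurable_funX; exact: measurable_funB.
move=> y _ /=; rewrite lee_fin !ger0_norm ?normal_pdf_sqr_le//.
- by apply: mulr_ge0; rewrite ?normal_pdf_ge0// mulr_ge0// sqr_ge0.
- by apply: mulr_ge0; rewrite ?normal_pdf_ge0// sqr_ge0.
Qed.

Lemma Rintegral_normal_pdf m s : \int[mu]_y normal_pdf m s y = 1.
Proof. by rewrite /Rintegral integral_normal_pdf. Qed.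

Lemma Rintegral_normal_sqr_le m s : 0 < s ->
  \int[mu]_y ((y - m) ^+ 2 * normal_pdf m s y) <= 8 * s ^+ 2.
Proof.
move=> s0; have i2 := integrable_normal_pdf m (2 * s).
apply: (@le_trans _ _ (\int[mu]_y (8 * s ^+ 2 * normal_pdf m (2 * s) y))); last first.
  by rewrite RintegralZl// Rintegral_normal_pdf mulr1.
apply: le_Rintegral => //; first exact: integrable_normal_sqr.
  exact: RintegrableZl.
by move=> y _; exact: normal_pdf_sqr_le.
Qed.

Lemma integrable_normal_mul m s (h : R -> R) : measurable_fun setT h ->
  0 < s -> (forall y, `|h y| <= 1 + (y - m) ^+ 2) ->
  mu.-integrable setT (EFin \o (fun y => h y * normal_pdf m s y)).
Proof.
move=> mh s0 hle; apply: (le_integrable measurableT _ _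
  (integrableD measurableT (integrable_normal_pdf m s) (integrable_normal_sqr m s0))).
  apply/measurable_EFinP; apply: measurable_funM => //; exact: measurable_normal_pdf.
move=> y _ /=; rewrite lee_fin normrM (ger0_norm (normal_pdf_ge0 _ _ _)).
have n0 := normal_pdf_ge0 m s y; have y0 := sqr_ge0 (y - m).
by rewrite [leRHS]ger0_norm; have := hle y; nra.
Qed.

(** Integration by parts over the whole line, with the product under the
    derivative: integrate over [-n, n] and let n tend to infinity. *)
Lemma Rintegral_derivative_eq0 (F f : R -> R) :
  (forall x, is_derive x 1 F (f x)) -> continuous f ->
  mu.-integrable setT (EFin \o f) ->
  F n.+1%:R @[n --> \oo] --> 0 -> F (- n.+1%:R) @[n --> \oo] --> 0 ->
  \int[mu]_x f x = 0.
Proof.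
move=> dF cf intf Fy FNy.
pose D n : set R := `[- n.+1%:R, n.+1%:R]%classic.
have mf : measurable_fun setT f by exact: continuous_measurable_fun.
have cF : continuous F.
  move=> x; apply: differentiable_continuous; apply/derivable1_diffP.
  by have [] := dF x.
have FTC n : \int[mu]_(x in D n) f x = F n.+1%:R - F (- n.+1%:R).
  rewrite /Rintegral (@continuous_FTC2 _ f F)//.
  - by rewrite (@lt_trans _ _ 0)// ?oppr_lt0 ?ltr0Sn.
  - exact: continuous_subspaceT.
  - split.
    + by move=> x _; have [] := dF x.
    + by apply: cvg_at_right_filter; exact: cF.
    + by apply: cvg_at_left_filter; exact: cF.
  - by move=> x _; rewrite derive1E; have [_ ->] := dF x.
have mfn n : measurable_fun setT (f \_ (D n)).
  exact: (proj1 (measurable_restrictT f (measurable_itv _)) (measurable_funTS mf)).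
have cfn x : setT x -> (f \_ (D n)) x @[n --> \oo] --> f x.
  move=> _; apply: cvg_near_cst; near=> n.
  rewrite patchE mem_set// /D /= in_itv/= -ler_norml.
  have : `|x| <= n%:R by near: n; exact: nbhs_infty_ger.
  by move=> /le_trans; apply; rewrite ler_nat.
have dfn n x : setT x -> `|(f \_ (D n)) x| <= `|f x|.
  by move=> _; rewrite patchE; case: ifP => // _; rewrite normr0.
have [_ cvg1] := @Rdominated_cvg _ _ _ mu _ _ _ _ measurableT mfn cfn (integrable_norm intf) dfn.
have cvg2 : \int[mu]_x (f \_ (D n)) x @[n --> \oo] --> (0 - 0 : R).
  under eq_fun do rewrite -Rintegral_mkcond FTC.
  exact: cvgB.
rewrite subr0 in cvg2.
exact: (cvg_unique _ cvg1 cvg2).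
Unshelve. all: by end_near. Qed.

Lemma is_derive_normal_pdf s x : 0 < s ->
  is_derive x 1 (normal_pdf 0 s) (- (x / s ^+ 2) * normal_pdf 0 s x).
Proof.
move=> s0; rewrite normal_pdfE ?gt_eqF// /normal_fun.
apply: trigger_derive; rewrite /GRing.scale/=.
by field; rewrite gt_eqF.
Qed.

Lemma normal_pdf_cvg0 s : 0 < s -> normal_pdf 0 s n.+1%:R @[n --> \oo] --> 0.
Proof.
move=> s0.
apply: (@squeeze_cvgr _ _ _ _ (cst 0) (fun n => (normal_peak s * (2 * s ^+ 2)) * n.+1%:R^-1)).
- apply: nearW => n; rewrite normal_pdf_ge0/= normal_pdfE ?gt_eqF// -mulrA.
  rewrite ler_wpM2l ?normal_peak_ge0// /normal_fun subr0.
  set N : R := n.+1%:R; have N1 : 1 <= N by rewrite ler1n.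
  have N0 : 0 < N by rewrite ltr0n.
  rewrite mulNr expRN; set z := N ^+ 2 / _.
  have z0 : 0 < z by apply: divr_gt0; rewrite ?pmulrn_lgt0// exprn_gt0.
  apply: (@le_trans _ _ z^-1); first by rewrite lef_pV2 ?posrE ?expR_gt0// expR_bound.
  rewrite /z invf_div -mulr_natl ler_pM2l ?mulr_gt0 ?exprn_gt0//.
  by rewrite lef_pV2 ?posrE ?exprn_gt0// expr2 ler_peMl// ltW.
- exact: cvg_cst.
- rewrite -[X in _ --> X](mulr0 (normal_peak s * (2 * s ^+ 2))).
  by apply: cvgM; [exact: cvg_cst|exact: cvg_harmonic].
Qed.

Lemma normal_pdf_even s x : 0 < s -> normal_pdf 0 s (- x) = normal_pdf 0 s x.
Proof. by move=> s0; rewrite normal_pdfE ?gt_eqF// /normal_fun !subr0 sqrrN. Qed.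

Let sin_le1' x : `|sin x| <= 1. Proof. by rewrite sin_max. Qed.
Let cos_le1' x : `|cos x| <= 1. Proof. by rewrite cos_max. Qed.

Let integrable_bounded_normal s (h : R -> R) : 0 < s -> measurable_fun setT h ->
  (forall y, `|h y| <= 1) -> mu.-integrable setT (EFin \o (fun y => h y * normal_pdf 0 s y)).
Proof.
move=> s0 mh h1; apply: integrable_normal_mul => // y.
by rewrite (le_trans (h1 y))// lerDl sqr_ge0.
Qed.

Let integrable_id_normal s (h : R -> R) : 0 < s -> measurable_fun setT h ->
  (forall y, `|h y| <= 1) -> mu.-integrable setT (EFin \o (fun y => y * h y * normal_pdf 0 s y)).
Proof.
move=> s0 mh h1; apply: integrable_normal_mul => //.
  exact: measurable_funM.
move=> y; rewrite subr0 normrM (le_trans (ler_wpM2l (normr_ge0 _) (h1 y)))// mulr1.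
by rewrite -(real_normK (num_real y)); have := sqr_ge0 (`|y| - 1); nra.
Qed.

Let measurable_cosl l : measurable_fun setT (fun y : R => cos (l * y)).
Proof. by apply: measurable_fun_cos; exact: measurable_funM. Qed.

Let measurable_sinl l : measurable_fun setT (fun y : R => sin (l * y)).
Proof. by apply: measurable_fun_sin; exact: measurable_funM. Qed.

(** Integration by parts with the primitive sin (l y) normal_pdf 0 s y, since the
    density satisfies p' = - y p / s^2. *)
Let normal_parts s l : 0 < s ->
  \int[mu]_y (y * sin (l * y) * normal_pdf 0 s y) =
  s ^+ 2 * (l * \int[mu]_y (cos (l * y) * normal_pdf 0 s y)).
Proof.
move=> s0; have s20 : s ^+ 2 != 0 by rewrite expf_neq0// gt_eqF.
pose f y := l * (cos (l * y) * normal_pdf 0 s y) -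
            s ^- 2 * (y * sin (l * y) * normal_pdf 0 s y).
have i1 := integrable_bounded_normal s0 (measurable_cosl l) (fun y => cos_le1' (l * y)).
have i2 := integrable_id_normal s0 (measurable_sinl l) (fun y => sin_le1' (l * y)).
suff : \int[mu]_y f y = 0.
  rewrite RintegralB//; try exact: RintegrableZl.
  rewrite !RintegralZl// => /eqP; rewrite subr_eq0 => /eqP ->.
  by rewrite mulVKf.
have cn := @continuous_normal_pdf R 0 s (lt0r_neq0 s0).
apply: (@Rintegral_derivative_eq0 (fun y => sin (l * y) * normal_pdf 0 s y)).
- move=> y; have dn := is_derive_normal_pdf y s0.
  apply: trigger_derive; rewrite /GRing.scale/= /f; field.
  by rewrite gt_eqF.
- move=> y; apply: cvgB.
    apply: cvgM; [exact: cvg_cst|apply: cvgM; last exact: cn].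
    apply: continuous_comp; last exact: continuous_cos.
    exact: mulrl_continuous.
  apply: cvgM; [exact: cvg_cst|apply: cvgM; last exact: cn].
  apply: cvgM; first exact: cvg_id.
  by apply: continuous_comp; [exact: mulrl_continuous|exact: continuous_sin].
- by apply: RintegrableB => //; exact: RintegrableZl.
- apply: norm_cvg0; apply: (squeeze_cvgr _ (cvg_cst 0) (normal_pdf_cvg0 s0)).
  apply: nearW => n; rewrite normr_ge0/= normrM (ger0_norm (normal_pdf_ge0 _ _ _)).
  by rewrite ler_piMl ?normal_pdf_ge0.
- apply: norm_cvg0; apply: (squeeze_cvgr _ (cvg_cst 0) (normal_pdf_cvg0 s0)).
  apply: nearW => n; rewrite normr_ge0/= normrM (ger0_norm (normal_pdf_ge0 _ _ _)).
  by rewrite normal_pdf_even// ler_piMl ?normal_pdf_ge0.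
Qed.

(** As a function C of l, the cosine transform satisfies C' = - s^2 l C (derive
    under the integral sign, then normal_parts) and C 0 = 1. *)
Lemma normal_cos s l : 0 < s ->
  \int[mu]_y (cos (l * y) * normal_pdf 0 s y) = expR (- (s ^+ 2 * l ^+ 2 / 2)).
Proof.
move=> s0.
pose C l := \int[mu]_y (cos (l * y) * normal_pdf 0 s y).
pose f (t y : R) := cos (t * y) * normal_pdf 0 s y.
have df (t y : R) : is_derive t (1:R) (f ^~ y) (- (y * sin (t * y) * normal_pdf 0 s y)).
  by rewrite /f; apply: trigger_derive; rewrite /GRing.scale/=; ring.
have d1f (t y : R) : partial1of2 f t y = - (y * sin (t * y) * normal_pdf 0 s y).
  by rewrite partial1of2E; have [_ ->] := df t y.
have dC (t : R) : is_derive t (1:R) C (- (s ^+ 2 * (t * C t))).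
  have tI : `]t - 1, t + 1[%classic t by rewrite /= in_itv/=; lra.
  pose G y := (1 + y ^+ 2) * normal_pdf 0 s y.
  have G0 y : 0 <= G y by rewrite mulr_ge0 ?normal_pdf_ge0// addr_ge0// sqr_ge0.
  have iG : mu.-integrable setT (EFin \o G).
    apply: integrable_normal_mul => //.
      by apply: measurable_funD => //; exact: measurable_funX.
    by move=> y; rewrite subr0 ger0_norm// addr_ge0// sqr_ge0.
  have intf (x : R) : `]t - 1, t + 1[%classic x -> mu.-integrable setT (EFin \o f x).
    by move=> _; exact: integrable_bounded_normal.
  have der (x y : R) : `]t - 1, t + 1[%classic x -> setT y -> derivable (f ^~ y) x 1.
    by move=> _ _; have [] := df x y.
  have Gub (x y : R) : `]t - 1, t + 1[%classic x -> setT y -> `|partial1of2 f x y| <= G y.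
    move=> _ _; rewrite d1f normrN normrM (ger0_norm (normal_pdf_ge0 _ _ _)).
    rewrite ler_wpM2r ?normal_pdf_ge0// normrM.
    rewrite (le_trans (ler_wpM2l (normr_ge0 _) (sin_le1' _)))// mulr1.
    by rewrite -(real_normK (num_real y)); have := sqr_ge0 (`|y| - 1); nra.
  apply: DeriveDef.
    exact: (derivable_under_integral measurableT tI intf der G0 iG Gub).
  rewrite -derive1E (differentiation_under_integral measurableT tI intf der G0 iG Gub).
  under eq_Rintegral do rewrite d1f -mulN1r.
  by rewrite RintegralZl//; [rewrite normal_parts// mulN1r|exact: integrable_id_normal].
(* The differential equation says that this product is constant. *)
pose D t := C t * expR (s ^+ 2 * t ^+ 2 / 2).
have D0 : D l = D 0.
  apply: is_derive_0_is_cst => t; have dCt := dC t.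
  by rewrite /D; apply: trigger_derive; rewrite /GRing.scale/=; field.
have : D l = 1.
  rewrite D0 /D /C; under eq_Rintegral do rewrite mul0r cos0 mul1r.
  by rewrite Rintegral_normal_pdf mul1r expr0n/= mulr0 mul0r expR0.
rewrite /D /C => H; apply: (@mulIf _ (expR (s ^+ 2 * l ^+ 2 / 2))).
  by rewrite gt_eqF ?expR_gt0.
by rewrite H -expRD addrC subrr expR0.
Qed.

Lemma normal_sin s l : 0 < s -> \int[mu]_y (sin (l * y) * normal_pdf 0 s y) = 0.
Proof.
move=> s0; set I := LHS.
have : I = - I.
  rewrite {1}/I -Rintegral_opp; last first.
    by apply: measurable_funM => //; exact: measurable_normal_pdf.
  rewrite -mulN1r /I -RintegralZl//; last exact: integrable_bounded_normal.
  by apply: eq_Rintegral => y _; rewrite mulrN sinN normal_pdf_even// mulN1r mulNr.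
lra.
Qed.

Lemma normal_characteristic s l th : 0 < s ->
  \int[mu]_y (cos (l * y + th) * normal_pdf 0 s y) =
  expR (- (s ^+ 2 * l ^+ 2 / 2)) * cos th.
Proof.
move=> s0.
have i1 := integrable_bounded_normal s0 (measurable_cosl l) (fun y => cos_le1' (l * y)).
have i2 := integrable_bounded_normal s0 (measurable_sinl l) (fun y => sin_le1' (l * y)).
transitivity (\int[mu]_y (cos th * (cos (l * y) * normal_pdf 0 s y) -
                          sin th * (sin (l * y) * normal_pdf 0 s y))).
  by apply: eq_Rintegral => y _; rewrite cosD; ring.
rewrite RintegralB//; try exact: RintegrableZl.
by rewrite !RintegralZl// normal_cos// normal_sin// mulr0 subr0 mulrC.
Qed.

End normal_characteristic_function.

(** * Convergence in distribution from convergence of cosine transforms *)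

(** Fubini for a probability and a finite signed density a, with a bounded kernel,
    stated for real-valued integrals. *)
Lemma Rintegral_Fubini d1 d2 (T1 : measurableType d1) (T2 : measurableType d2)
    (R : realType) (Q : probability T1 R) (m : {sigma_finite_measure set T2 -> \bar R})
    (a : T2 -> R) (h : T1 -> T2 -> R) :
  m.-integrable setT (EFin \o a) ->
  measurable_fun [set: T1 * T2] (fun p => h p.1 p.2) ->
  (forall w z, `|h w z| <= 1) ->
  [/\ measurable_fun setT (fun z => \int[Q]_w h w z),
      measurable_fun setT (fun w => \int[m]_z (a z * h w z)) &
      \int[Q]_w \int[m]_z (a z * h w z) = \int[m]_z (a z * \int[Q]_w h w z)].
Proof.
move=> ia mh h1; have ma : measurable_fun setT a by apply/measurable_EFinP; exact: measurable_int ia.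
have mh1 w : measurable_fun setT (h w).
  exact: (measurableT_comp mh (measurable_fun_pair (measurable_cst w) (@measurable_id _ _ setT))).
have mh2 z : measurable_fun setT (h ^~ z).
  exact: (measurableT_comp mh (measurable_fun_pair (@measurable_id _ _ setT) (measurable_cst z))).
have ih z : Q.-integrable setT (EFin \o (h ^~ z)).
  by apply: (@bounded_integrable _ _ _ _ _ 1) => // w; exact: h1.
pose f (p : T1 * T2) := (a p.2 * h p.1 p.2)%:E.
have mf : measurable_fun setT f.
  by apply/measurable_EFinP; apply: measurable_funM => //; exact: measurableT_comp.
have iah w : m.-integrable setT (EFin \o (fun z => a z * h w z)).
  apply: (le_Rintegrable measurableT _ (integrable_norm ia)).
    exact: measurable_funM.
  by move=> z _; rewrite normrM ler_piMr.
have inf_ : (Q \x m)%E.-integrable setT f.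
  apply/integrable12ltyP => //.
  apply: (@le_lt_trans _ _ (\int[Q]_w (\int[m]_z `|a z|%:E)%E)%E).
    apply: ge0_le_integral => //.
    - by move=> w _; exact: integral_ge0.
    - by apply: (measurable_fun_fubini_tonelli_F (abse \o f)) => //=; exact: measurableT_comp.
    - move=> w _; apply: ge0_le_integral => //.
      + exact: (measurable_int _ (integrable_abse (iah w))).
      + exact: (measurable_int _ (integrable_norm ia)).
      + by move=> z _; rewrite lee_fin normrM ler_piMr.
  rewrite integral_cst// [X in (_ * X)%E](_ : _ = 1%E) ?mule1; last exact: probability_setT.
  by case/integrableP : ia.
have mz : measurable_fun setT (fun z => \int[Q]_w h w z).
  (* Tonelli gives the measurability of partial integrals of nonnegative kernels,
     such as h + 1. *)
  have mhe : measurable_fun setT (fun p : T1 * T2 => (h p.1 p.2 + 1)%:E).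
    by apply/measurable_EFinP; exact: measurable_funD.
  have h0 (p : T1 * T2) : (0 <= (h p.1 p.2 + 1)%:E)%E.
    by rewrite lee_fin; have := h1 p.1 p.2; rewrite ler_norml => /andP[]; lra.
  have mG := @measurable_fun_fubini_tonelli_G _ _ _ _ _ Q _ mhe h0.
  have -> : (fun z => \int[Q]_w h w z) = (fun z => fine (\int[Q]_w (h w z + 1)%:E)%E - 1).
    apply/funext => z; rewrite -[RHS]/(\int[Q]_w (h w z + 1) - 1) RintegralD//.
      by rewrite Rintegral_cstP addrK.
    by apply: (@bounded_integrable _ _ _ _ _ 1) => // w; rewrite normr1.
  by apply: measurable_funB => //; apply: measurableT_comp.
split=> //.
  by apply: (measurableT_comp _ (measurable_fubini_F inf_)); exact: fine_measurable.
rewrite /Rintegral; congr fine.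
transitivity (\int[Q]_w \int[m]_z f (w, z))%E.
  by apply: eq_integral => w _; rewrite fineK//; exact: integrable_fin_num (iah w).
rewrite (Fubini inf_); apply: eq_integral => z _.
rewrite -[LHS]fineK; last first.
  exact: (integrable_fin_num measurableT (RintegrableZl (a z) measurableT (ih z))).
by congr EFin; rewrite -[RHS]/(a z * \int[Q]_w h w z) -RintegralZl//; exact: ih.
Qed.

Section levy_continuity.
Context d (T : measurableType d) (R : realType) (P : probability T R).
Variables (Y : (T -> R)^nat) (nu : probability (measurableTypeR R) R).
Hypothesis mY : forall n, measurable_fun setT (Y n).
Notation mu := (@lebesgue_measure R).

Let cvgE (h : R -> R) := \int[P]_w h (Y n w) @[n --> \oo] --> \int[nu]_x h x.

(** Convergence of expectations passes to mixtures of test functions: exchange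
    the two integrals, then dominate by |a|. *)
Let cvgE_mixture (a : R -> R) (h : R -> R -> R) :
  mu.-integrable setT (EFin \o a) ->
  measurable_fun [set: measurableTypeR R * measurableTypeR R] (fun p => h p.1 p.2) ->
  (forall z x, `|h x z| <= 1) -> (forall z, cvgE (h ^~ z)) ->
  cvgE (fun x => \int[mu]_z (a z * h x z)).
Proof.
move=> ia mh h1 ch; rewrite /cvgE.
have [mnu _ Fnu] := @Rintegral_Fubini _ _ _ _ _ nu mu a h ia mh (fun w z => h1 z w).
have FP n : [/\ measurable_fun setT (fun z => \int[P]_w h (Y n w) z),
    measurable_fun setT (fun w => \int[mu]_z (a z * h (Y n w) z)) &
    \int[P]_w \int[mu]_z (a z * h (Y n w) z) = \int[mu]_z (a z * \int[P]_w h (Y n w) z)].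
  apply: (@Rintegral_Fubini _ _ _ _ _ P mu a (fun w z => h (Y n w) z) ia) => [|w z]; last exact: h1.
  apply: (measurableT_comp mh (measurable_fun_pair _ _)).
    by apply: measurableT_comp => //; exact: mY.
  exact: measurable_snd.
rewrite Fnu; under eq_fun => n do have [_ _ ->] := FP n.
have ma : measurable_fun setT a by apply/measurable_EFinP; exact: measurable_int ia.
have mF n : measurable_fun setT (fun z => a z * \int[P]_w h (Y n w) z).
  by apply: measurable_funM => //; have [] := FP n.
have cF z : setT z -> (a z * \int[P]_w h (Y n w) z) @[n --> \oo] --> a z * \int[nu]_x h x z.
  by move=> _; apply: cvgM; [exact: cvg_cst|exact: ch].
have dF n z : setT z -> `|a z * \int[P]_w h (Y n w) z| <= `|a z|.
  move=> _; rewrite normrM ler_piMr//.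
  have mhz : measurable_fun setT (fun w => h (Y n w) z).
    apply: (measurableT_comp mh (measurable_fun_pair (mY n) (measurable_cst z))).
  have ihz : P.-integrable setT (EFin \o (fun w => h (Y n w) z)).
    by apply: (@bounded_integrable _ _ _ _ _ 1) => // w; exact: h1.
  rewrite (le_trans (le_normr_Rintegral measurableT ihz))//.
  rewrite -[leRHS](Rintegral_cstP P); apply: le_Rintegral => //.
    exact: integrable_norm.
  by apply: (@bounded_integrable _ _ _ _ _ 1) => // w; rewrite normr1.
exact: (@Rdominated_cvg _ _ _ mu _ _ _ _ measurableT mF cF (integrable_norm ia) dF).2.
Qed.

Hypothesis chY : forall l th,
  \int[P]_w cos (l * Y n w + th) @[n --> \oo] --> \int[nu]_x cos (l * x + th).

(** A gaussian bump is a mixture of cosines, because the gaussian density is its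
    own Fourier transform up to scaling. *)
Let cvgE_gauss (s y : R) : 0 < s -> cvgE (fun x => expR (- ((x - y) ^+ 2 / (s ^+ 2 * 2)))).
Proof.
move=> s0; have si0 : 0 < s^-1 by rewrite invr_gt0.
pose h (x l : R) := cos (l * x + - (l * y)).
have -> : (fun x => expR (- ((x - y) ^+ 2 / (s ^+ 2 * 2)))) =
    (fun x => \int[mu]_l (normal_pdf 0 s^-1 l * h x l)).
  apply/funext => x.
  transitivity (\int[mu]_l (cos ((x - y) * l + 0) * normal_pdf 0 s^-1 l)).
    rewrite normal_characteristic// cos0 mulr1; congr (expR (- _)).
    by field; rewrite gt_eqF.
  by apply: eq_Rintegral => l _; rewrite mulrC /h; congr (_ * cos _); ring.
apply: cvgE_mixture.
- exact: integrable_normal_pdf.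
- apply: measurable_fun_cos; apply: measurable_funD.
    by apply: measurable_funM; [exact: measurable_snd|exact: measurable_fst].
  by apply: measurableT_comp => //; apply: measurable_funM => //; exact: measurable_snd.
- by move=> z x; rewrite cos_max.
- by move=> z; exact: chY.
Qed.

Let mollify (g : R -> R) (s x : R) := \int[mu]_y (g y * normal_pdf x s y).

Let mollifyE (g : R -> R) (s : R) : 0 < s -> mollify g s =
  (fun x => \int[mu]_y ((normal_peak s * g y) * expR (- ((x - y) ^+ 2 / (s ^+ 2 * 2))))).
Proof.
move=> s0; apply/funext => x; apply: eq_Rintegral => y _.
rewrite normal_pdfE ?gt_eqF// /normal_fun.
have -> : - (y - x) ^+ 2 / (s ^+ 2 *+ 2) = - ((x - y) ^+ 2 / (s ^+ 2 * 2)).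
  by rewrite mulNr -mulr_natr; congr (- (_ / _)); ring.
by ring.
Qed.

Let measurable_gauss2 (s : R) :
  measurable_fun [set: measurableTypeR R * measurableTypeR R]
    (fun p => expR (- ((p.1 - p.2) ^+ 2 / (s ^+ 2 * 2)))).
Proof.
apply: measurableT_comp; first exact: measurable_expR.
apply: measurableT_comp => //; apply: measurable_funM => //; apply: measurable_funX.
by apply: measurable_funB; [exact: measurable_fst|exact: measurable_snd].
Qed.

Let gauss2_le1 (s x y : R) : `|expR (- ((x - y) ^+ 2 / (s ^+ 2 * 2)))| <= 1.
Proof.
rewrite ger0_norm ?expR_ge0// -expR0 ler_expR oppr_le0.
by rewrite divr_ge0 ?sqr_ge0// mulr_ge0// sqr_ge0.
Qed.

Let cvgE_mollify (g : R -> R) (s : R) : 0 < s ->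
  mu.-integrable setT (EFin \o g) -> cvgE (mollify g s).
Proof.
move=> s0 ig; rewrite mollifyE//.
apply: (@cvgE_mixture _ (fun x y => expR (- ((x - y) ^+ 2 / (s ^+ 2 * 2))))).
- exact: RintegrableZl.
- exact: measurable_gauss2.
- by move=> z x; exact: gauss2_le1.
- by move=> z; exact: cvgE_gauss.
Qed.

(** Chebyshev: where |y - x| < dl the oscillation of g is at most e; elsewhere
    2 M <= (2 M / dl^2) (y - x)^2, and the second moment of the density is O(s^2). *)
Let mollify_approx (g : R -> R) (M e dl s : R) : 0 < s -> 0 < dl -> 0 <= e ->
  measurable_fun setT g -> (forall x, `|g x| <= M) ->
  (forall x y, `|x - y| < dl -> `|g x - g y| <= e) ->
  forall x, `|mollify g s x - g x| <= e + 2 * M / dl ^+ 2 * (8 * s ^+ 2).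
Proof.
move=> s0 dl0 e0 mg gM guc x.
have M0 : 0 <= M by rewrite (le_trans _ (gM 0)).
pose n := normal_pdf x s; pose K := 2 * M / dl ^+ 2.
have K0 : 0 <= K by rewrite divr_ge0 ?sqr_ge0// mulr_ge0.
have n0 y : 0 <= n y by exact: normal_pdf_ge0.
have In : mu.-integrable setT (EFin \o n) by exact: integrable_normal_pdf.
have mn : measurable_fun setT n by exact: measurable_normal_pdf.
have Ign : mu.-integrable setT (EFin \o (fun y => g y * n y)).
  apply: (le_Rintegrable measurableT _ (RintegrableZl M measurableT In)).
    exact: measurable_funM.
  by move=> y _; rewrite normrM (ger0_norm (n0 y)) ler_wpM2r.
have Icn : mu.-integrable setT (EFin \o (fun y => g x * n y)) by exact: RintegrableZl.
have Isq := integrable_normal_sqr x s0.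
have -> : mollify g s x - g x = \int[mu]_y (g y * n y - g x * n y).
  by rewrite RintegralB// RintegralZl// Rintegral_normal_pdf mulr1.
rewrite (le_trans (le_normr_Rintegral measurableT (RintegrableB measurableT Ign Icn)))//.
have Ib : mu.-integrable setT (EFin \o (fun y => e * n y + K * ((y - x) ^+ 2 * n y))).
  by apply: RintegrableD => //; exact: RintegrableZl.
apply: (@le_trans _ _ (\int[mu]_y (e * n y + K * ((y - x) ^+ 2 * n y)))).
  apply: le_Rintegral => //.
    by apply: integrable_norm; exact: RintegrableB.
  move=> y _; rewrite -mulrBl normrM (ger0_norm (n0 y)) mulrA -mulrDl ler_wpM2r//.
  have [xy|xy] := ltP `|y - x| dl.
    by rewrite (le_trans (guc _ _ xy))// lerDl mulr_ge0// sqr_ge0.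
  apply: (@le_trans _ _ (2 * M)).
    by rewrite (le_trans (ler_normB _ _))// mulr_natl mulr2n lerD.
  rewrite -[leLHS]add0r lerD// /K mulrAC ler_pdivlMr ?exprn_gt0//.
  apply: ler_wpM2l; first by rewrite mulr_ge0.
  by rewrite -[leRHS]real_normK ?num_real// lerXn2r// nnegrE// ltW.
rewrite RintegralD//; try exact: RintegrableZl.
rewrite !RintegralZl// Rintegral_normal_pdf mulr1 lerD2l ler_wpM2l//.
exact: Rintegral_normal_sqr_le.
Qed.

(** Mollify g by a gaussian density: the result is a mixture of gaussian bumps
    and is uniformly close to g. *)
Let cvgE_uniform (g : R -> R) : continuous g -> mu.-integrable setT (EFin \o g) ->
  (exists M, forall x, `|g x| <= M) ->
  (forall e, 0 < e -> exists2 dl, 0 < dl & forall x y, `|x - y| < dl -> `|g x - g y| <= e) ->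
  cvgE g.
Proof.
move=> cg ig [M gM] guc; have mg : measurable_fun setT g by exact: continuous_measurable_fun.
have M0 : 0 <= M by rewrite (le_trans _ (gM 0)).
apply/cvgrPdist_le => e e0.
have e80 : 0 < e / 8 by rewrite divr_gt0.
have [dl dl0 gdl] := guc _ e80.
pose K := 2 * M / dl ^+ 2 * 8.
have K0 : 0 <= K by rewrite mulr_ge0// divr_ge0 ?sqr_ge0// mulr_ge0.
(* Chosen such that s^2 <= s and K s <= e / 8. *)
pose s := Num.min 1 (e / 8 / (K + 1)).
have s0 : 0 < s by rewrite lt_min ltr01 divr_gt0// ltr_pwDr.
have Ks : K * s ^+ 2 <= e / 8.
  have s1 : s <= 1 by rewrite ge_min lexx.
  have s2 : s * (K + 1) <= e / 8 by rewrite -ler_pdivlMr ?ltr_pwDr// ge_min lexx orbT.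
  have s3 : s ^+ 2 <= s by rewrite expr2 ler_piMl// ltW.
  apply: le_trans s2; rewrite mulrC ler_pM ?sqr_ge0// lerDl//.
have appr x : `|mollify g s x - g x| <= e / 4.
  rewrite (le_trans (mollify_approx s0 dl0 (ltW e80) mg gM gdl x))//.
  by rewrite mulrA -/K; lra.
have mmol : measurable_fun setT (mollify g s).
  rewrite (mollifyE g s0).
  have ia : mu.-integrable setT (EFin \o (fun y => normal_peak s * g y)).
    exact: RintegrableZl.
  by have [] := @Rintegral_Fubini _ _ _ _ _ nu mu _ _ ia (measurable_gauss2 s) (gauss2_le1 s).
have Q1 d' (T' : measurableType d') (Q : probability T' R) (V : T' -> R) :
    measurable_fun setT V ->
    `|\int[Q]_w g (V w) - \int[Q]_w mollify g s (V w)| <= e / 4.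
  move=> mV.
  have i1 : Q.-integrable setT (EFin \o (fun w => g (V w))).
    by apply: (@bounded_integrable _ _ _ _ _ M) => //; exact: measurableT_comp.
  have i2 : Q.-integrable setT (EFin \o (fun w => mollify g s (V w))).
    apply: (@bounded_integrable _ _ _ _ _ (M + e / 4)) => //; first exact: measurableT_comp.
    move=> w; rewrite -(subrK (g (V w)) (mollify g s (V w))) addrC.
    by rewrite (le_trans (ler_normD _ _))// lerD.
  rewrite -RintegralB// (le_trans (le_normr_Rintegral measurableT (RintegrableB measurableT i1 i2)))//.
  rewrite -[leRHS](Rintegral_cstP Q); apply: le_Rintegral => //.
  - by apply: integrable_norm; exact: RintegrableB.
  - exact: (@bounded_integrable _ _ _ _ _ `|e / 4|).
  - by move=> w _; rewrite distrC.
have e20 : 0 < e / 2 by rewrite divr_gt0.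
have := cvgE_mollify s0 ig; rewrite /cvgE => /cvgrPdist_le /(_ _ e20).
apply: filterS => n; rewrite !ler_norml => /andP[H1 H2].
have := Q1 _ _ P (Y n) (mY n); rewrite ler_norml => /andP[H3 H4].
have := Q1 _ _ nu id (@measurable_id _ _ setT); rewrite ler_norml => /andP[H5 H6].
by apply/andP; split; lra.
Qed.

Hypothesis tightY : exists C : R, forall n, sqint P (Y n) /\ ip P (Y n) (Y n) <= C.

(** Continuous, 1 on [-M, M], 0 outside of [-(M + 1), M + 1] and affine in between;
    this closed formula makes continuity immediate. *)
Let bump (M x : R) : R := (`|M + 1 - `|x| | - `|M - `|x| | + 1) / 2.

Let bump_continuous M : continuous (bump M).
Proof.
have cdist (a : R) : continuous (fun x : R => `|a - `|x| |).
  move=> x; apply: (@continuous_comp _ _ _ (fun x : R => a - `|x|)); last exact: norm_continuous.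
  by apply: cvgB; [exact: cvg_cst|exact: norm_continuous].
move=> x; apply: cvgM; last exact: cvg_cst.
by apply: cvgD; [apply: cvgB; exact: cdist|exact: cvg_cst].
Qed.

Let bump_ge0 M x : 0 <= bump M x.
Proof.
have := ler_normB (M - `|x|) (- 1); rewrite normrN1 opprK /bump.
have := ler_normD (M + 1 - `|x|) (- 1); rewrite normrN1.
have -> : M + 1 - `|x| + - 1 = M - `|x| by ring.
lra.
Qed.

Let bump_le1 M x : bump M x <= 1.
Proof.
have := ler_normD (M - `|x|) 1; rewrite normr1 /bump.
have -> : M - `|x| + 1 = M + 1 - `|x| by ring.
lra.
Qed.

Let bump1 M x : `|x| <= M -> bump M x = 1.
Proof.
move=> xM; have t0 : 0 <= M - `|x| by lra.
have t1 : 0 <= M + 1 - `|x| by lra.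
by rewrite /bump (ger0_norm t0) (ger0_norm t1); lra.
Qed.

Let bump0 M x : M + 1 <= `|x| -> bump M x = 0.
Proof.
move=> xM; have t0 : M - `|x| <= 0 by lra.
have t1 : M + 1 - `|x| <= 0 by lra.
by rewrite /bump (ler0_norm t0) (ler0_norm t1); lra.
Qed.

Let bump_defect M x : 0 < M -> 0 <= 1 - bump M x <= x ^+ 2 / M ^+ 2.
Proof.
move=> M0; rewrite subr_ge0 bump_le1/=.
have [xM|xM] := leP `|x| M.
  by rewrite bump1// subrr divr_ge0// sqr_ge0.
apply: (@le_trans _ _ 1); first by rewrite gerBl.
rewrite ler_pdivlMr ?exprn_gt0// mul1r -[leRHS]real_normK ?num_real//.
by rewrite lerXn2r// ?nnegrE ltW.
Qed.

(** Heine-Cantor on [-(M + 2), M + 2]; outside of this interval both values are 0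
    when |x - y| < 1. *)
Let bump_uniform (g : R -> R) M e : continuous g -> 0 < M -> 0 < e ->
  exists2 dl, 0 < dl &
    forall x y, `|x - y| < dl -> `|g x * bump M x - g y * bump M y| <= e.
Proof.
move=> cg M0 e0; pose G x := g x * bump M x.
have cG : continuous G by move=> x; apply: cvgM; [exact: cg|exact: bump_continuous].
pose K := `[- (M + 2), M + 2]%classic : set R.
have cK : compact K by exact: segment_compact.
have /compact_near_coveringP/(_ R (0^'+) (fun dl x => forall y, `|x - y| < dl -> `|G x - G y| <= e)) := cK.
have cov : forall x, K x -> \forall x' \near x & i \near 0^'+,
    forall y, `|x' - y| < i -> `|G x' - G y| <= e.
  move=> x _; have e20 : 0 < e / 2 by rewrite divr_gt0.
  have /cvgrPdist_le /(_ _ e20) [r /= r0 rG] := cG x.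
  exists (ball x (r / 2), [set i | i < r / 2]) => /=.
    split; first by apply: nbhsx_ballx; rewrite divr_gt0.
    by apply: nbhs_right_lt; rewrite divr_gt0.
  move=> [x' i] /= [bx ir] y xy.
  have H1 : `|G x - G x'| <= e / 2.
    by apply: rG => /=; move: bx; rewrite /ball/= => /lt_trans; apply; lra.
  have H2 : `|G x - G y| <= e / 2.
    apply: rG => /=; rewrite -(subrK x' x) -addrA (le_lt_trans (ler_normD _ _))//.
    by move: bx; rewrite /ball/=; lra.
  by move: H1 H2; rewrite !ler_norml => /andP[? ?] /andP[? ?]; apply/andP; split; lra.
move=> /(_ _ cov) near0.
have [dl [dl0 dl1 Hdl]] : exists dl, [/\ 0 < dl, dl < 1 &
    K `<=` (fun x => forall y, `|x - y| < dl -> `|G x - G y| <= e)].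
  near (0:R)^'+ => dl; exists dl; split.
  - by near: dl; exact: nbhs_right_gt.
  - by near: dl; exact: nbhs_right_lt.
  - by near: dl; exact: near0.
exists dl => // x y xy.
have [Kx|Kx] := leP `|x| (M + 2).
  by apply: Hdl => //; rewrite /K /= in_itv/= -ler_norml.
rewrite !bump0 ?mulr0 ?subrr ?normr0 ?ltW//.
- have := ler_normD y (x - y); have -> : y + (x - y) = x by ring.
  lra.
- lra.
Unshelve. all: by end_near. Qed.

(** A continuity theorem phrased with the real functions cos (l x + th), which
    carry the real and imaginary parts of the characteristic function. Truncating
    g by a bump costs O(1 / M^2) uniformly in n because the second moments are
    bounded, and o(1) for the limit law; the truncated g is uniformly continuous
    and integrable, hence covered by cvgE_uniform. *)
Theorem levy_continuity (g : R -> R) : continuous g ->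
  (exists M, forall x, `|g x| <= M) -> cvgE g.
Proof.
move=> cg [B gB].
have B0 : 0 <= B by rewrite (le_trans _ (gB 0)).
have mg : measurable_fun setT g by exact: continuous_measurable_fun.
have [C HC] := tightY.
have C0 : 0 <= C by have [_] := HC 0%N; apply: le_trans; exact: ip_ge0.
have mb M : measurable_fun setT (bump M).
  by apply: continuous_measurable_fun; exact: bump_continuous.
have mgb M : measurable_fun setT (fun x => g x * bump M x) by exact: measurable_funM.
have gbB M x : `|g x * bump M x| <= B.
  by rewrite normrM (ger0_norm (bump_ge0 _ _)) (le_trans _ (gB x))// ler_piMr.
have cvgb M : 0 < M -> cvgE (fun x => g x * bump M x).
  move=> M0; apply: cvgE_uniform.
  - by move=> x; apply: cvgM; [exact: cg|exact: bump_continuous].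
  - pose K := `[- (M + 1), M + 1]%classic : set R.
    have iK : mu.-integrable setT (EFin \o (fun x => B * \1_K x)).
      by apply: RintegrableZl => //; apply: integrable_indic_itv.
    have mgM := mgb M.
    apply: (@le_Rintegrable _ _ _ mu setT _ (fun x => B * \1_K x)) => // x _.
    rewrite indicE; have [Kx|Kx] := boolP (x \in K); first by rewrite mulr1.
    rewrite bump0 ?mulr0 ?normr0//; apply: ltW; rewrite ltNge; apply/negP => xM.
    by move/negP : Kx; apply; rewrite inE /K /= in_itv/= -ler_norml.
  - by exists B.
  - by move=> e e0; exact: bump_uniform.
have tailY M n : 0 < M -> `|\int[P]_w g (Y n w) - \int[P]_w (g (Y n w) * bump M (Y n w))| <= B * (C / M ^+ 2).
  move=> M0; have [sY Yle] := HC n.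
  have i1 : P.-integrable setT (EFin \o (fun w => g (Y n w))).
    by apply: (@bounded_integrable _ _ _ _ _ B) => //; exact: measurableT_comp.
  have i2 : P.-integrable setT (EFin \o (fun w => g (Y n w) * bump M (Y n w))).
    apply: (@bounded_integrable _ _ _ _ _ B) => //; exact: (measurableT_comp (mgb M) (mY n)).
  have i3 : P.-integrable setT (EFin \o (fun w => Y n w * Y n w)) by exact: sqint_mul.
  rewrite -RintegralB// (le_trans (le_normr_Rintegral measurableT (RintegrableB measurableT i1 i2)))//.
  apply: (@le_trans _ _ (\int[P]_w (B / M ^+ 2 * (Y n w * Y n w)))).
    apply: le_Rintegral => //.
    - by apply: integrable_norm; exact: RintegrableB.
    - exact: RintegrableZl.
    - move=> w _; rewrite -{1}(mulr1 (g _)) -mulrBr normrM.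
      have /andP[b0 b1] := bump_defect (Y n w) M0.
      rewrite (ger0_norm b0) -mulrA -expr2 mulrC (mulrC _ (_ ^+ 2)).
      by rewrite mulrC ler_pM.
  by rewrite RintegralZl// mulrAC -mulrA ler_wpM2l// ler_wpM2r// invr_ge0 sqr_ge0.
have tailnu : \int[nu]_x (g x * bump n.+1%:R x) @[n --> \oo] --> \int[nu]_x g x.
  have cbn x : setT x -> (g x * bump n.+1%:R x) @[n --> \oo] --> g x.
    move=> _; apply: cvg_near_cst; near=> n; rewrite bump1 ?mulr1//.
    have : `|x| <= n%:R by near: n; exact: nbhs_infty_ger.
    by move=> /le_trans; apply; rewrite ler_nat.
  have iB : nu.-integrable setT (EFin \o cst B).
    exact: (@bounded_integrable _ _ _ _ _ `|B|).
  exact: (@Rdominated_cvg _ _ _ nu _ _ _ _ measurableT (fun n => mgb n.+1%:R) cbn iB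
    (fun n x _ => gbB n.+1%:R x)).2.
apply/cvgrPdist_le => e e0.
have e30 : 0 < e / 3 by rewrite divr_gt0.
have tail0 : B * (C / n.+1%:R ^+ 2) @[n --> \oo] --> 0.
  rewrite -[X in _ --> X](mulr0 B); apply: cvgM; first exact: cvg_cst.
  rewrite -[X in _ --> X](mulr0 C); apply: cvgM; first exact: cvg_cst.
  rewrite -[X in _ --> X](mulr0 0).
  under eq_fun do rewrite expr2 invfM.
  by apply: cvgM; exact: cvg_harmonic.
have [M M0 [HM1 HM2]] : exists2 M : R, 0 < M &
    B * (C / M ^+ 2) <= e / 3 /\ `|\int[nu]_x g x - \int[nu]_x (g x * bump M x)| <= e / 3.
  near \oo => n; exists n.+1%:R; first by rewrite ltr0n.
  split.
    have : `|0 - B * (C / n.+1%:R ^+ 2)| <= e / 3.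
      by near: n; move/cvgrPdist_le : tail0; apply.
    by rewrite sub0r normrN; apply: le_trans; exact: ler_norm.
  by near: n; move/cvgrPdist_le : tailnu; apply.
have := cvgb M M0; rewrite /cvgE => /cvgrPdist_le /(_ _ e30).
apply: filterS => n; rewrite !ler_norml => /andP[H1 H2].
have := tailY M n M0; move: HM2; rewrite !ler_norml => /andP[H3 H4] /andP[H5 H6].
by apply/andP; split; lra.
Unshelve. all: by end_near. Qed.

End levy_continuity.

(** * Independent random variables *)

Section independence.
Context d (T : measurableType d) (R : realType) (P : probability T R).
Import HBNNSimple.

(** If W is uncorrelated with all indicators of xi, it is uncorrelated with all
    bounded functions of xi: approximate by simple functions. *)
Lemma independent_bounded (W xi : T -> R) (M : R) :
  measurable_fun setT W -> (forall w, `|W w| <= M) -> measurable_fun setT xi ->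
  (forall A : set R, measurable A ->
     \int[P]_w (W w * \1_A (xi w)) = \int[P]_w W w * \int[P]_w \1_A (xi w)) ->
  forall (phi : R -> R) (K : R), measurable_fun setT phi -> (forall x, `|phi x| <= K) ->
  \int[P]_w (W w * phi (xi w)) = \int[P]_w W w * \int[P]_w phi (xi w).
Proof.
move=> mW WM mxi ind phi K mphi phiK.
have K0 : 0 <= K by rewrite (le_trans _ (phiK 0)).
(* Approximation from below by simple functions needs a nonnegative function. *)
pose psi x := phi x + K.
have mpsi : measurable_fun setT psi by exact: measurable_funD.
have psi0 x : 0 <= psi x by have := phiK x; rewrite ler_norml /psi => /andP[]; lra.
have psiK x : psi x <= 2 * K by have := phiK x; rewrite ler_norml /psi => /andP[]; lra.
have iW : P.-integrable setT (EFin \o W) by exact: bounded_integrable WM.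
have mpx (g : R -> R) : measurable_fun setT g -> measurable_fun setT (fun w => g (xi w)).
  by move=> mg; exact: measurableT_comp.
have ib (g : R -> R) C : measurable_fun setT g -> (forall x, `|g x| <= C) ->
    P.-integrable setT (EFin \o (fun w => g (xi w))).
  by move=> mg gC; apply: (@bounded_integrable _ _ _ _ _ C) => //; exact: mpx.
have iWb (g : R -> R) C : measurable_fun setT g -> (forall x, `|g x| <= C) ->
    P.-integrable setT (EFin \o (fun w => W w * g (xi w))).
  move=> mg gC; apply: (@bounded_integrable _ _ _ _ _ (M * C)) => [|w].
    by apply: measurable_funM => //; exact: mpx.
  by rewrite normrM ler_pM.
have mpsiE : measurable_fun setT (EFin \o psi) by exact/measurable_EFinP.
have psiE0 t : setT t -> (0 <= (EFin \o psi) t)%E by move=> _; rewrite lee_fin.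
pose g := nnsfun_approx measurableT mpsiE.
have gcvg x : g n x @[n --> \oo] --> psi x.
  have : EFin \o g ^~ x @ \oo --> (EFin \o psi) x by exact: cvg_nnsfun_approx.
  by move=> /fine_cvgP[].
have gle n x : g n x <= psi x.
  have nd : nondecreasing_seq (g ^~ x).
    by move=> a b ab; exact/lefP/nd_nnsfun_approx.
  rewrite -(cvg_lim _ (gcvg x))//.
  apply: (nondecreasing_cvgn_le nd); apply/cvg_ex; exists (psi x); exact: gcvg.
have g0 n x : 0 <= g n x by [].
have gK n x : `|g n x| <= 2 * K by rewrite ger0_norm// (le_trans (gle n x)).
have mg n : measurable_fun setT (g n) by exact: measurable_funP.
have step n : \int[P]_w (W w * g n (xi w)) = \int[P]_w W w * \int[P]_w g n (xi w).
  have gE x : g n x = \sum_(y <- finmap.enum_fset (fset_set (range (g n)))) (y * \1_(g n @^-1` [set y]) x).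
    by rewrite {1}fimfunE fsbig_finite//.
  have mA y : measurable (g n @^-1` [set y]) by exact: measurable_funPTI.
  have i1 y : P.-integrable setT (EFin \o (fun w => y * \1_(g n @^-1` [set y]) (xi w))).
    apply: RintegrableZl => //; apply: (ib _ 1) => // x.
    by rewrite indicE; case: (_ \in _); rewrite ?normr1 ?normr0.
  have i1' y : P.-integrable setT (EFin \o (fun w => \1_(g n @^-1` [set y]) (xi w))).
    apply: (ib _ 1) => // x.
    by rewrite indicE; case: (_ \in _); rewrite ?normr1 ?normr0.
  have i2' y : P.-integrable setT (EFin \o (fun w => W w * \1_(g n @^-1` [set y]) (xi w))).
    apply: (iWb _ 1) => // x.
    by rewrite indicE; case: (_ \in _); rewrite ?normr1 ?normr0.
  have i2 y : P.-integrable setT (EFin \o (fun w => y * (W w * \1_(g n @^-1` [set y]) (xi w)))).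
    exact: RintegrableZl.
  under eq_Rintegral => w _ do rewrite gE mulr_sumr.
  under eq_Rintegral => w _ do under eq_bigr => y _ do rewrite mulrCA.
  rewrite (Rintegral_sum _ measurableT i2).2.
  rewrite [X in _ = _ * X](_ : _ = \int[P]_w (\sum_(y <- finmap.enum_fset (fset_set (range (g n)))) (y * \1_(g n @^-1` [set y]) (xi w)))); last by apply: eq_Rintegral => w _; rewrite gE.
  rewrite (Rintegral_sum _ measurableT i1).2 mulr_sumr; apply: eq_bigr => y _.
  by rewrite !RintegralZl// ind// mulrCA.
have cv1 : \int[P]_w (W w * g n (xi w)) @[n --> \oo] --> \int[P]_w (W w * psi (xi w)).
  apply: (@Rdominated_cvg _ _ _ P _ _ _ (cst (M * (2 * K))) measurableT _ _ _ _).2.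
  - by move=> n; apply: measurable_funM => //; exact: mpx.
  - by move=> w _; apply: cvgM; [exact: cvg_cst|exact: gcvg].
  - exact: (@bounded_integrable _ _ _ _ _ `|M * (2 * K)|).
  - by move=> n w _; rewrite normrM ler_pM.
have cv2 : \int[P]_w W w * \int[P]_w (g n (xi w)) @[n --> \oo] -->
    \int[P]_w W w * \int[P]_w psi (xi w).
  apply: cvgM; first exact: cvg_cst.
  apply: (@Rdominated_cvg _ _ _ P _ _ _ (cst (2 * K)) measurableT _ _ _ _).2.
  - by move=> n; exact: mpx.
  - by move=> w _; exact: gcvg.
  - exact: (@bounded_integrable _ _ _ _ _ `|2 * K|).
  - by move=> n w _; exact: gK.
have psiE : \int[P]_w (W w * psi (xi w)) = \int[P]_w W w * \int[P]_w psi (xi w).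
  by move: cv1; under eq_fun do rewrite step; move=> cv1; exact: (cvg_unique _ cv1 cv2).
move: psiE; rewrite /psi RintegralD//; last 2 first.
  exact: ib phiK.
  exact: (@bounded_integrable _ _ _ _ _ `|K|).
under eq_Rintegral do rewrite mulrDr.
rewrite RintegralD//; last 2 first.
  exact: iWb phiK.
  by apply: (@bounded_integrable _ _ _ _ _ (M * `|K|)) => [|w]; [exact: measurable_funM|rewrite normrM ler_wpM2r].
rewrite Rintegral_cstP mulrDr RintegralZr//.
by move=> /addIr.
Qed.

Lemma normr_indic (A : set R) x : `|\1_A x| <= 1 :> R.
Proof. by rewrite indicE; case: (_ \in _); rewrite ?normr1 ?normr0. Qed.

Lemma Rintegral_indic (X : T -> R) (A : set R) : measurable_fun setT X -> measurable A ->
  (\int[P]_w \1_A (X w))%:E = P (X @^-1` A).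
Proof.
move=> mX mA; have mXA : measurable (X @^-1` A) by rewrite -[X in measurable X]setTI; exact: mX.
rewrite /Rintegral -[X in (_ = X)]fineK; last exact: fin_num_measure.
congr (EFin (fine _)).
have := @integral_indic _ _ _ P _ measurableT _ mXA; rewrite setIT => <-.
by apply: eq_integral => w _; rewrite !indicE; congr ((_ : bool)%:R%:E); apply/idP/idP; rewrite !inE.
Qed.

(** Independence is given for events, that is, for products of indicators; the
    functions are replaced one at a time, so the induction is on the number k of
    factors that are arbitrary bounded functions. *)
Lemma mutually_independent_prod n (X : 'I_n -> T -> R) (phi : 'I_n -> R -> R) (K : R) :
  (forall i, measurable_fun setT (X i)) -> mutually_independent P X ->
  (forall i, measurable_fun setT (phi i)) -> (forall i x, `|phi i x| <= K) ->
  \int[P]_w (\prod_(i < n) phi i (X i w)) = \prod_(i < n) \int[P]_w phi i (X i w).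
Proof.
move=> mX ind mphi phiK.
suff H k : forall phi : 'I_n -> R -> R,
    (forall i, measurable_fun setT (phi i)) -> (exists K, 1 <= K /\ forall i x, `|phi i x| <= K) ->
    (forall i : 'I_n, (k <= i)%N -> exists2 A : set R, measurable A & phi i = \1_A) ->
    \int[P]_w (\prod_(i < n) phi i (X i w)) = \prod_(i < n) \int[P]_w phi i (X i w).
  apply: (H n) => //; last by move=> i; rewrite leqNgt ltn_ord.
  exists (Num.max 1 K); split; first by rewrite le_max lexx.
  by move=> i x; rewrite le_max phiK orbT.
elim: k => [|k IHk] {}phi {}mphi [{}K [K1 {}phiK]] indphi.
  have /choice[A HA] : forall i, exists A : set R, measurable A /\ phi i = \1_A.
    by move=> i; have [//|A mA pA] := indphi i; exists A.
  have := ind A (fun i => (HA i).1).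
  have -> : (\prod_(i < n) P (X i @^-1` A i))%E =
      (\prod_(i < n) \int[P]_w phi i (X i w))%:E.
    rewrite -prodEFin; apply: eq_bigr => i _.
    by rewrite (HA i).2 Rintegral_indic//; exact: (HA i).1.
  move=> /(congr1 fine) /= <-; congr fine.
  have mcap : measurable (\bigcap_i X i @^-1` A i).
    apply: fin_bigcap_measurable; first exact: finite_finset.
    by move=> i _; rewrite -[X in measurable X]setTI; apply: mX => //; exact: (HA i).1.
  have := @integral_indic _ _ _ P _ measurableT _ mcap; rewrite setIT => <-.
  apply: eq_integral => w _; congr EFin.
  under eq_bigr => i _ do rewrite (HA i).2.
  rewrite indicE; have [wA|wA] := boolP (w \in _).
    rewrite big1// => i _; rewrite indicE mem_set//.
    by move/set_mem : wA => /(_ i I).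
  have [i wi] : exists i, ~ A i (X i w).
    apply: contrapT => /forallNP nA; move/negP: wA; apply; apply/mem_set => i _ /=.
    by apply: contrapT; exact: nA.
  by rewrite (bigD1 i)//= indicE memNset// mul0r.
have [nk|kn] := leqP n k.
  apply: IHk => //; first by exists K.
  by move=> i ki; have := leq_trans nk ki; rewrite leqNgt ltn_ord.
pose k' := Ordinal kn.
pose phiA (A : set R) i := if i == k' then \1_A else phi i : R -> R.
have phiAkk A : phiA A k' = \1_A by rewrite /phiA eqxx.
have phiAk A i : i != k' -> phiA A i = phi i by rewrite /phiA => /negbTE ->.
have IHA (A : set R) : measurable A ->
    \int[P]_w ((\prod_(i < n | i != k') phi i (X i w)) * \1_A (X k' w)) =
    (\prod_(i < n | i != k') \int[P]_w phi i (X i w)) * \int[P]_w \1_A (X k' w).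
  move=> mA; have := IHk (phiA A).
  have -> : (fun w => \prod_(i < n) phiA A i (X i w)) =
      (fun w => (\prod_(i < n | i != k') phi i (X i w)) * \1_A (X k' w)).
    apply/funext => w; rewrite (bigD1 k')//= mulrC phiAkk; congr (_ * _).
    by apply: eq_bigr => i ik; rewrite phiAk.
  rewrite (bigD1 k')//= phiAkk mulrC.
  have -> : \prod_(i < n | i != k') \int[P]_w phiA A i (X i w) =
      \prod_(i < n | i != k') \int[P]_w phi i (X i w).
    by apply: eq_bigr => i ik; rewrite phiAk.
  apply.
  - by move=> i; rewrite /phiA; case: ifP => // _; exact: measurable_indic.
  - exists K; split => // i x; rewrite /phiA; case: ifP => // _.
    exact: le_trans (normr_indic A x) K1.
  - move=> i ki; rewrite /phiA; have [_|ik] := eqVneq i k'; first by exists A.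
    by apply: indphi; rewrite ltn_neqAle ki andbT eq_sym; apply: contra ik => /eqP e; apply/eqP/val_inj => /=; rewrite e.
pose W w := \prod_(i < n | i != k') phi i (X i w).
have K0 : 0 <= K by exact: le_trans K1.
have EW : \int[P]_w W w = \prod_(i < n | i != k') \int[P]_w phi i (X i w).
  have := IHA setT measurableT.
  under eq_Rintegral do rewrite indicT mulr1.
  under [in RHS]eq_Rintegral do rewrite indicT.
  by rewrite Rintegral_cstP mulr1.
rewrite (bigD1 k')//= -EW mulrC.
under eq_Rintegral => w _ do rewrite (bigD1 k')//= mulrC.
apply: (@independent_bounded W (X k') (K ^+ n) _ _ _ _ _ K) => //.
- rewrite /W; under eq_fun do rewrite big_mkcond/=.
  by apply: measurable_prod => i _; have [_|_] := eqVneq i k' => /=; [exact: measurable_cst|exact: measurableT_comp].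
- move=> w; rewrite /W normr_prod.
  apply: (@le_trans _ _ (\prod_(i < n | i != k') K)).
    by apply: ler_prod => i _; rewrite normr_ge0/=.
  by rewrite prodr_const; apply: ler_weXn2l => //; rewrite -[leqRHS](card_ord n) max_card.
- by move=> A mA; rewrite IHA// EW.
Qed.

End independence.

(** * Taylor bounds for characteristic functions *)

Section trigonometric_bounds.
Context (R : realType).
Implicit Types x y : R.

Let cont_derive (f df : R -> R) : (forall x : R, is_derive x (1:R) f (df x)) -> continuous f.
Proof.
move=> dF x; apply: differentiable_continuous; apply/derivable1_diffP.
by have [] := dF x.
Qed.

(** The mean value inequality, applied in turn to sin, to sin - id and to
    cos - 1 + id^2 / 2. *)
Let increment_bound (f df : R -> R) (B y : R) :
  (forall x : R, is_derive x (1:R) f (df x)) -> f 0 = 0 -> 0 <= y ->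
  (forall x, 0 <= x -> x <= y -> `|df x| <= B) -> `|f y| <= B * y.
Proof.
move=> fdf f0; rewrite le_eqVlt => /predU1P[<- _|y0 dfB]; first by rewrite f0 normr0 mulr0.
have [//|c] := @MVT _ f df 0 y y0 (fun x _ => fdf x).
  by apply: continuous_subspaceT; exact: cont_derive fdf.
rewrite in_itv/= => /andP[c0 cy]; rewrite f0 !subr0 => ->.
by rewrite normrM (gtr0_norm y0) ler_wpM2r ?(ltW y0)// dfB ?ltW.
Qed.

Lemma normr_sin_le x : `|sin x| <= `|x|.
Proof.
wlog x0 : x / 0 <= x.
  move=> H; have [x0|x0] := leP 0 x; first exact: H.
  by rewrite -(normrN x) -(normrN (sin x)) -sinN H// oppr_ge0 ltW.
rewrite (ger0_norm x0) -[leRHS]mul1r.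
apply: (@increment_bound sin cos 1) => //; first exact: sin0.
by move=> y _ _; rewrite cos_max.
Qed.

Lemma one_minus_cos_bound x : 0 <= 1 - cos x <= x ^+ 2 / 2.
Proof.
rewrite subr_ge0 cos_le1/=.
have -> : cos x = cos (x / 2 + x / 2) by congr cos; lra.
rewrite cosD; have := cos2Dsin2 (x / 2).
have := normr_sin_le (x / 2); rewrite -(@ler_pXn2r _ 2)// ?nnegrE// !real_normK ?num_real//.
by move=> H1 H2; nra.
Qed.

Lemma sin_sub_bound x : `|sin x - x| <= `|x| ^+ 3 / 2.
Proof.
wlog x0 : x / 0 <= x.
  move=> H; have [x0|x0] := leP 0 x; first exact: H.
  have := H (- x); rewrite sinN normrN -opprD normrN; apply.
  by rewrite oppr_ge0 ltW.
rewrite (ger0_norm x0) (_ : x ^+ 3 / 2 = x ^+ 2 / 2 * x); last by ring.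
apply: (@increment_bound (fun x => sin x - x) (fun x => cos x - 1)) => //.
- by rewrite sin0 subr0.
- move=> y y0 yx; have /andP[c0 c1] := one_minus_cos_bound y.
  rewrite distrC ger0_norm// (le_trans c1)// ler_wpM2r ?invr_ge0//.
  by rewrite lerXn2r// nnegrE// (le_trans y0).
Qed.

Lemma cos_sub_bound x : `|cos x - 1 + x ^+ 2 / 2| <= `|x| ^+ 4 / 2.
Proof.
wlog x0 : x / 0 <= x.
  move=> H; have [x0|x0] := leP 0 x; first exact: H.
  by have := H (- x); rewrite cosN normrN sqrrN; apply; rewrite oppr_ge0 ltW.
rewrite (ger0_norm x0) (_ : x ^+ 4 / 2 = x ^+ 3 / 2 * x); last by ring.
apply: (@increment_bound (fun x => cos x - 1 + x ^+ 2 / 2) (fun x => x - sin x)) => //.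
- by move=> y; apply: trigger_derive; rewrite /GRing.scale/=; field.
- by rewrite cos0 subrr expr0n/= mul0r addr0.
- move=> y y0 yx; rewrite distrC (le_trans (sin_sub_bound y))// ler_wpM2r ?invr_ge0//.
  by rewrite (ger0_norm y0) lerXn2r// nnegrE// (le_trans y0).
Qed.

(** The quadratic factor keeps the bounds integrable for square integrable
   variables; the minimum makes them small near the origin. *)
Lemma cos_taylor2 x : `|cos x - 1 + x ^+ 2 / 2| <= x ^+ 2 * Num.min 1 `|x|.
Proof.
have x2 := sqr_ge0 x; have n0 := normr_ge0 x; have nK := real_normK (num_real x).
have [x1|x1] := leP 1 `|x|.
  rewrite mulr1; have /andP[] := one_minus_cos_bound x => H1 H2.
  by rewrite ler_norml; apply/andP; split; lra.
rewrite (le_trans (cos_sub_bound x))// -nK.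
rewrite (_ : `|x| ^+ 4 / 2 = `|x| ^+ 2 * `|x| * (`|x| / 2)); last by field.
by apply: ler_piMr; [rewrite mulr_ge0// sqr_ge0|lra].
Qed.

Lemma sin_taylor2 x : `|sin x - x| <= 2 * (x ^+ 2 * Num.min 1 `|x|).
Proof.
have x2 := sqr_ge0 x; have n0 := normr_ge0 x; have nK := real_normK (num_real x).
have [x1|x1] := leP 1 `|x|.
  rewrite mulr1 (le_trans (ler_normB _ _))//.
  have := normr_sin_le x; have : `|x| <= x ^+ 2 by rewrite -nK expr2 ler_peMl.
  by lra.
rewrite (le_trans (sin_sub_bound x))// -nK.
rewrite (_ : `|x| ^+ 3 / 2 = `|x| ^+ 2 * `|x| / 2); last by ring.
have : 0 <= `|x| ^+ 2 * `|x| by rewrite mulr_ge0// sqr_ge0.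
by lra.
Qed.

(** From 1 - z <= exp (-z) <= 1 / (1 + z) <= 1 - z + z^2. *)
Lemma expRN_sub_bound (z : R) : 0 <= z -> `|expR (- z) - 1 + z| <= z ^+ 2.
Proof.
move=> z0; have e1 := expR_ge1Dx (- z); have e2 := expR_ge1Dx z.
have z10 : 0 < 1 + z by lra.
have : expR (- z) <= (1 + z)^-1.
  by rewrite expRN lef_pV2 ?posrE ?expR_gt0.
have : (1 + z)^-1 <= 1 - z + z ^+ 2.
  rewrite -[leLHS]mul1r ler_pdivrMr//.
  have : 0 <= z ^+ 3 by rewrite exprn_ge0.
  have -> : (1 - z + z ^+ 2) * (1 + z) = 1 + z ^+ 3 by ring.
  lra.
by move=> H1 H2; rewrite ler_norml; apply/andP; split; have := sqr_ge0 z; lra.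
Qed.

End trigonometric_bounds.

Section characteristic_expansion.
Context d (T : measurableType d) (R : realType) (P : probability T R).
Variables (xi : T -> R) (tau : R).
Hypotheses (sxi : sqint P xi) (xi0 : \int[P]_w xi w = 0) (xi2 : ip P xi xi = tau).

Let q n := \int[P]_w (xi w ^+ 2 * Num.min 1 (`|xi w| / n.+1%:R)).

Let min_norm_bound (a : R) : 0 <= a -> `|Num.min 1 a| <= 1.
Proof. by move=> a0; rewrite ger0_norm ?ge_min ?lexx// le_min ler01. Qed.

Let measurable_q n : measurable_fun setT (fun w => xi w ^+ 2 * Num.min 1 (`|xi w| / n.+1%:R)).
Proof.
have [mxi _] := sxi; apply: measurable_funM; first exact: measurable_funX.
apply: measurable_minr => //; apply: measurable_funM => //.
exact: measurableT_comp.
Qed.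

Let q_dom n w : `|xi w ^+ 2 * Num.min 1 (`|xi w| / n.+1%:R)| <= xi w ^+ 2.
Proof.
rewrite normrM (ger0_norm (sqr_ge0 _)) ler_piMr ?sqr_ge0// min_norm_bound//.
Qed.

Let q_cvg0 : q n @[n --> \oo] --> 0.
Proof.
rewrite -(Rintegral_cstP P 0).
apply: (@Rdominated_cvg _ _ _ P _ _ _ _ measurableT measurable_q _ _ (fun n w _ => q_dom n w)).2.
  move=> w _.
  have c1 : `|xi w| / n.+1%:R @[n --> \oo] --> (0 : R).
    by rewrite -(mulr0 `|xi w|); apply: cvgM; [exact: cvg_cst|exact: cvg_harmonic].
  have c2 : xi w ^+ 2 * (`|xi w| / n.+1%:R) @[n --> \oo] --> (0 : R).
    by rewrite -(mulr0 (xi w ^+ 2)); apply: cvgM; [exact: cvg_cst|exact: c1].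
  apply: (squeeze_cvgr _ (cvg_cst 0) c2); apply: nearW => n.
  rewrite mulr_ge0 ?sqr_ge0 ?le_min ?ler01 ?divr_ge0//=.
  by rewrite ler_wpM2l ?sqr_ge0// ge_min lexx orbT.
exact: sxi.2.
Qed.

(** E exp (i x xi) = 1 - x^2 tau / 2 + o(x^2), split into real and imaginary parts.
    Only the second moment is finite, so the remainder is controlled by
    E xi^2 min (1, |x xi|), which tends to 0 with x by dominated convergence. *)
Lemma characteristic_expansion e : 0 < e -> exists2 dl, 0 < dl &
  forall x, `|x| <= dl ->
    `|\int[P]_w cos (x * xi w) - 1 + x ^+ 2 * tau / 2| <= e * x ^+ 2 /\
    `|\int[P]_w sin (x * xi w)| <= e * x ^+ 2.
Proof.
move=> e0; have e20 : 0 < e / 2 by rewrite divr_gt0.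
have [n qn] : exists n, q n <= e / 2.
  near \oo => n; exists n.
  have : `|0 - q n| <= e / 2 by near: n; move/cvgrPdist_le : q_cvg0; apply.
  by rewrite sub0r normrN; apply: le_trans; exact: ler_norm.
exists n.+1%:R^-1; first by rewrite invr_gt0.
move=> x xn; have [mxi ixi] := sxi.
have ixi2 : P.-integrable setT (EFin \o (fun w => xi w * xi w)) by exact: sqint_mul.
have mx : measurable_fun setT (fun w => x * xi w) by exact: measurable_funM.
have icos : P.-integrable setT (EFin \o (fun w => cos (x * xi w))).
  by apply: (@bounded_integrable _ _ _ _ _ 1) => [|w]; [exact: measurable_fun_cos|rewrite cos_max].
have isin : P.-integrable setT (EFin \o (fun w => sin (x * xi w))).
  by apply: (@bounded_integrable _ _ _ _ _ 1) => [|w]; [exact: measurable_fun_sin|rewrite sin_max].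
have iq : P.-integrable setT (EFin \o (fun w => xi w ^+ 2 * Num.min 1 (`|xi w| / n.+1%:R))).
  by apply: (le_Rintegrable measurableT (@measurable_q n) ixi) => w _; exact: q_dom.
have pt w : (x * xi w) ^+ 2 * Num.min 1 `|x * xi w| <=
    x ^+ 2 * (xi w ^+ 2 * Num.min 1 (`|xi w| / n.+1%:R)).
  rewrite exprMn -mulrA ler_wpM2l ?sqr_ge0// ler_wpM2l ?sqr_ge0//.
  rewrite le_min ge_min lexx/= ge_min; apply/orP; right.
  by rewrite normrM mulrC ler_wpM2l.
have i1 : P.-integrable setT (EFin \o (fun w => xi w ^+ 2)) := ixi.
have ixi1 := sqint_integrable sxi.
have x20 := sqr_ge0 x.
split.
- have -> : \int[P]_w cos (x * xi w) - 1 + x ^+ 2 * tau / 2 =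
      \int[P]_w (cos (x * xi w) - 1 + (x ^+ 2 / 2) * xi w ^+ 2).
    have ione : P.-integrable setT (EFin \o (fun=> 1 : R)).
      exact: (@bounded_integrable _ _ _ _ _ `|1|).
    rewrite RintegralD//; try by [exact: RintegrableB|exact: RintegrableZl].
    rewrite RintegralB// Rintegral_cstP RintegralZl// -xi2 mulrAC; congr (_ + _ * _).
  have ic : P.-integrable setT (EFin \o (fun w => cos (x * xi w) - 1 + (x ^+ 2 / 2) * xi w ^+ 2)).
    apply: RintegrableD => //; last exact: RintegrableZl.
    by apply: RintegrableB => //; exact: (@bounded_integrable _ _ _ _ _ `|1|).
  rewrite (le_trans (le_normr_Rintegral measurableT ic))//.
  apply: (@le_trans _ _ (x ^+ 2 * q n)); last first.
    by rewrite mulrC ler_wpM2r//; lra.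
  rewrite /q -RintegralZl//; apply: le_Rintegral => //.
  + exact: integrable_norm.
  + exact: RintegrableZl.
  + move=> w _; apply: le_trans (pt w).
    by rewrite -mulrA (mulrC 2^-1) mulrA -exprMn; exact: cos_taylor2.
- have -> : \int[P]_w sin (x * xi w) = \int[P]_w (sin (x * xi w) - x * xi w).
    by rewrite RintegralB//; [rewrite RintegralZl// xi0 mulr0 subr0|exact: RintegrableZl].
  have ic : P.-integrable setT (EFin \o (fun w => sin (x * xi w) - x * xi w)).
    by apply: RintegrableB => //; exact: RintegrableZl.
  rewrite (le_trans (le_normr_Rintegral measurableT ic))//.
  apply: (@le_trans _ _ (2 * x ^+ 2 * q n)); last first.
    by rewrite mulrC mulrA ler_wpM2r//; lra.
  rewrite /q -RintegralZl//; apply: le_Rintegral => //.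
  + exact: integrable_norm.
  + exact: RintegrableZl.
  + move=> w _; rewrite (le_trans (sin_taylor2 _))// -[leRHS]mulrA.
    by rewrite ler_wpM2l// pt.
Unshelve. all: by end_near. Qed.

End characteristic_expansion.

(** * A central limit theorem with bounded periodic weights *)

Section identical_distribution.
Context d (T : measurableType d) (R : realType) (P : probability T R).

(** Both integrals are integrals of f for the same image measure. *)
Let ge0_identically_distributed_integral (X Y : T -> R) (f : R -> \bar R) :
  measurable_fun setT X -> measurable_fun setT Y -> identically_distributed P X Y ->
  measurable_fun setT f -> (forall x, (0 <= f x)%E) ->
  (\int[P]_w f (X w) = \int[P]_w f (Y w))%E.
Proof.
move=> mX mY XY mf f0.
rewrite -[LHS](ge0_integral_pushforward mX P measurableT mf) ?preimage_setT//.
rewrite -[RHS](ge0_integral_pushforward mY P measurableT mf) ?preimage_setT//.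
by apply: eq_measure_integral => A mA _; exact: XY.
Qed.

Lemma identically_distributed_integral (X Y : T -> R) (f : R -> \bar R) :
  measurable_fun setT X -> measurable_fun setT Y -> identically_distributed P X Y ->
  measurable_fun setT f -> (\int[P]_w f (X w) = \int[P]_w f (Y w))%E.
Proof.
move=> mX mY XY mf; rewrite integralE [RHS]integralE; congr (_ - _)%E.
- transitivity (\int[P]_w f^\+ (X w))%E.
    by congr integral; apply/funext => x; rewrite !funeposE.
  rewrite (ge0_identically_distributed_integral mX mY XY (measurable_funepos mf)).
    by congr integral; apply/funext => x; rewrite !funeposE.
  by move=> x; exact: funepos_ge0.
- transitivity (\int[P]_w f^\- (X w))%E.
    by congr integral; apply/funext => x; rewrite !funenegE.
  rewrite (ge0_identically_distributed_integral mX mY XY (measurable_funeneg mf)).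
    by congr integral; apply/funext => x; rewrite !funenegE.
  by move=> x; exact: funeneg_ge0.
Qed.

Lemma identically_distributed_Rintegral (X Y : T -> R) (f : R -> R) :
  measurable_fun setT X -> measurable_fun setT Y -> identically_distributed P X Y ->
  measurable_fun setT f -> \int[P]_w f (X w) = \int[P]_w f (Y w).
Proof.
move=> mX mY XY mf; congr fine.
by apply: (identically_distributed_integral (f := EFin \o f)) => //; exact/measurable_EFinP.
Qed.

Lemma identically_distributed_sqint (X Y : T -> R) :
  measurable_fun setT X -> measurable_fun setT Y -> identically_distributed P X Y ->
  sqint P X -> sqint P Y.
Proof.
move=> mX mY XY [_ iX]; split => //; apply/integrableP; split.
  by apply/measurable_EFinP; exact: measurable_funX.
case/integrableP : iX => _.
rewrite (identically_distributed_integral (f := fun x => `|(x ^+ 2)%:E|%E) mX mY XY)//.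
apply: measurableT_comp => //; apply/measurable_EFinP; exact: measurable_funX.
Qed.

Lemma identically_distributed_ip (X Y : T -> R) :
  measurable_fun setT X -> measurable_fun setT Y -> identically_distributed P X Y ->
  ip P X X = ip P Y Y.
Proof.
move=> mX mY XY; apply: (identically_distributed_Rintegral (f := fun x => x * x)) => //.
exact: measurable_funM.
Qed.

End identical_distribution.

Section central_limit.
Context d (T : measurableType d) (R : realType) (P : probability T R).
Variables (X : nat -> T -> R).
Hypotheses (mX : forall i, measurable_fun setT (X i))
  (indX : forall n, mutually_independent P (fun i : 'I_n => X i)).

Let mlin (c : nat -> R) l th : measurable_fun setT (fun w => \sum_(i < l) c i * X i w + th).
Proof.
by apply: measurable_funD => //; apply: measurable_sum => i; exact: measurable_funM.
Qed.

Let integrable_cos (f : T -> R) : measurable_fun setT f -> P.-integrable setT (EFin \o (fun w => cos (f w))).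
Proof.
by move=> mf; apply: (@bounded_integrable _ _ _ _ _ 1) => [|w]; [exact: measurable_fun_cos|rewrite cos_max].
Qed.

(** The partial sum of the first l terms is independent of the later variables,
    tested on shifted cosines of the sum against products of bounded functions.
    Shifts th make the family stable under the addition formula. *)
Let cos_prod_at (c : nat -> R) l := forall n th (phi : nat -> R -> R), (l <= n)%N ->
  (forall i, measurable_fun setT (phi i)) -> (forall i x, `|phi i x| <= 1) ->
  \int[P]_w (cos (\sum_(i < l) c i * X i w + th) * \prod_(l <= i < n) phi i (X i w)) =
  \int[P]_w cos (\sum_(i < l) c i * X i w + th) * \prod_(l <= i < n) \int[P]_w phi i (X i w).

(** Addition formula: the last term of the sum is moved to the product, where
    independence up to l applies. A sine is a cosine shifted by pi / 2. *)
Let cos_prod_step (c : nat -> R) l : cos_prod_at c l ->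
  forall n' th (psi : nat -> R -> R), (l.+1 <= n')%N ->
  (forall i, measurable_fun setT (psi i)) -> (forall i x, `|psi i x| <= 1) ->
  \int[P]_w (cos (\sum_(i < l.+1) c i * X i w + th) * \prod_(l.+1 <= i < n') psi i (X i w)) =
  (\int[P]_w cos (\sum_(i < l) c i * X i w + th) * \int[P]_w cos (c l * X l w) -
   \int[P]_w cos (\sum_(i < l) c i * X i w + (th - pi / 2)) * \int[P]_w sin (c l * X l w)) *
  \prod_(l.+1 <= i < n') \int[P]_w psi i (X i w).
Proof.
move=> IHl n' th psi; pose S w := \sum_(i < l) c i * X i w.
move=> ln' mpsi psi1; have ln'' := ltnW ln'.
pose p1 i := if i == l then (fun x => cos (c l * x)) else psi i : R -> R.
pose p2 i := if i == l then (fun x => sin (c l * x)) else psi i : R -> R.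
have mcl : measurable_fun setT (fun x : R => c l * x) by exact: measurable_funM.
have mp1 i : measurable_fun setT (p1 i).
  by rewrite /p1; case: eqP => // _; exact: measurable_fun_cos.
have mp2 i : measurable_fun setT (p2 i).
  by rewrite /p2; case: eqP => // _; exact: measurable_fun_sin.
have p11 i x : `|p1 i x| <= 1 by rewrite /p1; case: eqP => // _; exact: cos_max.
have p21 i x : `|p2 i x| <= 1 by rewrite /p2; case: eqP => // _; exact: sin_max.
have H1 := IHl n' th p1 ln'' mp1 p11.
have H2 := IHl n' (th - pi / 2) p2 ln'' mp2 p21.
have ne i : (l.+1 <= i < n')%N -> (i == l) = false.
  by move=> /andP[li _]; rewrite gtn_eqF.
have E1 w : \prod_(l <= i < n') p1 i (X i w) = cos (c l * X l w) * \prod_(l.+1 <= i < n') psi i (X i w).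
  by rewrite big_ltn// {1}/p1 eqxx; congr (_ * _); apply: eq_big_nat => i il; rewrite /p1 ne.
have E2 w : \prod_(l <= i < n') p2 i (X i w) = sin (c l * X l w) * \prod_(l.+1 <= i < n') psi i (X i w).
  by rewrite big_ltn// {1}/p2 eqxx; congr (_ * _); apply: eq_big_nat => i il; rewrite /p2 ne.
have F1 : \prod_(l <= i < n') \int[P]_w p1 i (X i w) = \int[P]_w cos (c l * X l w) * \prod_(l.+1 <= i < n') \int[P]_w psi i (X i w).
  by rewrite big_ltn// {1}/p1 eqxx; congr (_ * _); apply: eq_big_nat => i il; rewrite /p1 ne.
have F2 : \prod_(l <= i < n') \int[P]_w p2 i (X i w) = \int[P]_w sin (c l * X l w) * \prod_(l.+1 <= i < n') \int[P]_w psi i (X i w).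
  by rewrite big_ltn// {1}/p2 eqxx; congr (_ * _); apply: eq_big_nat => i il; rewrite /p2 ne.
rewrite F1 in H1; rewrite F2 in H2; rewrite mulrBl -!mulrA -H1 -H2 -RintegralB//; last 2 first.
- apply: (@bounded_integrable _ _ _ _ _ 1) => [|w].
    apply: measurable_funM; first exact: measurable_fun_cos.
    by apply: measurable_prod => i _; exact: measurableT_comp.
  rewrite normrM -[leRHS]mulr1 ler_pM// ?cos_max//.
  by rewrite normr_prod; apply: prodr_ile1 => i; rewrite normr_ge0/=.
- apply: (@bounded_integrable _ _ _ _ _ 1) => [|w].
    apply: measurable_funM; first exact: measurable_fun_cos.
    by apply: measurable_prod => i _; exact: measurableT_comp.
  rewrite normrM -[leRHS]mulr1 ler_pM// ?cos_max//.
  by rewrite normr_prod; apply: prodr_ile1 => i; rewrite normr_ge0/=.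
apply: eq_Rintegral => w _.
rewrite E1 E2 big_ord_recr/= -/(S w).
have -> : S w + c l * X l w + th = (S w + th) + c l * X l w by ring.
have -> : cos (S w + (th - pi / 2)) = sin (S w + th).
  by rewrite addrA cosB cos_pihalf sin_pihalf mulr0 add0r mulr1.
by rewrite [in LHS]cosD; ring.
Qed.

Let cos_prod (c : nat -> R) l : cos_prod_at c l.
Proof.
elim: l => [|l IHl] n th phi ln mphi phi1.
  under eq_Rintegral => w _ do rewrite big_ord0 add0r big_mkord.
  under [in RHS]eq_Rintegral => w _ do rewrite big_ord0 add0r.
  rewrite Rintegral_cstP RintegralZl//; last first.
    apply: (@bounded_integrable _ _ _ _ _ 1) => [|w].
      by apply: measurable_prod => i _; exact: measurableT_comp.
    by rewrite normr_prod; apply: prodr_ile1 => i; rewrite normr_ge0/=.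
  by rewrite big_mkord (@mutually_independent_prod _ _ _ _ _ _ (fun i => phi i) 1).
rewrite (cos_prod_step IHl)//; congr (_ * _).
have := @cos_prod_step c l IHl l.+1 th phi (leqnn _) mphi phi1.
rewrite big_geq// mulr1 => <-.
by apply: eq_Rintegral => w _; rewrite big_geq// mulr1.
Qed.

Lemma cos_recursion (c : nat -> R) l th :
  \int[P]_w cos (\sum_(i < l.+1) c i * X i w + th) =
  \int[P]_w cos (\sum_(i < l) c i * X i w + th) * \int[P]_w cos (c l * X l w) -
  \int[P]_w cos (\sum_(i < l) c i * X i w + (th - pi / 2)) * \int[P]_w sin (c l * X l w).
Proof.
have m0 (i : nat) : measurable_fun setT (cst 0 : R -> R) by exact: measurable_cst.
have b0 (i : nat) (x : R) : `|(cst 0 : R -> R) x| <= 1 by rewrite normr0.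
have := @cos_prod_step c l (@cos_prod c l) l.+1 th (fun _ => cst 0) (leqnn _) m0 b0.
rewrite big_geq// mulr1 => <-.
by apply: eq_Rintegral => w _; rewrite big_geq// mulr1.
Qed.

Variable tau : R.
Hypotheses (idX : forall i, identically_distributed P (X i) (X 0%N))
  (sX : sqint P (X 0%N)) (X0 : \int[P]_w X 0%N w = 0) (X2 : ip P (X 0%N) (X 0%N) = tau).

Let tau0 : 0 <= tau. Proof. by rewrite -X2 ip_ge0. Qed.

Let EcosX x i : \int[P]_w cos (x * X i w) = \int[P]_w cos (x * X 0%N w).
Proof.
apply: (identically_distributed_Rintegral (f := fun y => cos (x * y))) => //.
by apply: measurable_fun_cos; exact: measurable_funM.
Qed.

Let EsinX x i : \int[P]_w sin (x * X i w) = \int[P]_w sin (x * X 0%N w).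
Proof.
apply: (identically_distributed_Rintegral (f := fun y => sin (x * y))) => //.
by apply: measurable_fun_sin; exact: measurable_funM.
Qed.

Let norm_Ecos (f : T -> R) : measurable_fun setT f -> `|\int[P]_w cos (f w)| <= 1.
Proof.
move=> mf; have i1 := integrable_cos mf.
rewrite (le_trans (le_normr_Rintegral measurableT i1))//.
rewrite -[leRHS](Rintegral_cstP P); apply: le_Rintegral => //.
- exact: integrable_norm.
- exact: (@bounded_integrable _ _ _ _ _ `|1|).
- by move=> w _; exact: cos_max.
Qed.

(** Each step of cos_recursion multiplies the expectation by about
    1 - c^2 tau / 2, hence by about exp (- c^2 tau / 2); the errors add up because
    all factors are bounded by 1. *)
Let telescope_bound e dl (c : nat -> R) : 0 < e ->
  (forall x, `|x| <= dl ->
    `|\int[P]_w cos (x * X 0%N w) - 1 + x ^+ 2 * tau / 2| <= e * x ^+ 2 /\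
    `|\int[P]_w sin (x * X 0%N w)| <= e * x ^+ 2) ->
  (forall i, `|c i| <= dl) -> forall l th,
  `|\int[P]_w cos (\sum_(i < l) c i * X i w + th) -
    expR (- (\sum_(i < l) c i ^+ 2 * tau / 2)) * cos th| <=
  \sum_(i < l) (2 * e * c i ^+ 2 + (c i ^+ 2 * tau / 2) ^+ 2).
Proof.
move=> e0 He cdl; elim=> [|l IHl] th.
  rewrite !big_ord0 oppr0 expR0 mul1r; under eq_Rintegral do rewrite big_ord0 add0r.
  by rewrite Rintegral_cstP subrr normr0.
rewrite cos_recursion EcosX EsinX !big_ord_recr/=.
have [Hc Hs] := He _ (cdl l).
set a := \int[P]_w cos (_ + th); set a' := \int[P]_w cos (_ + (th - _)).
set C := \int[P]_w _ in Hc *; set S := \int[P]_w _ in Hs *.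
pose z := c l ^+ 2 * tau / 2; pose G := expR (- (\sum_(i < l) c i ^+ 2 * tau / 2)).
have z0 : 0 <= z by rewrite /z divr_ge0// mulr_ge0// sqr_ge0.
have a1 : `|a| <= 1 by apply: norm_Ecos; exact: mlin.
have a'1 : `|a'| <= 1 by apply: norm_Ecos; exact: mlin.
have Ez := expRN_sub_bound z0.
rewrite opprD expRD -/G -/z.
(* The first term carries the induction hypothesis; the others compare one step
   with its gaussian counterpart. *)
have -> : a * C - a' * S - G * expR (- z) * cos th =
    (a - G * cos th) * expR (- z) + a * ((C - 1 + z) - (expR (- z) - 1 + z)) - a' * S by ring.
have ez1 : expR (- z) <= 1 by rewrite -expR0 ler_expR oppr_le0.
rewrite (le_trans (ler_normB _ _))// (@le_trans _ _ (`|a - G * cos th| + (e * c l ^+ 2 + z ^+ 2) + e * c l ^+ 2))//.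
  apply: lerD; last by rewrite normrM -[leRHS]mul1r ler_pM.
  rewrite (le_trans (ler_normD _ _))// lerD//.
    by rewrite normrM (ger0_norm (expR_ge0 _)) ler_piMr.
  rewrite normrM -[leRHS]mul1r ler_pM// (le_trans (ler_normB _ _))// lerD//.
have := IHl th; rewrite -/a -/G; lra.
Qed.

(** Lindeberg-Levy for bounded weights, at the level of shifted cosines. With r
    variables for each unit of n, the weights of the normalized sum are
    O(n^(-1/2)) uniformly, and there are n r of them, so that the total error of
    telescope_bound is at most e O(1) + O(1 / n). *)
Theorem central_limit_cos (b : nat -> R) (B v : R) (r : nat) :
  (forall i, `|b i| <= B) ->
  (forall n, \sum_(i < n * r) b i ^+ 2 * tau = n%:R * v) ->
  forall l th,
  \int[P]_w cos (l * ((Num.sqrt n%:R)^-1 * \sum_(i < n * r) b i * X i w) + th) @[n --> \oo] -->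
  expR (- (l ^+ 2 * v / 2)) * cos th.
Proof.
move=> bB bv l th.
have B0 : 0 <= B by rewrite (le_trans _ (bB 0%N)).
apply/cvgrPdist_le => eps eps0.
pose K := r%:R * (l ^+ 2 * B ^+ 2).
have K0 : 0 <= K by rewrite mulr_ge0// mulr_ge0// sqr_ge0.
pose e := eps / (4 * (K + 1)).
have e0 : 0 < e by rewrite divr_gt0// mulr_gt0// ltr_pwDr.
have [dl dl0 Hdl] := characteristic_expansion sX X0 X2 e0.
pose K2 := r%:R * ((l ^+ 2 * B ^+ 2) * tau / 2) ^+ 2.
have K20 : 0 <= K2 by rewrite mulr_ge0// sqr_ge0.
near=> n.
have n0 : 0 < n%:R :> R by rewrite ltr0n; near: n; exact: nbhs_infty_gt.
have sn0 : 0 < Num.sqrt n%:R :> R by rewrite sqrtr_gt0.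
pose c i := l * (Num.sqrt n%:R)^-1 * b i.
have cdl i : `|c i| <= dl.
  rewrite !normrM normfV (gtr0_norm sn0).
  apply: (@le_trans _ _ (`|l| / Num.sqrt n%:R * B)).
    by rewrite ler_wpM2l// mulr_ge0// invr_ge0 ltW.
  rewrite mulrAC ler_pdivrMr//.
  have A1 : 0 <= `|l| * B by rewrite mulr_ge0.
  have A2 : 0 <= dl * Num.sqrt n%:R by rewrite mulr_ge0// ltW.
  rewrite -(@ler_pXn2r _ 2)//.
  have -> : (dl * Num.sqrt n%:R) ^+ 2 = dl ^+ 2 * n%:R by rewrite exprMn sqr_sqrtr// ltW.
  rewrite -ler_pdivrMl ?exprn_gt0//.
  by near: n; exact: nbhs_infty_ger.
have c2 i : c i ^+ 2 <= l ^+ 2 * B ^+ 2 / n%:R.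
  have -> : c i ^+ 2 = l ^+ 2 * b i ^+ 2 / n%:R.
    by rewrite /c !exprMn exprVn sqr_sqrtr 1?ltW// mulrAC.
  have bB2 : b i ^+ 2 <= B ^+ 2 by rewrite -(real_normK (num_real (b i))) lerXn2r ?nnegrE.
  by apply: ler_wpM2r; [rewrite invr_ge0 ltW|rewrite ler_wpM2l// sqr_ge0].
have sumc : \sum_(i < n * r) c i ^+ 2 * tau / 2 = l ^+ 2 * v / 2.
  have -> : \sum_(i < n * r) c i ^+ 2 * tau / 2 = (l ^+ 2 / n%:R / 2) * \sum_(i < n * r) b i ^+ 2 * tau.
    rewrite mulr_sumr; apply: eq_bigr => i _.
    rewrite /c !exprMn exprVn sqr_sqrtr ?ltW//; by ring.
  by rewrite bv; field; rewrite gt_eqF.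
have -> : \int[P]_w cos (l * ((Num.sqrt n%:R)^-1 * \sum_(i < n * r) b i * X i w) + th) =
    \int[P]_w cos (\sum_(i < n * r) c i * X i w + th).
  apply: eq_Rintegral => w _; congr (cos (_ + th)).
  by rewrite mulrA mulr_sumr; apply: eq_bigr => i _; rewrite mulrA.
rewrite distrC -sumc (le_trans (telescope_bound e0 Hdl cdl (n * r) th))//.
apply: (@le_trans _ _ (\sum_(i < n * r) (2 * e * (l ^+ 2 * B ^+ 2 / n%:R) + (l ^+ 2 * B ^+ 2 / n%:R * tau / 2) ^+ 2))).
  apply: ler_sum => i _; apply: lerD.
    by apply: ler_wpM2l => //; rewrite mulr_ge0// ltW.
  have A0 : 0 <= c i ^+ 2 * tau / 2 by rewrite divr_ge0// mulr_ge0// sqr_ge0.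
  have A1 : c i ^+ 2 * tau / 2 <= l ^+ 2 * B ^+ 2 / n%:R * tau / 2.
    by rewrite ler_wpM2r// ler_wpM2r.
  by rewrite lerXn2r// nnegrE// (le_trans A0).
rewrite sumr_const card_ord -[leLHS]mulr_natl natrM.
have -> : n%:R * r%:R * (2 * e * (l ^+ 2 * B ^+ 2 / n%:R) + (l ^+ 2 * B ^+ 2 / n%:R * tau / 2) ^+ 2)
   = 2 * e * K + K2 / n%:R.
  by rewrite /K /K2; field; rewrite gt_eqF.
have : 2 * e * K <= eps / 2.
  rewrite /e; have -> : 2 * (eps / (4 * (K + 1))) * K = eps / 2 * (K / (K + 1)).
    by field; rewrite gt_eqF// ltr_pwDr.
  by apply: ler_piMr; [rewrite divr_ge0// ltW|rewrite ler_pdivrMr ?ltr_pwDr// mul1r lerDl].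
have : K2 / n%:R <= eps / 2.
  rewrite ler_pdivrMr// -ler_pdivrMl ?divr_gt0//.
  by near: n; exact: nbhs_infty_ger.
lra.
Unshelve. all: by end_near. Qed.

End central_limit.

(** * Independent pairs *)

Section independent_pair.
Context d (T : measurableType d) (R : realType) (P : probability T R).
Implicit Types X Y : T -> R.

(** Tested on bounded functions, the form in which truncation arguments use
    independence. *)
Definition independent_pair X Y := forall (phi psi : R -> R) (K : R),
  measurable_fun setT phi -> measurable_fun setT psi ->
  (forall x, `|phi x| <= K) -> (forall x, `|psi x| <= K) ->
  \int[P]_w (phi (X w) * psi (Y w)) = \int[P]_w phi (X w) * \int[P]_w psi (Y w).

Let window (n : nat) : set R := `[- n%:R, n%:R]%classic.

Let window_cvg (x : R) : \1_(window n) x @[n --> \oo] --> (1 : R).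
Proof.
apply: cvg_near_cst; near=> n; rewrite indicE mem_set// /window /= in_itv/= -ler_norml.
by near: n; exact: nbhs_infty_ger.
Unshelve. all: by end_near. Qed.

Let measurable_window n : measurable (window n). Proof. exact: measurable_itv. Qed.

(** On the event |Y| <= M, which is independent of X and of positive probability
    c for some M, X^2 <= 2 (X + Y)^2 + 2 M^2. Hence E min (X^2, K) <= C / c for
    every K, and K tends to infinity. *)
Lemma independent_pair_sqint X Y : measurable_fun setT X -> measurable_fun setT Y ->
  independent_pair X Y -> sqint P (fun w => X w + Y w) -> sqint P X.
Proof.
move=> mX mY ind [mS iS].
have mwY n : measurable_fun setT (fun w => \1_(window n) (Y w) : R).
  by apply: measurableT_comp => //; exact: measurable_indic.
have [M cM] : exists M, 0 < \int[P]_w \1_(window M) (Y w).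
  have c1 : \int[P]_w \1_(window n) (Y w) @[n --> \oo] --> \int[P]_w (1 : R).
    apply: (@Rdominated_cvg _ _ _ P _ _ _ (cst 1) measurableT mwY _ _ _).2.
    - by move=> w _; exact: window_cvg.
    - exact: (@bounded_integrable _ _ _ _ _ `|1|).
    - by move=> n w _; exact: normr_indic.
  rewrite Rintegral_cstP in c1.
  near \oo => n; exists n.
  by near: n; move/cvgr_gt : c1; apply.
set c := \int[P]_w _ in cM.
pose C := \int[P]_w (2 * (X w + Y w) ^+ 2 + 2 * M%:R ^+ 2).
have iC : P.-integrable setT (EFin \o (fun w => 2 * (X w + Y w) ^+ 2 + 2 * M%:R ^+ 2)).
  apply: RintegrableD => //; first exact: RintegrableZl.
  exact: (@bounded_integrable _ _ _ _ _ `|2 * M%:R ^+ 2|).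
pose phi (K : nat) (x : R) := Num.min (x ^+ 2) K%:R.
have phi0 K x : 0 <= phi K x by rewrite le_min sqr_ge0/=.
have mphi K : measurable_fun setT (phi K).
  by apply: measurable_minr => //; exact: measurable_funX.
have phiK K x : `|phi K x| <= K%:R by rewrite ger0_norm// ge_min lexx orbT.
have bound K : \int[P]_w phi K (X w) <= C / c.
  have -> : \int[P]_w phi K (X w) = (\int[P]_w (phi K (X w) * \1_(window M) (Y w))) / c.
    rewrite (ind (phi K) (\1_(window M)) (Num.max 1 K%:R)) ?mulfK ?gt_eqF//.
    - by move=> x; rewrite le_max phiK orbT.
    - by move=> x; rewrite le_max normr_indic.
  rewrite ler_wpM2r ?invr_ge0 ?(ltW cM)//; apply: le_Rintegral => //.
    apply: (@bounded_integrable _ _ _ _ _ K%:R) => [|w].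
      by apply: measurable_funM => //; exact: measurableT_comp.
    by rewrite normrM -[leRHS]mulr1 ler_pM// normr_indic.
  move=> w _; rewrite indicE; have [YM|_] := boolP (Y w \in window M); last first.
    by rewrite mulr0; have := sqr_ge0 (X w + Y w); have := sqr_ge0 (M%:R : R); lra.
  rewrite mulr1 (@le_trans _ _ (X w ^+ 2))//; first by rewrite ge_min lexx.
  move: YM; rewrite inE /window /= in_itv/= -ler_norml => YM.
  have : Y w ^+ 2 <= M%:R ^+ 2.
    by rewrite -(real_normK (num_real (Y w))) lerXn2r ?nnegrE.
  by have := sqr_ge0 (X w + 2 * Y w); nra.
split => //; apply/integrableP; split.
  by apply/measurable_EFinP; exact: measurable_funX.
apply: (@le_lt_trans _ _ (C / c)%:E); last exact: ltry.
have -> : (\int[P]_w `|(X w ^+ 2)%:E|)%E = (\int[P]_w limn (fun K => (phi K (X w))%:E))%E.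
  apply: eq_integral => w _; apply/esym/cvg_lim => //=.
  rewrite ger0_norm ?sqr_ge0//; apply: cvg_EFin; first exact: nearW.
  apply: cvg_near_cst; near=> K; rewrite /= /phi min_l//.
  by near: K; exact: nbhs_infty_ger.
have mphiX K : measurable_fun setT (fun w => (phi K (X w))%:E).
  by apply/measurable_EFinP; exact: measurableT_comp.
rewrite monotone_convergence//; last 2 first.
- by move=> K w _; rewrite lee_fin.
- move=> w _ a b ab; rewrite lee_fin /phi le_min ge_min lexx/= ge_min.
  by rewrite ler_nat ab orbT.
apply: lime_le.
  apply: ereal_nondecreasing_is_cvgn => a b ab; apply: ge0_le_integral => //.
  - by move=> w _; rewrite lee_fin.
  - move=> w _; rewrite lee_fin /phi le_min ge_min lexx/= ge_min.
    by rewrite ler_nat ab orbT.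
apply: nearW => K.
rewrite -[leLHS]fineK; first by rewrite lee_fin; exact: bound.
apply: integrable_fin_num => //.
by apply: (@bounded_integrable _ _ _ _ _ K%:R) => //; exact: measurableT_comp.
Unshelve. all: by end_near. Qed.

(** Truncate both variables and pass to the limit by dominated convergence. *)
Lemma independent_pair_ip X Y : sqint P X -> sqint P Y ->
  independent_pair X Y -> ip P X Y = \int[P]_w X w * \int[P]_w Y w.
Proof.
move=> sX sY ind; have [mX iX] := sX; have [mY iY] := sY.
pose tr n (x : R) := x * \1_(window n) x.
have mtr n : measurable_fun setT (tr n).
  by apply: measurable_funM => //; exact: measurable_indic.
have trn n x : `|tr n x| <= n%:R.
  rewrite /tr normrM indicE; have [xn|_] := boolP (x \in _); last by rewrite normr0 mulr0.
  by move: xn; rewrite inE /window /= in_itv/= normr1 mulr1 -ler_norml.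
have trx n x : `|tr n x| <= `|x| by rewrite normrM ler_piMr// normr_indic.
have trc x : tr n x @[n --> \oo] --> x.
  by rewrite -[X in _ --> X](mulr1 x); apply: cvgM; [exact: cvg_cst|exact: window_cvg].
have cXY : \int[P]_w (tr n (X w) * tr n (Y w)) @[n --> \oo] --> ip P X Y.
  apply: (@Rdominated_cvg _ _ _ P _ _ _ (fun w => `|X w * Y w|) measurableT _ _ _ _).2.
  - by move=> n; apply: measurable_funM; exact: measurableT_comp.
  - by move=> w _; exact: cvgM.
  - by apply: integrable_norm; exact: sqint_mul.
  - by move=> n w _; rewrite normrM [leRHS]normrM; apply: ler_pM => //; exact: trx.
have cE Z : sqint P Z -> \int[P]_w tr n (Z w) @[n --> \oo] --> \int[P]_w Z w.
  move=> sZ; have [mZ _] := sZ.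
  apply: (@Rdominated_cvg _ _ _ P _ _ _ (fun w => `|Z w|) measurableT _ _ _ _).2.
  - by move=> n; exact: measurableT_comp.
  - by move=> w _; exact: trc.
  - by apply: integrable_norm; exact: sqint_integrable.
  - by move=> n w _; exact: trx.
have cM : \int[P]_w tr n (X w) * \int[P]_w tr n (Y w) @[n --> \oo] --> \int[P]_w X w * \int[P]_w Y w.
  exact: (cvgM (cE _ sX) (cE _ sY)).
have E : (fun n => \int[P]_w (tr n (X w) * tr n (Y w))) =
    (fun n => \int[P]_w tr n (X w) * \int[P]_w tr n (Y w)).
  by apply/funext => n; exact: (ind (tr n) (tr n) n%:R).
by rewrite E in cXY; exact: (cvg_unique _ cXY cM).
Qed.

End independent_pair.

(** * Moments of the increments of a Levy process *)

Section additive_functions.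
Context (R : realType).

Lemma additive_natmul (U : R -> R) :
  (forall a b, 0 < a -> 0 < b -> U (a + b) = U a + U b) ->
  forall n t, 0 < t -> U (n.+1%:R * t) = n.+1%:R * U t.
Proof.
move=> UD; elim=> [|n IHn] t t0; first by rewrite !mul1r.
by rewrite -natr1 !mulrDl !mul1r UD ?IHn// mulr_gt0.
Qed.

(** An additive function that is nonnegative is nondecreasing, so that its values
    are squeezed between those at neighbouring multiples of 1 / N. *)
Lemma additive_ge0_linear (U : R -> R) :
  (forall a b, 0 < a -> 0 < b -> U (a + b) = U a + U b) ->
  (forall a, 0 < a -> 0 <= U a) ->
  forall t, 0 < t -> U t = t * U 1.
Proof.
move=> UD U0 t t0.
have Umono a b : 0 < a -> a <= b -> U a <= U b.
  move=> a0; rewrite le_eqVlt => /predU1P[->//|ab].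
  by rewrite -(subrK a b) addrC UD ?subr_gt0// lerDl U0// subr_gt0.
have U10 : 0 <= U 1 by exact: U0.
have close n : `|U t - t * U 1| <= U 1 / n.+1%:R.
  set N : R := n.+1%:R; have N0 : 0 < N by rewrite ltr0n.
  have Nt0 : 0 < N * t by exact: mulr_gt0.
  have UN : U (N * t) = N * U t by exact: additive_natmul.
  have /andP[k1 k2] := truncn_itv (ltW Nt0).
  set k := Num.trunc (N * t) in k1 k2.
  have u1 : N * U t <= (N * t + 1) * U 1.
    rewrite -UN (@le_trans _ _ (U (k.+1%:R * 1)))//; first by rewrite Umono ?mulr1// ltW.
    by rewrite additive_natmul// ler_wpM2r// -natr1 lerD2r.
  have u2 : (N * t - 1) * U 1 <= N * U t.
    rewrite -UN; have [k0|k0] := posnP k.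
      apply: (@le_trans _ _ 0); last exact: U0.
      by rewrite mulr_le0_ge0// subr_le0 ltW//; move: k2; rewrite k0.
    apply: (@le_trans _ _ (U (k%:R * 1))); last by rewrite Umono ?mulr1// ltr0n.
    rewrite -(prednK k0) additive_natmul// ler_wpM2r// prednK// lerBlDr natr1 ltW//.
  rewrite ler_pdivlMr// -(gtr0_norm N0) -normrM ler_norml.
  by apply/andP; split; lra.
apply/eqP; rewrite -subr_eq0 -normr_le0; apply/ler_addgt0Pl => e e0; rewrite addr0.
near \oo => n; apply: (le_trans (close n)).
rewrite ler_pdivrMr// mulrC -ler_pdivrMr//.
apply: (@le_trans _ _ n%:R); last by rewrite ler_nat.
by near: n; exact: nbhs_infty_ger.
Unshelve. all: by end_near. Qed.

End additive_functions.

Section levy_moments.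
Context d (T : measurableType d) (R : realType) (P : probability T R).
Variables (L : R -> {RV P >-> R}) (sigma : R).
Hypotheses (HL : two_sided_levy_process L)
  (L_mean : ('E_P[L 1%R] = 0)%E)
  (L_var : ('E_P[fun w => (L 1 w ^+ 2)%R] = (sigma ^+ 2)%:E)%E).

Lemma measurable_increment s t : measurable_fun setT (increment L s t).
Proof. by apply: measurable_funB. Qed.

Let inc0 (f : R -> R) : measurable_fun setT f ->
  (\int[P]_w (f (increment L 0 1 w))%:E = \int[P]_w (f (L 1 w))%:E)%E.
Proof.
move=> mf; apply: ae_eq_integral => //.
- by apply/measurable_EFinP; apply: measurableT_comp => //; exact: measurable_increment.
- by apply/measurable_EFinP; exact: measurableT_comp.
- by apply: filterS (levy_start HL) => w L0 _; rewrite /increment L0 subr0.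
Qed.

Let sqint_inc01 : sqint P (increment L 0 1).
Proof.
split; first exact: measurable_increment.
apply/integrableP; split.
  by apply/measurable_EFinP; apply: measurable_funX; exact: measurable_increment.
under eq_integral do rewrite /= ger0_norm ?sqr_ge0//.
rewrite (inc0 (f := fun x => x ^+ 2)); last exact: measurable_funX.
by move: L_var; rewrite unlock => ->; rewrite ltry.
Qed.

Let mean_inc01 : \int[P]_w increment L 0 1 w = 0.
Proof.
rewrite /Rintegral (inc0 (f := id))//.
by move: L_mean; rewrite unlock => ->.
Qed.

Let ip_inc01 : ip P (increment L 0 1) (increment L 0 1) = sigma ^+ 2.
Proof.
rewrite /ip /Rintegral (inc0 (f := fun x => x * x)); last exact: measurable_funM.
by move: L_var; rewrite unlock => ->.
Qed.

Lemma increment_chasles s t u w : increment L s u w = increment L s t w + increment L t u w.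
Proof. by rewrite /increment; ring. Qed.

Let stationary s t : s <= t ->
  identically_distributed P (increment L 0 (t - s)) (increment L s t).
Proof.
move=> st; have ts : 0 <= t - s by rewrite subr_ge0.
by have := levy_stationary_increments HL s ts; rewrite add0r subrK.
Qed.

(** Independence is given along infinite increasing sequences of times: s, t, u is
    continued by u + 1, u + 2 and so on. *)
Let independent s t u : s < t -> t < u ->
  independent_pair P (increment L s t) (increment L t u).
Proof.
move=> st tu phi psi K mphi mpsi phiK psiK.
pose tt k : R := match k with 0 => s | 1 => t | k.+2 => u + k%:R end.
have ttmono : {homo tt : i j / (i < j)%N >-> i < j}.
  move=> [|[|i]] [|[|j]]//= ij.
  - by rewrite (lt_trans st)// (lt_le_trans tu)// lerDl.
  - by rewrite (lt_le_trans tu)// lerDl.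
  - by rewrite ltrD2l ltr_nat.
have ind := @levy_independent_increments _ _ _ _ _ HL 2 tt ttmono.
pose p (i : 'I_2) := if i == ord0 then phi else psi.
have := @mutually_independent_prod _ _ _ P 2 _ p K _ ind _ _.
rewrite !big_ord_recl big_ord0 /p/= mulr1.
under eq_Rintegral => w _ do rewrite !big_ord_recl big_ord0 /= mulr1 addr0.
rewrite addr0; apply.
- by move=> i; exact: measurable_increment.
- by move=> i; case: ifP.
- by move=> i x; case: ifP.
Qed.

Let sqint_nat n : sqint P (increment L 0 n%:R).
Proof.
elim: n => [|n IHn].
  have -> : increment L 0 0 = fun=> 0 by apply/funext => w; rewrite /increment subrr.
  exact: sqint0.
have -> : increment L 0 n.+1%:R = (fun w => increment L 0 n%:R w + increment L n%:R n.+1%:R w).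
  by apply/funext => w; exact: increment_chasles.
apply: sqintD => //.
apply: (identically_distributed_sqint _ _ (stationary _)); try exact: measurable_increment.
  by rewrite ler_nat.
by rewrite -natr1 addrAC subrr add0r.
Qed.

(** The increment over [0, t] is one of two independent summands of the increment
    over [0, n], which is a sum of variables with the law of L_1. *)
Let sqint_inc0 t : 0 <= t -> sqint P (increment L 0 t).
Proof.
rewrite le_eqVlt => /predU1P[<-|t0]; first exact: (sqint_nat 0).
pose n := (Num.trunc t).+1.
have tn : t < n%:R by have /andP[] := truncn_itv (ltW t0).
apply: (independent_pair_sqint _ _ (independent t0 tn)); try exact: measurable_increment.
under eq_fun do rewrite -increment_chasles; exact: sqint_nat.
Qed.

Let m t := \int[P]_w increment L 0 t w.
Let V t := ip P (increment L 0 t) (increment L 0 t).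
(** The variance of the increment over [0, t]. Additivity and nonnegativity make it
    linear in t, while the mean is only known to be additive at this stage. *)
Let U t := V t - m t ^+ 2.

Let inc_split a b : increment L 0 (a + b) = fun w => increment L 0 a w + increment L a (a + b) w.
Proof. by apply/funext => w; exact: increment_chasles. Qed.

Let transfer a b : 0 < a -> 0 < b -> [/\ sqint P (increment L a (a + b)),
  \int[P]_w increment L a (a + b) w = m b & ip P (increment L a (a + b)) (increment L a (a + b)) = V b].
Proof.
move=> a0 b0; have ab : a <= a + b by rewrite lerDl ltW.
have st := stationary ab; rewrite (addrC a) addrK (addrC b) in st.
have m1 := measurable_increment 0 b; have m2 := measurable_increment a (a + b).
split.
- apply: (identically_distributed_sqint m1 m2 st); exact: sqint_inc0 (ltW b0).
- by rewrite /m -(identically_distributed_Rintegral (f := id) m1 m2 st).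
- by rewrite /V (identically_distributed_ip m1 m2 st).
Qed.

Let mD a b : 0 < a -> 0 < b -> m (a + b) = m a + m b.
Proof.
move=> a0 b0; have [s1 m1 _] := transfer a0 b0.
rewrite {1}/m inc_split RintegralD//; first by rewrite m1.
- exact: sqint_integrable (sqint_inc0 (ltW a0)).
- exact: sqint_integrable.
Qed.

Let UD a b : 0 < a -> 0 < b -> U (a + b) = U a + U b.
Proof.
move=> a0 b0; have [s1 m1 V1] := transfer a0 b0; have s0 := sqint_inc0 (ltW a0).
have ab : a < a + b by rewrite ltrDl.
rewrite /U mD// {1}/V inc_split ip_sqrD// V1 (independent_pair_ip s0 s1 (independent a0 ab)) m1.
by rewrite -/(V a) -/(m a); ring.
Qed.

Let Ucenter t : 0 <= t ->
  ip P (fun w => increment L 0 t w - m t) (fun w => increment L 0 t w - m t) = U t.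
Proof.
move=> t0; have s0 := sqint_inc0 t0; have sc := sqint_cst P (m t).
rewrite ip_sqrB// /U -/(V t).
have -> : ip P (increment L 0 t) (fun=> m t) = m t ^+ 2.
  by rewrite /ip RintegralZr//; exact: sqint_integrable.
by rewrite /ip Rintegral_cstP -expr2; ring.
Qed.

Let U_ge0 t : 0 < t -> 0 <= U t.
Proof. by move=> t0; rewrite -Ucenter ?ip_ge0// ltW. Qed.

Let U_linear t : 0 < t -> U t = t * U 1.
Proof. exact: additive_ge0_linear UD U_ge0 t. Qed.

(** The mean is additive and vanishes on the positive rationals, so that a nonzero value
    m t is also taken at t modulo 1 / N, arbitrarily close to 0. *)
Let m_small t n : 0 < t -> m t <> 0 ->
  exists2 s, 0 < s <= n.+1%:R^-1 & m s = m t.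
Proof.
move=> t0 mt0; set N : R := n.+1%:R; have N0 : 0 < N by rewrite ltr0n.
have Ni0 : 0 < N^-1 by rewrite invr_gt0.
have mN : m N^-1 = 0.
  have := additive_natmul mD n Ni0; rewrite divff ?gt_eqF// (mean_inc01 : m 1 = 0) => /esym/eqP.
  by rewrite mulf_eq0 gt_eqF//= => /eqP.
have mkN k : m (k.+1%:R * N^-1) = 0 by rewrite additive_natmul// mN mulr0.
have /andP[k1 k2] := truncn_itv (ltW (mulr_gt0 N0 t0)).
set k := Num.trunc (N * t) in k1 k2.
have tk : t <= k.+1%:R / N by rewrite ler_pdivlMr// mulrC ltW.
have [k0|k0] := posnP k.
  by exists t => //; rewrite t0 (le_trans tk)// k0 mul1r.
have := mkN k.-1; rewrite prednK// => mk.
have kt : k%:R / N <= t by rewrite ler_pdivrMr// mulrC.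
move: kt; rewrite le_eqVlt => /predU1P[kt|kt]; first by rewrite -kt mk in mt0.
exists (t - k%:R / N).
  rewrite subr_gt0 kt/= lerBlDr; apply: (le_trans tk).
  by rewrite -natr1 mulrDl mul1r addrC.
have kN0 : 0 < k%:R / N by rewrite divr_gt0// ltr0n.
rewrite [RHS](_ : _ = m (k%:R / N + (t - k%:R / N))); last by congr m; ring.
by rewrite [RHS]mD ?subr_gt0// mk add0r.
Qed.

(** An additive function need not be linear; regularity of the paths excludes the
    pathological ones. If m t were nonzero, m_small would give times s_n tending
    to 0 with mean m t and variance O(s_n), contradicting that the increments
    over [0, s_n] tend to 0 almost surely by right-continuity. *)
Let m_eq0 t : 0 < t -> m t = 0.
Proof.
move=> t0; apply: contrapT => mt0.
have /choice[s Hs] : forall n, exists s, 0 < s <= n.+1%:R^-1 /\ m s = m t.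
  by move=> n; have [s s0 ms] := m_small n t0 mt0; exists s.
have s0 n : 0 < s n by have [/andP[]] := Hs n.
have sn n : s n <= n.+1%:R^-1 by have [/andP[]] := Hs n.
have ms n : m (s n) = m t by have [] := Hs n.
have scvg : s @ \oo --> (0 : R).
  apply: (squeeze_cvgr _ (cvg_cst 0) (@cvg_harmonic R)).
  by apply: nearW => n; rewrite /= sn ltW.
(* A bounded gauge of the size of an increment: it allows dominated convergence
   without uniform integrability. *)
pose phi (x : R) := Num.min 1 `|x|.
have phi1 x : `|phi x| <= 1 by rewrite ger0_norm ?ge_min ?lexx// le_min ler01/=.
have mphi : measurable_fun setT phi by apply: measurable_minr.
have phiD x y : phi (x + y) <= phi x + `|y|.
  rewrite /phi; have := ler_normD x y.
  by have := normr_ge0 y; have := normr_ge0 x; have [|] := leP 1 `|x|; have [|] := leP 1 `|x + y|; lra.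
have c0 : \int[P]_w phi (increment L 0 (s n) w) @[n --> \oo] --> \int[P]_w (0 : R).
  apply: (@Rdominated_cvg_ae _ _ _ P setT _ _ (cst 1)) => //.
  - by move=> n; apply: measurableT_comp => //; exact: measurable_increment.
  - apply: filterS (levy_cadlag_paths HL) => w cw _.
    have [cr _] := cw 0.
    have cL : L (s n) w @[n --> \oo] --> L 0 w.
      by move/cvg_at_rightP : cr; apply; split => // n; exact: s0.
    have cd : L (s n) w - L 0 w @[n --> \oo] --> L 0 w - L 0 w.
      by apply: cvgB => //; exact: cvg_cst.
    have ci : `|increment L 0 (s n) w| @[n --> \oo] --> `|L 0 w - L 0 w|.
      exact: (cvg_norm cd).
    rewrite subrr normr0 in ci.
    apply: (squeeze_cvgr _ (cvg_cst 0) ci); apply: nearW => n.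
    by rewrite /phi le_min ler01 normr_ge0/= ge_min lexx orbT.
  - exact: (@bounded_integrable _ _ _ _ _ `|1|).
rewrite Rintegral_cstP in c0.
have c1 : Num.sqrt (s n * U 1) @[n --> \oo] --> (0 : R).
  rewrite -sqrtr0; apply: (@continuous_cvg _ _ _ _ _ _ (@Num.sqrt R)); first exact: sqrt_continuous.
  by rewrite -(mul0r (U 1)); apply: cvgM; [exact: scvg|exact: cvg_cst].
(* The distance between the increment and its mean m t is small in L^1. *)
have bound n : phi (m t) <= \int[P]_w phi (increment L 0 (s n) w) + Num.sqrt (s n * U 1).
  have sinc := sqint_inc0 (ltW (s0 n)).
  have sc : sqint P (fun w => increment L 0 (s n) w - m (s n)) by apply: sqintB => //; exact: sqint_cst.
  have := Rintegral_norm_le_ip sc; rewrite (Ucenter (ltW (s0 n))) U_linear// => le1.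
  apply: le_trans (lerD (lexx _) le1).
  have i1 : P.-integrable setT (EFin \o (fun w => phi (increment L 0 (s n) w))).
    by apply: (@bounded_integrable _ _ _ _ _ 1) => //; apply: measurableT_comp => //; exact: measurable_increment.
  have i2 : P.-integrable setT (EFin \o (fun w => `|increment L 0 (s n) w - m (s n)|)).
    by apply: integrable_norm; exact: sqint_integrable.
  rewrite -RintegralD// -[leLHS](Rintegral_cstP P); apply: le_Rintegral => //.
  - exact: (@bounded_integrable _ _ _ _ _ `|phi (m t)|).
  - exact: RintegrableD.
  - move=> w _; rewrite -(ms n) distrC (le_trans _ (phiD _ _))//.
    by rewrite addrC subrK.
have p0 : 0 < phi (m t) by rewrite lt_min ltr01 normr_gt0; apply/eqP.
have p20 : 0 < phi (m t) / 2 by rewrite divr_gt0.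
near \oo => n; have := bound n.
have : \int[P]_w phi (increment L 0 (s n) w) < phi (m t) / 2.
  by near: n; apply: (cvgr_lt _ c0).
have : Num.sqrt (s n * U 1) < phi (m t) / 2 by near: n; apply: (cvgr_lt _ c1).
lra.
Unshelve. all: by end_near. Qed.

Lemma increment_moments s t : s <= t -> [/\ sqint P (increment L s t),
  \int[P]_w increment L s t w = 0 &
  ip P (increment L s t) (increment L s t) = sigma ^+ 2 * (t - s)].
Proof.
move=> st; have ts0 : 0 <= t - s by rewrite subr_ge0.
have m1 := measurable_increment 0 (t - s); have m2 := measurable_increment s t.
have st' := stationary st; have s1 := sqint_inc0 ts0.
have s2 := identically_distributed_sqint m1 m2 st' s1.
split => //.
  rewrite -(identically_distributed_Rintegral (f := id) m1 m2 st')//.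
  move: ts0; rewrite le_eqVlt => /predU1P[<-|ts0]; last exact: m_eq0.
  by under eq_Rintegral do rewrite /increment subrr; rewrite Rintegral_cstP.
rewrite -(identically_distributed_ip m1 m2 st').
move: ts0; rewrite le_eqVlt => /predU1P[<-|ts0].
  by rewrite mulr0 /ip; under eq_Rintegral do rewrite /increment subrr mul0r; rewrite Rintegral_cstP.
have Ut := U_linear ts0; rewrite /U !m_eq0// expr0n/= !subr0 in Ut.
by rewrite -/(V (t - s)) Ut /V ip_inc01 mulrC.
Qed.

Lemma sqint_increment s t : sqint P (increment L s t).
Proof.
have [st|/ltW ts] := leP s t; first by have [] := increment_moments st.
have [H _ _] := increment_moments ts.
have := sqintZ (-1) H; congr sqint; apply/funext => w; rewrite /increment; ring.
Qed.

Let ip_increment_sqr s t : ip P (increment L s t) (increment L s t) = sigma ^+ 2 * `|t - s|.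
Proof.
have [st|/ltW ts] := leP s t.
  by have [_ _ ->] := increment_moments st; rewrite ger0_norm// subr_ge0.
have [_ _] := increment_moments ts; rewrite distrC (ger0_norm (_ : 0 <= s - t)) ?subr_ge0// => <-.
by apply: eq_Rintegral => w _; rewrite /increment; ring.
Qed.

(** Polarization turns the variance of increments into their covariance. *)
Lemma ip_increment a b a' b' :
  ip P (increment L a b) (increment L a' b') =
  sigma ^+ 2 * ((`|b - a'| + `|a - b'| - `|b - b'| - `|a - a'|) / 2).
Proof.
have -> : sigma ^+ 2 * ((`|b - a'| + `|a - b'| - `|b - b'| - `|a - a'|) / 2) =
  2^-1 * (sigma ^+ 2 * `|b - a'| + sigma ^+ 2 * `|a - b'| -
          sigma ^+ 2 * `|b - b'| - sigma ^+ 2 * `|a - a'|) by field.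
rewrite -!ip_increment_sqr /ip.
have i s t : P.-integrable setT (EFin \o (fun w => increment L s t w * increment L s t w)).
  by apply: sqint_mul; exact: sqint_increment.
rewrite -RintegralD// -RintegralB//; last exact: RintegrableD.
rewrite -RintegralB//; last by apply: RintegrableB => //; exact: RintegrableD.
rewrite -RintegralZl//; last by do 2 apply: RintegrableB => //; exact: RintegrableD.
by apply: eq_Rintegral => w _; rewrite /increment; field.
Qed.

End levy_moments.

(** * The integral with respect to a Levy process is isometric *)

Section step_integrals.
Context d (T : measurableType d) (R : realType) (P : probability T R).
Notation mu := (@lebesgue_measure R).

Lemma sqint_indic_itv (a b : R) : sqint mu (\1_(`]a, b]%classic)).
Proof.
split; first exact: measurable_indic.
have := @integrable_indic_itv R a b false false.
apply: eq_integrable => // x _ /=.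
by rewrite indicE; case: (_ \in _); rewrite ?expr1n ?expr0n.
Qed.

(** The same polarized form as for increments (ip_increment), so that the isometry
    on steps is a comparison of coefficients. *)
Lemma ip_indic_itv (a b a' b' : R) : a <= b -> a' <= b' ->
  ip mu (\1_(`]a, b]%classic)) (\1_(`]a', b']%classic)) =
  (`|b - a'| + `|a - b'| - `|b - b'| - `|a - a'|) / 2.
Proof.
move=> ab ab'.
have -> : ip mu (\1_(`]a, b]%classic)) (\1_(`]a', b']%classic)) =
    fine (mu (`](Num.max a a'), (Num.min b b')]%classic)).
  rewrite /ip /Rintegral; congr fine.
  have := @integral_indic _ _ _ mu setT measurableT (`](Num.max a a'), (Num.min b b')]%classic) (measurable_itv _).
  rewrite setIT => <-; apply: eq_integral => x _; congr EFin.
  rewrite !indicE -natrM mulnb; congr (_%:R); congr nat_of_bool.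
  by apply/andP/idP; rewrite !inE /= !in_itv/= ?gt_max ?le_min => H; [case: H => /andP[-> ->] /andP[-> ->]|move: H => /andP[/andP[-> ->] /andP[-> ->]]].
rewrite lebesgue_measure_itv/= lte_fin.
have [H1|H1] := leP a a'; have [H2|H2] := leP b b'; case: ltP => H3 /=;
  case: (ger0P (b - a')) => H4; case: (ger0P (a - b')) => H5;
  case: (ger0P (b - b')) => H6; case: (ger0P (a - a')) => H7; lra.
Qed.

Variables (L : R -> {RV P >-> R}) (sigma : R).
Hypotheses (HL : two_sided_levy_process L)
  (L_mean : ('E_P[L 1%R] = 0)%E)
  (L_var : ('E_P[fun w => (L 1 w ^+ 2)%R] = (sigma ^+ 2)%:E)%E).

Let sinc s t : sqint P (increment L s t).
Proof. exact: sqint_increment HL L_mean L_var s t. Qed.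

Lemma sqint_step g I : step_integral L g I -> sqint mu g /\ sqint P I.
Proof.
move=> [n [a [b [c [ab gE IE]]]]]; split.
  rewrite (funext gE); apply: sqint_sum => i.
  by apply: sqintZ; exact: sqint_indic_itv.
by rewrite (funext IE); apply: sqint_sum => i; exact: sqintZ.
Qed.

Lemma step_mean g I : step_integral L g I -> \int[P]_w I w = 0.
Proof.
move=> [n [a [b [c [ab gE IE]]]]]; rewrite (funext IE).
have ii i : P.-integrable setT (EFin \o (fun w => c i * increment L (a i) (b i) w)).
  by apply: RintegrableZl => //; exact: sqint_integrable.
rewrite (Rintegral_sum _ measurableT ii).2 big1// => i _.
rewrite RintegralZl//; last exact: sqint_integrable.
by have [_ -> _] := increment_moments HL L_mean L_var (ab i); rewrite mulr0.
Qed.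

Lemma step_isometry g I h J : step_integral L g I -> step_integral L h J ->
  ip P I J = sigma ^+ 2 * ip mu g h.
Proof.
move=> [n [a [b [c [ab gE IE]]]]] [n' [a' [b' [c' [ab' hE JE]]]]].
rewrite (funext IE) (funext JE) (funext gE) (funext hE).
have sJ : sqint P (fun w => \sum_(j < n') c' j * increment L (a' j) (b' j) w).
  by apply: sqint_sum => j; exact: sqintZ.
have sh : sqint mu (fun x => \sum_(j < n') c' j * \1_(`]a' j, b' j]%classic) x).
  by apply: sqint_sum => j; apply: sqintZ; exact: sqint_indic_itv.
rewrite !ip_suml//; last 2 first.
- by move=> i; apply: sqintZ; exact: sqint_indic_itv.
- by move=> i; exact: sqintZ.
rewrite mulr_sumr; apply: eq_bigr => i _.
rewrite !ipZl//; last exact: sqint_indic_itv.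
rewrite !ip_sumr//; last 3 first.
- by move=> j; apply: sqintZ; exact: sqint_indic_itv.
- exact: sqint_indic_itv.
- by move=> j; exact: sqintZ.
rewrite mulrCA; congr (_ * _); rewrite mulr_sumr; apply: eq_bigr => j _.
rewrite !ipZr//; try exact: sqint_indic_itv.
by rewrite (ip_increment HL L_mean L_var) ip_indic_itv//; ring.
Qed.

(** The content of levy_integral with norms replaced by inner products; it also
    covers the integrals of step functions, for which the sequences are constant. *)
Definition mean_square_integral (f : R -> R) (Y : T -> R) : Prop :=
  [/\ sqint mu f, sqint P Y & exists (g : (R -> R)^nat) (I : (T -> R)^nat),
    [/\ forall n, step_integral L (g n) (I n),
      ip mu (fun x => g n x - f x) (fun x => g n x - f x) @[n --> \oo] --> 0 &
      ip P (fun w => I n w - Y w) (fun w => I n w - Y w) @[n --> \oo] --> 0]].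

Lemma levy_integral_mean_square f Y : sqint mu f -> levy_integral L f Y ->
  mean_square_integral f Y.
Proof.
move=> sf [/Lfun2_sqint sY [g [I [step cg cI]]]]; split=> //; exists g, I; split => //.
- apply: Lnorm2_cvg0 => // n; apply: sqintB => //.
  by have [] := sqint_step (step n).
- apply: Lnorm2_cvg0 => // n; apply: sqintB => //.
  by have [] := sqint_step (step n).
Qed.

Lemma step_mean_square g I : step_integral L g I -> mean_square_integral g I.
Proof.
move=> st; have [sg sI] := sqint_step st; split => //.
exists (fun=> g), (fun=> I); split => //.
- rewrite (_ : (fun n => _) = cst 0); first exact: cvg_cst.
  apply/funext => n; rewrite /ip; under eq_Rintegral do rewrite subrr mul0r.
  by rewrite Rintegral_cst// mul0r.
- rewrite (_ : (fun n => _) = cst 0); first exact: cvg_cst.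
  apply/funext => n; rewrite /ip; under eq_Rintegral do rewrite subrr mul0r.
  by rewrite Rintegral_cst// mul0r.
Qed.

(** Stated bilinearly, so that covariances are obtained without forming linear
    combinations of integrals. *)
Theorem ito_isometry f Y h Z : mean_square_integral f Y -> mean_square_integral h Z ->
  ip P Y Z = sigma ^+ 2 * ip mu f h.
Proof.
move=> [sf sY [gf [If [stf cgf cIf]]]] [sh sZ [gh [Ih [sth cgh cIh]]]].
have sgf n := (sqint_step (stf n)).1; have sIf n := (sqint_step (stf n)).2.
have sgh n := (sqint_step (sth n)).1; have sIh n := (sqint_step (sth n)).2.
have c1 : ip P (If n) (Ih n) @[n --> \oo] --> ip P Y Z by exact: ip_cvg.
have c2 : sigma ^+ 2 * ip mu (gf n) (gh n) @[n --> \oo] --> sigma ^+ 2 * ip mu f h.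
  by apply: cvgM; [exact: cvg_cst|exact: ip_cvg].
have E : (fun n => ip P (If n) (Ih n)) = (fun n => sigma ^+ 2 * ip mu (gf n) (gh n)).
  by apply/funext => n; exact: step_isometry.
by rewrite E in c1; exact: (cvg_unique _ c1 c2).
Qed.

(** The mean is the inner product with 1, hence continuous in mean square. *)
Lemma mean_square_integral_mean f Y : mean_square_integral f Y -> \int[P]_w Y w = 0.
Proof.
move=> [sf sY [g [I [st cg cI]]]].
have sI n := (sqint_step (st n)).2.
have c1 : ip P (I n) (fun=> 1) @[n --> \oo] --> ip P Y (fun=> 1).
  apply: ip_cvg => //; try by move=> *; exact: sqint_cst.
  - rewrite (_ : (fun n => _) = cst 0); first exact: cvg_cst.
    apply/funext => n; rewrite /ip; under eq_Rintegral do rewrite subrr mul0r.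
    by rewrite Rintegral_cst// mul0r.
have ip1 Z : ip P Z (fun=> 1) = \int[P]_w Z w.
  by rewrite /ip; under eq_Rintegral do rewrite mulr1.
rewrite ip1 in c1.
have E : (fun n => ip P (I n) (fun=> 1)) = cst 0.
  by apply/funext => n; rewrite ip1 (step_mean (st n)).
rewrite E in c1; exact: (cvg_unique _ c1 (cvg_cst 0)).
Qed.

End step_integrals.

(** * Sums over the integers *)

Section bilateral_sums.
Context (R : realType).
Implicit Types a b : int -> R.

Definition bilateral_summable a : Prop := cvgn (series (fun n => a (Posz n))) /\
  cvgn (series (fun n => a (Negz n))).

(** Row i of the array sums to a partial sum of a over 0, ..., i plus one over the
    n - 1 - i first negative integers. Reversing the order of the rows in the second
    part, the double sum becomes a sum of two-sided partial sums, to which the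
    Cesaro theorem applies. *)
Lemma cesaro_bilateral a : bilateral_summable a ->
  n%:R^-1 * \sum_(i < n) \sum_(k < n) a (Posz i - Posz k) @[n --> \oo] --> bilateral_sum a.
Proof.
move=> [ca cb]; pose sp := series (fun n => a (Posz n)); pose sn := series (fun n => a (Negz n)).
have inner (n : nat) (i : 'I_n) :
    \sum_(k < n) a (Posz i - Posz k) = sp i.+1 + sn (rev_ord i).
  rewrite -(big_mkord xpredT (fun k => a (Posz i - Posz k))) (@big_cat_nat _ _ _ i.+1)//=.
  congr (_ + _).
    rewrite /sp /series/= big_nat_rev/=; apply: eq_big_nat => k ki; congr a.
    by rewrite add0n subSS subzn ?leq_subr//; congr Posz; rewrite subKn// -ltnS.
  rewrite -{1}(addn0 i.+1) addnC big_addn /sn /series/=.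
  apply: eq_big_nat => k _; congr a.
  by rewrite NegzE PoszD -addn1 PoszD; lia.
pose u n := sp n.+1 + sn n.
have cu : u @ \oo --> bilateral_sum a.
  by apply: cvgD => //; rewrite (cvg_shiftS sp).
have := cesaro cu; rewrite /arithmetic_mean => cm.
rewrite -(cvg_shiftS (fun n => n%:R^-1 * \sum_(i < n) \sum_(k < n) a (Posz i - Posz k))).
apply: cvg_trans cm; apply: near_eq_cvg; apply: nearW => n /=.
congr (_ * _); rewrite /series/= big_mkord /u big_split/=.
under [RHS]eq_bigr => i _ do rewrite inner.
rewrite big_split/=; congr (_ + _).
by rewrite (reindex_inj rev_ord_inj)/=.
Qed.

Lemma bilateral_sumD a b : bilateral_summable a -> bilateral_summable b ->
  bilateral_summable (fun j => a j + b j) /\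
  bilateral_sum (fun j => a j + b j) = bilateral_sum a + bilateral_sum b.
Proof.
move=> [a1 a2] [b1 b2]; rewrite /bilateral_summable /bilateral_sum.
have E (f g : nat -> R) : series (fun n => f n + g n) = (fun n => series f n + series g n).
  by apply/funext => n; rewrite /series/= big_split.
rewrite !E; split; first by split; exact: is_cvgD.
by rewrite !limD//; ring.
Qed.

Lemma bilateral_sumZ k a : bilateral_summable a ->
  bilateral_summable (fun j => k * a j) /\
  bilateral_sum (fun j => k * a j) = k * bilateral_sum a.
Proof.
move=> [a1 a2]; rewrite /bilateral_summable /bilateral_sum.
have E (f : nat -> R) : series (fun n => k * f n) = (fun n => k * series f n).
  by apply/funext => n; rewrite /series/= mulr_sumr.
rewrite !E; split; first by split; apply: is_cvgM => //; exact: is_cvg_cst.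
have Lm (f : nat -> R) : cvgn f -> limn (fun n => k * f n) = k * limn f.
  by move=> cf; apply/cvg_lim => //; apply: cvgM => //; exact: cvg_cst.
by rewrite !Lm//; ring.
Qed.

Lemma bilateral_sumB a b : bilateral_summable a -> bilateral_summable b ->
  bilateral_summable (fun j => a j - b j) /\
  bilateral_sum (fun j => a j - b j) = bilateral_sum a - bilateral_sum b.
Proof.
move=> sa sb; have [s1 e1] := bilateral_sumZ (-1) sb; have := bilateral_sumD sa s1.
by rewrite e1; under [X in bilateral_summable X]eq_fun do rewrite mulN1r;
  under [X in bilateral_sum X = _]eq_fun do rewrite mulN1r; rewrite mulN1r.
Qed.

End bilateral_sums.

Section integer_sums.
Context (R : realType).
Local Open Scope ereal_scope.

Lemma esum_int (a : int -> \bar R) : (forall j, 0 <= a j) ->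
  \esum_(j in [set: int]) a j =
  \sum_(k <oo) a (Posz k) + \sum_(k <oo) a (Negz k).
Proof.
move=> a0; rewrite (esumID (range Posz))// !setTI; congr (_ + _).
- rewrite (esum_image setT Posz)//; last by move=> x y _ _ [].
  by rewrite nneseries_esumT.
- have -> : ~` range Posz = range Negz.
    apply/seteqP; split => [[k|k] /= H|_ [k _ <-]] //=.
    + by exfalso; apply: H; exists k.
    + by exists k.
    + by move=> [j].
  rewrite (esum_image setT Negz)//; last by move=> x y _ _ [].
  by rewrite nneseries_esumT.
Qed.

Lemma esum_int_shift (a : int -> \bar R) (m : int) :
  \esum_(j in [set: int]) a (j + m)%R = \esum_(j in [set: int]) a j.
Proof.
rewrite [RHS](reindex_esum setT setT (fun j => j + m)%R)//; split => //.
  by move=> x y _ _ /addIr.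
by move=> y _; exists (y - m)%R => //; rewrite subrK.
Qed.

Lemma esum_intZ (a : int -> \bar R) (k : R) : (0 <= k)%R -> (forall j, 0 <= a j) ->
  \esum_(j in [set: int]) (k%:E * a j) = k%:E * \esum_(j in [set: int]) a j.
Proof.
move=> k0 a0; rewrite !esum_int//; last by move=> j; rewrite mule_ge0.
rewrite !nneseriesZl//; first by rewrite ge0_muleDr//; exact: nneseries_ge0.
all: by move=> *; exact: a0.
Qed.

Lemma esum_int_swap (a : int -> int -> \bar R) : (forall i j, 0 <= a i j) ->
  \esum_(i in [set: int]) \esum_(j in [set: int]) a i j =
  \esum_(j in [set: int]) \esum_(i in [set: int]) a i j.
Proof.
move=> a0; rewrite !esum_esum//.
rewrite (reindex_esum (setT `*`` (fun=> setT)) _ (fun x : int * int => (x.2, x.1)))//; split=> //=.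
by move=> [i1 i2] [j1 j2] /= _ _ [] -> ->.
by move=> [i1 i2] _ /=; exists (i2, i1).
Qed.

Lemma esum_single (a : int -> \bar R) (m : int) : 0 <= a m ->
  (forall j, j != m -> a j = 0) -> \esum_(j in [set: int]) a j = a m.
Proof.
move=> am aj; rewrite -[RHS](@esum_set1 R int m a)// [RHS]esum_mkcond.
apply: eq_esum => j _; case: ifPn => // /negP jm; rewrite aj//.
by apply/negP => /eqP jm'; apply: jm; rewrite inE /= jm'.
Qed.

Lemma bilateral_sum_esum (a : int -> R) : (forall j, (0 <= a j)%R) ->
  \esum_(j in [set: int]) (a j)%:E < +oo ->
  bilateral_summable a /\ (bilateral_sum a)%:E = \esum_(j in [set: int]) (a j)%:E.
Proof.
move=> a0; rewrite esum_int; last by move=> j; rewrite lee_fin.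
move=> fin.
have p0 : 0 <= \sum_(k <oo) (a (Posz k))%:E by apply: nneseries_ge0 => *; rewrite lee_fin.
have n0 : 0 <= \sum_(k <oo) (a (Negz k))%:E by apply: nneseries_ge0 => *; rewrite lee_fin.
have pf : \sum_(k <oo) (a (Posz k))%:E \is a fin_num.
  by rewrite ge0_fin_numE//; apply: le_lt_trans fin; rewrite leeDl.
have nf : \sum_(k <oo) (a (Negz k))%:E \is a fin_num.
  by rewrite ge0_fin_numE//; apply: le_lt_trans fin; rewrite leeDr.
have half (f : nat -> R) : (forall k, (0 <= f k)%R) -> \sum_(k <oo) (f k)%:E \is a fin_num ->
    cvgn (series f) /\ (limn (series f))%:E = \sum_(k <oo) (f k)%:E.
  move=> f0 ff.
  have c : (fun n => (series f n)%:E) @ \oo --> \sum_(k <oo) (f k)%:E.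
    have -> : (fun n => (series f n)%:E) = (fun n => \sum_(0 <= k < n) (f k)%:E).
      by apply/funext => n; rewrite /series/= sumEFin.
    by apply: is_cvg_ereal_nneg_natsum => k _; rewrite lee_fin.
  have c' : series f @ \oo --> fine (\sum_(k <oo) (f k)%:E).
    by rewrite -(fineK ff) in c; exact: (fine_cvg c).
  split; first by apply/cvg_ex; exists (fine (\sum_(k <oo) (f k)%:E)).
  by rewrite (cvg_lim _ c')// fineK.
have [cp Ep] := half (fun k => a (Posz k)) (fun k => a0 _) pf.
have [cn En] := half (fun k => a (Negz k)) (fun k => a0 _) nf.
by split => //; rewrite /bilateral_sum EFinD Ep En.
Qed.

End integer_sums.

Section integral_integer_sums.
Context d (T : measurableType d) (R : realType) (mu : {measure set T -> \bar R}).
Local Open Scope ereal_scope.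

Lemma measurable_esum_int (D : set T) (f : int -> T -> \bar R) :
  (forall j, measurable_fun D (f j)) -> (forall j x, 0 <= f j x) ->
  measurable_fun D (fun x => \esum_(j in [set: int]) f j x).
Proof.
move=> mf f0.
have -> : (fun x => \esum_(j in [set: int]) f j x) =
    (fun x => \sum_(k <oo) f (Posz k) x + \sum_(k <oo) f (Negz k) x).
  by apply/funext => x; rewrite esum_int.
by apply: emeasurable_funD; apply: ge0_emeasurable_sum => //.
Qed.

Lemma integral_esum_int (D : set T) (f : int -> T -> \bar R) : measurable D ->
  (forall j, measurable_fun D (f j)) -> (forall j x, 0 <= f j x) ->
  \int[mu]_(x in D) (\esum_(j in [set: int]) f j x) =
  \esum_(j in [set: int]) \int[mu]_(x in D) f j x.
Proof.
move=> mD mf f0; rewrite [RHS]esum_int; last by move=> j; exact: integral_ge0.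
under eq_integral do rewrite esum_int//.
rewrite ge0_integralD//; last 4 first.
- by move=> x _; exact: nneseries_ge0.
- by apply: ge0_emeasurable_sum.
- by move=> x _; exact: nneseries_ge0.
- by apply: ge0_emeasurable_sum.
by rewrite !integral_nneseries.
Qed.

(** The limit coincides with the upper limit where the upper and lower limits
    agree and are finite, and with the default point elsewhere. *)
Lemma measurable_limn (D : set T) (u : (T -> R)^nat) : measurable D ->
  (forall n, measurable_fun D (u n)) -> measurable_fun D (fun x => limn (u ^~ x)).
Proof.
move=> mD mu_; pose ue n x := (u n x)%:E.
have mue n : measurable_fun D (ue n) by exact/measurable_EFinP.
pose S x := limn_esup (ue ^~ x); pose I x := limn_einf (ue ^~ x).
have mS : measurable_fun D S by exact: measurable_fun_limn_esup.
have mI : measurable_fun D I.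
  have -> : I = (fun x => - limn_esup (fun n => - ue n x)).
    by apply/funext => x; rewrite -limn_einfN; congr limn_einf; apply/funext => n; exact/esym/oppeK.
  by apply: measurableT_comp => //; apply: measurable_fun_limn_esup => n; exact: measurableT_comp.
have -> : (fun x => limn (u ^~ x)) = (fun x =>
    if (S x == I x) && (S x \is a fin_num) then fine (S x) else point).
  apply/funext => x; case: ifPn => [/andP[/eqP SI Sf]|nSI].
    have c : ue ^~ x @ \oo --> (fine (S x))%:E.
      rewrite (fineK Sf).
      apply: (@squeeze_cvge _ _ _ _ (einfs (ue ^~ x)) _ (esups (ue ^~ x))).
      - apply: nearW => n; apply/andP; split.
          by apply: ereal_inf_lbound; exists n => /=.
        by apply: ereal_sup_ubound; exists n => /=.
      - by rewrite SI /I limn_einf_lim; exact: is_cvg_einfs.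
      - by rewrite /S limn_esup_lim; exact: is_cvg_esups.
    by apply/cvg_lim => //; exact: (fine_cvg c).
  apply: dvgP => cv.
  have ce : ue ^~ x @ \oo --> (limn (u ^~ x))%:E by apply: cvg_EFin => //; exact: nearW.
  have [e1 e2] := cvg_limn_einf_sup ce.
  by move/negP: nSI; apply; rewrite /S /I e1 e2 eqxx.
apply: measurable_fun_if => //.
  under eq_fun do rewrite fin_numE.
  apply: measurable_and; first exact: measurable_fun_eqe.
  by apply: measurable_and; apply: measurable_neg; apply: measurable_fun_eqe => //; exact: measurable_cst.
apply: measurableT_comp; first exact: fine_measurable.
by apply: measurable_funS mS => //; exact: subIsetl.
Qed.

End integral_integer_sums.

(** * Periodization *)

Section periodization.
Context (R : realType) (Delta : R) (Delta_gt0 : 0 < Delta).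
Notation mu := (@lebesgue_measure R).

(** Half-open, so that its translates by multiples of Delta tile the line. *)
Definition fundamental_cell : set R := `[0, Delta[%classic.
Notation cell := fundamental_cell.

Let measurable_cell : measurable cell. Proof. exact: measurable_itv. Qed.

Let measurable_translate (c : R) : measurable_fun [set: R] (fun x => x + c).
Proof. exact: measurable_funD. Qed.

Lemma in_cell (x : R) (j : int) :
  (x - j%:~R * Delta \in cell) = (j == Num.floor (x / Delta)).
Proof.
apply/idP/eqP => [|->].
  rewrite inE /cell /= in_itv/= => /andP[x0 x1]; apply/esym/floor_def.
  rewrite ler_pdivlMr// ltr_pdivrMr// intrD rmorph1 mulrDl mul1r; lra.
have /andP[f0 f1] := floor_itv (x / Delta).
rewrite inE /cell /= in_itv/=; move: f0 f1.
rewrite ler_pdivlMr// ltr_pdivrMr// intrD rmorph1 mulrDl mul1r => f0 f1.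
by apply/andP; split; lra.
Qed.

Local Open Scope ereal_scope.

(** Exactly one translate of the cell contains a given point, so that p is the sum
    over m of its restrictions to the translates. *)
Lemma integral_cells (p : R -> \bar R) : measurable_fun setT p -> (forall x, 0 <= p x) ->
  \int[mu]_x p x = \esum_(m in [set: int]) \int[mu]_(u in cell) p (u + m%:~R * Delta)%R.
Proof.
move=> mp p0.
pose g (m : int) (x : R) := ((fun u => p (u + m%:~R * Delta)%R) \_ cell) x.
have g0 m x : 0 <= g m x by rewrite /g patchE; case: ifP.
have mg m : measurable_fun setT (g m).
  apply: (proj1 (measurable_restrictT _ measurable_cell) (measurable_funTS _)).
  exact: measurableT_comp (measurable_translate _).
transitivity (\int[mu]_x \esum_(m in [set: int]) g m (x - m%:~R * Delta)%R).
  apply: eq_integral => x _; pose m := Num.floor (x / Delta).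
  rewrite (@esum_single _ _ m).
  - by rewrite /g patchE in_cell eqxx subrK.
  - exact: g0.
  - by move=> j jm; rewrite /g patchE in_cell (negbTE jm).
rewrite integral_esum_int//; last first.
  by move=> j; exact: measurableT_comp (measurable_translate _).
apply: eq_esum => j _.
rewrite (ge0_integral_shift (- (j%:~R * Delta)) (mg j))//.
by rewrite [RHS]integral_mkcond.
Qed.

(** Over the extended reals, so that it makes sense for every nonnegative p;
    periodized is its counterpart for signed functions. *)
Definition period_sum (p : R -> R) (u : R) : \bar R :=
  \esum_(j in [set: int]) (p (u + j%:~R * Delta)%R)%:E.

Lemma period_sum_ge0 (p : R -> R) u : (forall x, (0 <= p x)%R) -> 0 <= period_sum p u.
Proof. by move=> p0; apply: esum_ge0 => j _; rewrite lee_fin. Qed.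

Lemma measurable_period_sum (p : R -> R) : measurable_fun setT p -> (forall x, (0 <= p x)%R) ->
  measurable_fun setT (period_sum p).
Proof.
move=> mp p0; apply: measurable_esum_int => [j|j x]; last by rewrite lee_fin.
by apply/measurable_EFinP; exact: measurableT_comp (measurable_translate _).
Qed.

Lemma period_sum_shift (p : R -> R) u (m : int) : period_sum p (u + m%:~R * Delta)%R = period_sum p u.
Proof.
rewrite /period_sum -(esum_int_shift (fun j => (p (u + j%:~R * Delta)%R)%:E) m).
by apply: eq_esum => j _; rewrite intrD mulrDl addrAC addrA.
Qed.

(** Cut the integral into cells; the two summation indices then separate, the
    periodization of q being invariant under translation by multiples of Delta. *)
Lemma esum_correlation (p q : R -> R) : measurable_fun setT p -> measurable_fun setT q ->
  (forall x, (0 <= p x)%R) -> (forall x, (0 <= q x)%R) ->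
  \esum_(j in [set: int]) \int[mu]_x (p x * q (x + j%:~R * Delta))%:E =
  \int[mu]_(u in cell) (period_sum p u * period_sum q u).
Proof.
move=> mp mq p0 q0.
have mpt (c : R) : measurable_fun setT (fun x : R => p (x + c)%R).
  exact: measurableT_comp (measurable_translate _).
have mqt (c : R) : measurable_fun setT (fun x : R => q (x + c)%R).
  exact: measurableT_comp (measurable_translate _).
have mpq (a b : R) : measurable_fun cell (fun x : R => (p (x + a) * q (x + b))%:E).
  by apply: measurable_funTS; apply/measurable_EFinP; exact: measurable_funM.
have pq0 (a b : R) : (0 <= p a * q b)%R by rewrite mulr_ge0.
transitivity (\esum_(j in [set: int]) \esum_(m in [set: int])
   \int[mu]_(u in cell) (p (u + m%:~R * Delta) * q (u + m%:~R * Delta + j%:~R * Delta))%:E).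
  apply: eq_esum => j _; rewrite integral_cells//.
    by apply/measurable_EFinP; exact: measurable_funM.
  by move=> x; rewrite lee_fin.
rewrite esum_int_swap; last by move=> i j; apply: integral_ge0 => x _; rewrite lee_fin.
rewrite (_ : \int[mu]_(u in cell) _ = \int[mu]_(u in cell)
    \esum_(m in [set: int]) ((p (u + m%:~R * Delta)%R)%:E * period_sum q u)); last first.
  apply: eq_integral => u _; rewrite muleC.
  have q0' := period_sum_ge0 u q0.
  under eq_esum do rewrite muleC.
  case E : (period_sum q u) q0' => [r| |//] q0'.
    by rewrite esum_intZ// => j; rewrite lee_fin.
  (* Where the periodization of q is infinite, both sides are 0 or both infinite. *)
  have [p00|pn0] := eqVneq (period_sum p u) 0.
    rewrite p00 mule0 esum1// => j _.
    have : (p (u + j%:~R * Delta)%R)%:E <= 0.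
      rewrite -p00 -[leLHS](@esum_set1 R int j (fun j => (p (u + j%:~R * Delta)%R)%:E)) ?lee_fin//.
      rewrite [leLHS]esum_mkcond; apply: le_esum => i _.
      by case: ifPn => // _; rewrite lee_fin.
    by rewrite lee_fin => pj; rewrite (@le_anti _ _ (p (u + j%:~R * Delta)%R) 0%R) ?mule0// pj p0.
  rewrite gt0_mulye; last by rewrite lt_neqAle eq_sym pn0 period_sum_ge0.
  have [j pj] : exists j : int, p (u + j%:~R * Delta)%R != 0%R.
    apply: contrapT => /forallNP np; move/eqP : pn0; apply; apply: esum1 => j _.
    by have /negP := np j; rewrite negbK => /eqP ->.
  apply/esym/eqP; rewrite -leye_eq; apply: esum_ge; exists [set j]; first by split.
  by rewrite fsbig_set1 gt0_mulye// lte_fin lt_neqAle eq_sym pj p0.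
rewrite integral_esum_int//; first last.
- by move=> j x; rewrite mule_ge0 ?lee_fin// period_sum_ge0.
- move=> j; apply: emeasurable_funM; first by apply: measurable_funTS; apply/measurable_EFinP; exact: mpt.
  by apply: measurable_funTS; exact: measurable_period_sum.
apply: eq_esum => m _.
transitivity (\int[mu]_(u in cell) \esum_(j in [set: int]) (p (u + m%:~R * Delta) * q (u + m%:~R * Delta + j%:~R * Delta))%:E).
  rewrite integral_esum_int//; last by move=> j x; rewrite lee_fin.
  move=> j; apply: measurable_funTS; apply/measurable_EFinP; apply: measurable_funM => //.
    exact: mpt.
  have mt := measurable_translate (m%:~R * Delta)%R.
  by have := measurableT_comp (mqt (j%:~R * Delta)%R) mt.
apply: eq_integral => u _; rewrite -(period_sum_shift q u m) /period_sum.
by rewrite -esum_intZ// => j; rewrite lee_fin.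
Qed.

End periodization.

(** * The sum of the correlations of a kernel *)

Lemma ae_imply d (T : measurableType d) (R : realType) (mu : {measure set T -> \bar R})
    (P Q : T -> Prop) :
  (forall x, P x -> Q x) -> {ae mu, forall x, P x} -> {ae mu, forall x, Q x}.
Proof. by move=> PQ; apply: filterS. Qed.

Section correlation_sums.
Context (R : realType) (Delta : R) (Delta_gt0 : 0 < Delta).
Notation mu := (@lebesgue_measure R).
Notation cell := (fundamental_cell Delta).
Notation period_sum := (@period_sum R Delta).

(** The autocovariance at lag j Delta of the moving average with kernel h, for
    increments of variance 1 per unit of time. *)
Definition correlation (h : R -> R) (j : int) : R :=
  \int[mu]_x (h x * h (x + j%:~R * Delta)).

Let measurable_cell : measurable cell. Proof. exact: measurable_itv. Qed.

Let measurable_translate (c : R) : measurable_fun [set: R] (fun x => x + c).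
Proof. exact: measurable_funD. Qed.

Lemma sqint_translate (h : R -> R) (c : R) : sqint mu h -> sqint mu (fun x => h (x + c)).
Proof.
move=> [mh ih]; have mt := measurableT_comp mh (measurable_translate c); split=> //.
apply/integrableP; split; first by apply/measurable_EFinP; exact: measurable_funX.
case/integrableP : ih => _.
rewrite -(ge0_integral_shift c (f := fun x => `|(h x ^+ 2)%:E|%E))//.
by apply: measurableT_comp => //; apply/measurable_EFinP; exact: measurable_funX.
Qed.

Variable h : R -> R.
Hypotheses (sh : sqint mu h)
  (F2 : (\int[mu]_(u in cell) period_sum (fun x => `|h x|%R) u ^+ 2 < +oo)%E).

Let mh : measurable_fun setT h. Proof. exact: sh.1. Qed.

Let F := period_sum (fun x => `|h x|).

Let mF : measurable_fun setT F.
Proof. by apply: measurable_period_sum => //; exact: measurableT_comp. Qed.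

Let F0 u : (0 <= F u)%E. Proof. exact: period_sum_ge0. Qed.

(** The kernels to which Tonelli applies; |h| and the positive and negative parts
    of h are of this kind. *)
Let dominated (a : R -> R) := [/\ measurable_fun setT a, forall x, 0 <= a x & forall x, a x <= `|h x|].

Let dom_sqint a : dominated a -> sqint mu a.
Proof. by move=> [ma a0 ah]; apply: (@le_sqint _ _ _ mu _ h) => // x; rewrite (ger0_norm (a0 x)). Qed.

Let dom_le a u : dominated a -> (period_sum a u <= F u)%E.
Proof. by move=> [ma a0 ah]; apply: le_esum => j _; rewrite lee_fin. Qed.

Let corr (a b : R -> R) (j : int) := \int[mu]_x (a x * b (x + j%:~R * Delta)).

Let corr_ge0 a b j : dominated a -> dominated b -> 0 <= corr a b j.
Proof. by move=> [_ a0 _] [_ b0 _]; apply: Rintegral_ge0 => x _; rewrite mulr_ge0. Qed.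

Let esum_corr a b : dominated a -> dominated b ->
  (\esum_(j in [set: int]) (corr a b j)%:E = \int[mu]_(u in cell) (period_sum a u * period_sum b u))%E.
Proof.
move=> da db; have [ma a0 _] := da; have [mb b0 _] := db.
rewrite -esum_correlation//; apply: eq_esum => j _.
rewrite /corr /Rintegral fineK//; apply: integrable_fin_num => //.
by apply: sqint_mul; [exact: dom_sqint|exact: sqint_translate (dom_sqint db)].
Qed.

Let dom_int a b : dominated a -> dominated b ->
  (\int[mu]_(u in cell) (period_sum a u * period_sum b u) < +oo)%E.
Proof.
move=> da db; apply: le_lt_trans F2; have [ma a0 _] := da; have [mb b0 _] := db.
apply: ge0_le_integral => //.
- by move=> u _; rewrite mule_ge0// period_sum_ge0.
- by apply: measurable_funTS; apply: emeasurable_funM; exact: measurable_period_sum.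
- by apply: measurable_funTS; apply: emeasurable_funM.
- move=> u _; apply: lee_pmul; rewrite ?period_sum_ge0//; exact: dom_le.
Qed.

Let corr_sum a b : dominated a -> dominated b ->
  bilateral_summable (corr a b) /\
  ((bilateral_sum (corr a b))%:E = \int[mu]_(u in cell) (period_sum a u * period_sum b u))%E.
Proof.
move=> da db; rewrite -esum_corr//; apply: bilateral_sum_esum => [j|]; first exact: corr_ge0.
by rewrite esum_corr// dom_int.
Qed.

(** A function with finite integral of its square is finite almost everywhere. *)
Lemma ae_period_sum_fin :
  {ae mu, forall u, cell u -> (period_sum (fun x => `|h x|%R) u < +oo)%E}.
Proof.
suff : {ae mu, forall u, cell u -> (F u < +oo)%E} by [].
have iF : mu.-integrable cell (fun u => F u ^+ 2)%E.
  apply/integrableP; split; first by apply: measurable_funTS; exact: emeasurable_funM.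
  rewrite (_ : (\int[mu]_(u in cell) `|F u ^+ 2|)%E = (\int[mu]_(u in cell) F u ^+ 2)%E)//.
  by apply: eq_integral => u _; rewrite gee0_abs// mule_ge0.
have := @integrable_ae _ _ _ mu _ measurable_cell _ iF; apply: filterS => u fu cu.
have := fu cu; rewrite ltey; apply: contraTN => /eqP ->.
by rewrite expe2 mulyy.
Qed.

Let P a u := fine (period_sum a u).

Let PE a u : dominated a -> (F u < +oo)%E -> (P a u)%:E = period_sum a u.
Proof.
move=> da Fu; have [_ a0 _] := da; rewrite fineK// ge0_fin_numE ?period_sum_ge0//.
exact: le_lt_trans (dom_le _ da) Fu.
Qed.

Let mP a : dominated a -> measurable_fun setT (P a).
Proof.
by move=> [ma a0 _]; apply: measurableT_comp => //; exact: measurable_period_sum.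
Qed.

Let integral_P a b : dominated a -> dominated b ->
  mu.-integrable cell (EFin \o (fun u => P a u * P b u)) /\
  \int[mu]_(u in cell) (P a u * P b u) = bilateral_sum (corr a b).
Proof.
move=> da db; have [ma a0 _] := da; have [mb b0 _] := db.
have mPP : measurable_fun cell (EFin \o (fun u => P a u * P b u)).
  by apply: measurable_funTS; apply/measurable_EFinP; apply: measurable_funM; exact: mP.
have E : (\int[mu]_(u in cell) (P a u * P b u)%:E =
    \int[mu]_(u in cell) (period_sum a u * period_sum b u))%E.
  apply: ae_eq_integral => //.
    by apply: measurable_funTS; apply: emeasurable_funM; exact: measurable_period_sum.
  by apply: (ae_imply _ ae_period_sum_fin) => u Fu cu; rewrite EFinM !PE//; exact: Fu.
have PP0 u : 0 <= P a u * P b u by rewrite mulr_ge0// fine_ge0// period_sum_ge0.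
split.
  apply/integrableP; split => //.
  apply: le_lt_trans (dom_int da db); rewrite -E le_eqVlt; apply/orP; left; apply/eqP.
  by apply: eq_integral => u _; rewrite /= ger0_norm.
by rewrite /Rintegral E -(corr_sum da db).2.
Qed.

Let hp x := Num.max (h x) 0.
Let hn x := Num.max (- h x) 0.

Let dhp : dominated hp.
Proof.
split; first by apply: measurable_maxr.
- by move=> x; rewrite /hp le_max lexx orbT.
- by move=> x; rewrite /hp ge_max normr_ge0 ler_norm.
Qed.

Let dhn : dominated hn.
Proof.
split; first by apply: measurable_maxr => //; exact: measurableT_comp.
- by move=> x; rewrite /hn le_max lexx orbT.
- by move=> x; rewrite /hn ge_max normr_ge0 -normrN ler_norm.
Qed.

Let hE x : h x = hp x - hn x.
Proof. by rewrite /hp /hn; have [|] := leP (h x) 0; have [|] := leP (- h x) 0; lra. Qed.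

(** Dominate by the correlations of |h|, whose sum is the integral of the square of
    its periodization. *)
Lemma correlation_esum_lty :
  (\esum_(j in [set: int]) `|correlation h j|%:E < +oo)%E.
Proof.
have da : dominated (fun x => `|h x|) by split => //; exact: measurableT_comp.
apply: (@le_lt_trans _ _ (\esum_(j in [set: int]) (corr (fun x => `|h x|) (fun x => `|h x|) j)%:E)%E); last first.
  by rewrite esum_corr// dom_int.
apply: le_esum => j _; rewrite lee_fin /correlation.
have ihh : mu.-integrable setT (EFin \o (fun x => h x * h (x + j%:~R * Delta))).
  by apply: sqint_mul => //; exact: sqint_translate.
rewrite (le_trans (le_normr_Rintegral measurableT ihh))// /corr.
by rewrite le_eqVlt; apply/orP; left; apply/eqP; apply: eq_Rintegral => x _; rewrite normrM.
Qed.

Let correlationE : correlation h =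
  (fun j => (corr hp hp j - corr hp hn j) - (corr hn hp j - corr hn hn j)).
Proof.
apply/funext => j; rewrite /correlation /corr.
have i a b : dominated a -> dominated b ->
    mu.-integrable setT (EFin \o (fun x => a x * b (x + j%:~R * Delta))).
  by move=> da db; apply: sqint_mul; [exact: dom_sqint|exact: sqint_translate (dom_sqint db)].
rewrite -RintegralB; [|exact: measurableT|exact: i|exact: i].
rewrite -RintegralB; [|exact: measurableT|exact: i|exact: i].
rewrite -RintegralB; [|exact: measurableT|by apply: RintegrableB => //; exact: i|by apply: RintegrableB => //; exact: i].
by apply: eq_Rintegral => x _; rewrite !hE; ring.
Qed.

Let periodizedE u : (F u < +oo)%E -> periodized h Delta u = P hp u - P hn u.
Proof.
move=> Fu; have Ef a : dominated a ->
    bilateral_summable (fun j => a (u + j%:~R * Delta)) /\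
    bilateral_sum (fun j => a (u + j%:~R * Delta)) = P a u.
  move=> da; have [_ a0 _] := da.
  have [||H1 H2] := @bilateral_sum_esum R (fun j => a (u + j%:~R * Delta)).
  - by move=> j; exact: a0.
  - exact: le_lt_trans (dom_le u da) Fu.
  - by split => //; rewrite /P -[RHS]/(fine (\esum_(j in [set: int]) (a (u + j%:~R * Delta))%:E)%E) -H2.
have [sp Ep] := Ef _ dhp; have [sn En] := Ef _ dhn.
rewrite -Ep -En -(bilateral_sumB sp sn).2 /periodized; congr bilateral_sum.
by apply/funext => j; exact: hE.
Qed.

Lemma measurable_periodized : measurable_fun setT (periodized h Delta).
Proof.
have mhj (j : int) : measurable_fun setT (fun u : R => h (u + j%:~R * Delta)).
  exact: (measurableT_comp mh (measurable_translate _)).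
by apply: measurable_funD; apply: measurable_limn => // n; apply: measurable_sum => i.
Qed.

(** Split h into positive and negative parts. Each of the four correlation
    sequences is summed by esum_correlation, and all sums are finite since both
    parts are dominated by |h|. *)
Theorem correlation_sum :
  [/\ bilateral_summable (correlation h),
      mu.-integrable cell (EFin \o (fun u => periodized h Delta u ^+ 2)) &
      bilateral_sum (correlation h) = \int[mu]_(u in cell) (periodized h Delta u ^+ 2)].
Proof.
have [spp _] := corr_sum dhp dhp; have [spn _] := corr_sum dhp dhn.
have [snp _] := corr_sum dhn dhp; have [snn _] := corr_sum dhn dhn.
have [s1 e1] := bilateral_sumB spp spn; have [s2 e2] := bilateral_sumB snp snn.
have [s3 e3] := bilateral_sumB s1 s2.
have [ipp Ipp] := integral_P dhp dhp; have [ipn Ipn] := integral_P dhp dhn.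
have [inp Inp] := integral_P dhn dhp; have [inn Inn] := integral_P dhn dhn.
have i1 := @RintegrableB _ _ _ mu _ _ _ measurable_cell ipp ipn.
have i2 := @RintegrableB _ _ _ mu _ _ _ measurable_cell inp inn.
have i3 := @RintegrableB _ _ _ mu _ _ _ measurable_cell i1 i2.
have mper : measurable_fun cell (EFin \o (fun u => periodized h Delta u ^+ 2)).
  by apply: measurable_funTS; apply/measurable_EFinP; apply: measurable_funX; exact: measurable_periodized.
have aeE : ae_eq mu cell (EFin \o (fun u => periodized h Delta u ^+ 2))
  (EFin \o (fun u => (P hp u * P hp u - P hp u * P hn u) - (P hn u * P hp u - P hn u * P hn u))).
  apply: (ae_imply _ ae_period_sum_fin) => u Fu cu /=; congr EFin.
  by rewrite (periodizedE (Fu cu)); ring.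
have mi3 := measurable_int _ i3.
split.
- by rewrite correlationE.
- apply/integrableP; split => //.
  case/integrableP : i3 => _; apply: le_lt_trans.
  rewrite le_eqVlt; apply/orP; left; apply/eqP; apply: ae_eq_integral => //.
  + exact: measurableT_comp.
  + exact: measurableT_comp.
  + by apply: (ae_imply _ aeE) => u E cu; have /= [->] := E cu.
- rewrite correlationE e3 e1 e2 -Ipp -Ipn -Inp -Inn.
  rewrite -RintegralB// -RintegralB// -RintegralB//.
  by rewrite /Rintegral; congr fine; apply/esym/ae_eq_integral.
Qed.

End correlation_sums.

(** * Approximation on the fundamental cell by grid steps *)

Lemma ninths_le (R : realFieldType) (e x y z : R) :
  x <= e / 9 -> y <= e / 9 -> z <= e / 9 -> 3 * (x + y + z) <= e.
Proof. lra. Qed.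

Section grid_approximation.
Context (R : realType) (Delta : R) (Delta_gt0 : 0 < Delta).
Notation mu := (@lebesgue_measure R).
Notation cell := (fundamental_cell Delta).

Definition grid_cell (r m : nat) : set R :=
  `[m%:R * Delta / r%:R, m.+1%:R * Delta / r%:R[%classic.

(** The cells all have width Delta / r, so that the increments of a Levy process
    over them are identically distributed. *)
Definition grid_step (r : nat) (c : nat -> R) (u : R) : R :=
  \sum_(m < r) c m * \1_(grid_cell r m) u.

Lemma measurable_grid_step r c : measurable_fun setT (grid_step r c).
Proof.
apply: measurable_sum => m; apply: measurable_funM => //.
by apply: measurable_indic; exact: measurable_itv.
Qed.

Lemma in_grid_cell r m u : (0 < r)%N -> 0 <= u ->
  (u \in grid_cell r m) = (m == Num.trunc (u * r%:R / Delta)).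
Proof.
move=> r0 u0; have r0' : 0 < r%:R :> R by rewrite ltr0n.
have t0 : 0 <= u * r%:R / Delta by rewrite divr_ge0 ?mulr_ge0// ltW.
apply/idP/eqP => [|->].
  rewrite inE /grid_cell /= in_itv/= => /andP[u1 u2]; apply/esym/truncn_def.
  by rewrite ler_pdivlMr// ltr_pdivrMr// -ler_pdivrMr// u1/= -ltr_pdivlMr.
have /andP[u1 u2] := truncn_itv t0.
rewrite inE /grid_cell /= in_itv/=.
by rewrite ler_pdivrMr// -ler_pdivlMr// u1/= ltr_pdivlMr// -ltr_pdivrMr.
Qed.

Lemma grid_stepE r c u : (0 < r)%N -> u \in cell ->
  (Num.trunc (u * r%:R / Delta) < r)%N /\ grid_step r c u = c (Num.trunc (u * r%:R / Delta)).
Proof.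
move=> r0; rewrite inE /fundamental_cell /= in_itv/= => /andP[u0 uD].
have r0' : 0 < r%:R :> R by rewrite ltr0n.
have t0 : 0 <= u * r%:R / Delta by rewrite divr_ge0 ?mulr_ge0// ltW.
have kr : (Num.trunc (u * r%:R / Delta) < r)%N.
  have /andP[u1 _] := truncn_itv t0.
  by rewrite -(ltr_nat R) (le_lt_trans u1)// ltr_pdivrMr// mulrC ltr_pM2l.
split=> //; rewrite /grid_step (bigD1 (Ordinal kr))//= big1 ?addr0.
  by rewrite indicE in_grid_cell// eqxx mulr1.
move=> m mk; rewrite indicE in_grid_cell//.
have /negbTE -> : (m : nat) != Num.trunc (u * r%:R / Delta) by apply: contra mk => /eqP e; apply/eqP/val_inj.
by rewrite mulr0.
Qed.

Lemma grid_cell_sub r (m : 'I_r) : grid_cell r m `<=` cell.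
Proof.
move=> u; rewrite /grid_cell /fundamental_cell /= !in_itv/= => /andP[u1 u2].
have r0 : (0 < r)%N by apply: leq_ltn_trans (ltn_ord m).
have r0' : 0 < r%:R :> R by rewrite ltr0n.
rewrite (le_trans _ u1) ?divr_ge0 ?mulr_ge0// ?ltW//=.
by rewrite (lt_le_trans u2)// ler_pdivrMr// mulrC ler_pM2l// ler_nat.
Qed.

Lemma grid_step_out r c u : u \notin cell -> grid_step r c u = 0.
Proof.
move=> uc; rewrite /grid_step big1// => m _; rewrite indicE.
have /negbTE -> : u \notin grid_cell r m; last by rewrite mulr0.
by apply: contra uc; rewrite !inE; exact: grid_cell_sub.
Qed.

Lemma grid_step_bound r c (K : R) u : 0 <= K -> (forall m, `|c m| <= K) -> `|grid_step r c u| <= K.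
Proof.
move=> K0 cK; have [r0|r0] := posnP r.
  by rewrite r0 /grid_step big_ord0 normr0.
have [uc|uc] := boolP (u \in cell); last by rewrite grid_step_out// normr0.
by have [_ ->] := grid_stepE c r0 uc.
Qed.

Lemma grid_step_le_sum r c u : `|grid_step r c u| <= \sum_(m < r) `|c m|.
Proof.
rewrite (le_trans (ler_norm_sum _ _ _))// ler_sum// => m _.
by rewrite normrM ler_piMr// indicE; case: (_ \in _); rewrite ?normr1 ?normr0.
Qed.

Lemma grid_step_sqr r c u : (0 < r)%N ->
  grid_step r c u ^+ 2 = grid_step r (fun m => c m ^+ 2) u.
Proof.
move=> r0; have [uc|uc] := boolP (u \in cell).
  by have [_ ->] := grid_stepE c r0 uc; have [_ ->] := grid_stepE (fun m => c m ^+ 2) r0 uc.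
by rewrite !grid_step_out// expr0n.
Qed.

Let measurable_cell : measurable cell. Proof. exact: measurable_itv. Qed.

Lemma fundamental_cell_fin : (mu cell < +oo)%E.
Proof. by rewrite lebesgue_measure_itv/= lte_fin Delta_gt0 sube0 ltry. Qed.

Lemma bounded_integrable_cell (f : R -> R) (M : R) : measurable_fun setT f ->
  (forall x, `|f x| <= M) -> mu.-integrable cell (EFin \o f).
Proof.
move=> mf fM; apply: measurable_bounded_integrable => //.
- exact: fundamental_cell_fin.
- exact: measurable_funTS.
- exists M; split; first exact: num_real.
  by move=> x Mx y _ /=; apply: (le_trans (fM y)); exact: ltW.
Qed.

(** The grid point to the left of u tends to u as the mesh tends to 0; boundedness
    of g allows dominated convergence. *)
Let grid_continuous (g : R -> R) (K e : R) : continuous g -> (forall x, `|g x| <= K) -> 0 < e ->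
  exists r c, [/\ (0 < r)%N, forall m, `|c m| <= K & \int[mu]_(u in cell) (g u - grid_step r c u) ^+ 2 <= e].
Proof.
move=> cg gK e0; have K0 : 0 <= K by rewrite (le_trans _ (gK 0)).
have mg : measurable_fun setT g by exact: continuous_measurable_fun.
pose c (r m : nat) := g (m%:R * Delta / r%:R).
pose G r u := (g u - grid_step r.+1 (c r.+1) u) ^+ 2.
have mG r : measurable_fun cell (G r).
  apply: measurable_funTS; apply: measurable_funX; apply: measurable_funB => //.
  exact: measurable_grid_step.
have cG u : cell u -> G r u @[r --> \oo] --> (0 : R).
  move=> cu; have uc : u \in cell by rewrite inE.
  pose x (r : nat) := (Num.trunc (u * r.+1%:R / Delta))%:R * Delta / r.+1%:R.
  have Gx r : G r u = (g u - g (x r)) ^+ 2.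
    by rewrite /G; have [_ ->] := grid_stepE (c r.+1) (ltn0Sn r) uc.
  have u0 : 0 <= u by move: cu; rewrite /fundamental_cell /= in_itv/= => /andP[].
  have xu : x @ \oo --> u.
    apply/cvgrPdist_le => eps eps0; near=> n.
    have n0 : 0 < n.+1%:R :> R by rewrite ltr0n.
    have t0 : 0 <= u * n.+1%:R / Delta by rewrite divr_ge0 ?mulr_ge0// ltW.
    have /andP[u1 u2] := truncn_itv t0.
    rewrite ler_pdivlMr// -ler_pdivrMr// -/(x n) in u1.
    rewrite ltr_pdivrMr// -ltr_pdivlMr// -natr1 mulrDl mul1r mulrDl -/(x n) in u2.
    rewrite ger0_norm ?subr_ge0// lerBlDl (le_trans (ltW u2))// lerD2l.
    rewrite ler_pdivrMr// mulrC -ler_pdivrMr//.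
    apply: (@le_trans _ _ n%:R); last by rewrite ler_nat.
    by near: n; exact: nbhs_infty_ger.
  have gx : g (x r) @[r --> \oo] --> g u by apply: (cvg_comp _ _ xu); exact: cg.
  rewrite (_ : (fun r => G r u) = (fun r => (g u - g (x r)) * (g u - g (x r)))); last first.
    by apply/funext => r; rewrite Gx expr2.
  have d0 : g u - g (x r) @[r --> \oo] --> (0 : R).
    by rewrite -(subrr (g u)); apply: cvgB => //; exact: cvg_cst.
  by rewrite -(mulr0 (0 : R)); exact: (cvgM d0 d0).
have dG r u : cell u -> `|G r u| <= (2 * K) ^+ 2.
  move=> _; rewrite /G normrX lerXn2r ?nnegrE ?mulr_ge0//.
  rewrite (le_trans (ler_normB _ _))// mulr_natl mulr2n lerD// grid_step_bound// => m.
  exact: gK.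
have iK : mu.-integrable cell (EFin \o (fun=> (2 * K) ^+ 2)).
  exact: (@bounded_integrable_cell _ `|(2 * K) ^+ 2|).
have [_] := @Rdominated_cvg _ _ _ mu cell _ _ _ measurable_cell mG cG iK dG.
rewrite Rintegral_cst// mul0r => /cvgrPdist_le /(_ _ e0) [N _ HN].
exists N.+1, (c N.+1); split => // [m|]; first exact: gK.
have := HN N (leqnn N); rewrite sub0r normrN => H.
by apply: le_trans H; exact: ler_norm.
Unshelve. all: by end_near. Qed.

(** The projection of the line onto [-K, K]. *)
Let clamp (K x : R) : R := (`|x + K| - `|x - K|) / 2.

Let clamp_continuous K : continuous (clamp K).
Proof.
move=> x; apply: cvgM; last exact: cvg_cst.
apply: cvgB; apply: cvg_norm; [apply: cvgD|apply: cvgB];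
  by [exact: cvg_id|exact: cvg_cst].
Qed.

Let clamp_bound K x : 0 <= K -> `|clamp K x| <= K.
Proof.
move=> K0; rewrite /clamp ler_norml.
have := ler_normB (x + K) (x - K); have := ler_normB (x - K) (x + K).
have -> : x + K - (x - K) = 2 * K by ring.
have -> : x - K - (x + K) = - (2 * K) by ring.
rewrite normrN; case: (ger0P (x + K)) => H1; case: (ger0P (x - K)) => H2 H3 H4;
  by apply/andP; split; lra.
Qed.

Let clamp_contract K a b : 0 <= K -> `|a| <= K -> `|a - clamp K b| <= `|a - b|.
Proof.
move=> K0; rewrite /clamp ler_norml => /andP[a1 a2].
rewrite ler_norml.
by case: (ger0P (b + K)) => H1; case: (ger0P (b - K)) => H2; case: (ger0P (a - b)) => H3;
  apply/andP; split; lra.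
Qed.

Let sqr_sum3_le (a b c d : R) :
  (a - d) ^+ 2 <= 3 * ((a - b) ^+ 2 + (b - c) ^+ 2 + (c - d) ^+ 2).
Proof.
have := sqr_ge0 ((a - b) - (b - c)); have := sqr_ge0 ((b - c) - (c - d)).
have := sqr_ge0 ((a - b) - (c - d)); nra.
Qed.

(** Three approximations: truncate psi at level K, approximate in L^1 by a
    continuous function, then use grid steps. Clamping the continuous function to
    [-K, K] turns L^1-closeness into L^2-closeness, the difference being bounded
    by 2 K. *)
Theorem grid_dense (psi : R -> R) (e : R) : measurable_fun setT psi ->
  mu.-integrable cell (EFin \o (fun u => psi u ^+ 2)) -> 0 < e ->
  exists r c, (0 < r)%N /\ \int[mu]_(u in cell) (psi u - grid_step r c u) ^+ 2 <= e.
Proof.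
move=> mpsi ipsi e0; have e90 : 0 < e / 9 by rewrite divr_gt0.
pose tr (n : nat) u := if `|psi u| <= n%:R then psi u else 0.
have mtr n : measurable_fun setT (tr n).
  apply: measurable_fun_ifT => //; apply: measurable_fun_ler => //.
  exact: measurableT_comp.
have trn n u : `|tr n u| <= n%:R by rewrite /tr; case: ifP => // _; rewrite normr0.
have [K HK] : exists K : nat, \int[mu]_(u in cell) (psi u - tr K u) ^+ 2 <= e / 9.
  have mtrn n : measurable_fun cell (fun u => (psi u - tr n u) ^+ 2).
    by apply: measurable_funTS; apply: measurable_funX; exact: measurable_funB.
  have ctrn u : cell u -> (psi u - tr n u) ^+ 2 @[n --> \oo] --> (0 : R).
    move=> _; apply: cvg_near_cst; near=> n.
    rewrite /tr ifT ?subrr ?expr0n//.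
    by near: n; exact: nbhs_infty_ger.
  have dtrn n u : cell u -> `|(psi u - tr n u) ^+ 2| <= psi u ^+ 2.
    move=> _; rewrite ger0_norm ?sqr_ge0// /tr; case: ifP => // _.
      by rewrite subrr expr0n/= sqr_ge0.
    by rewrite subr0.
  have [_] := @Rdominated_cvg _ _ _ mu cell _ _ _ measurable_cell mtrn ctrn ipsi dtrn.
  rewrite Rintegral_cst// mul0r => /cvgrPdist_le /(_ _ e90) [N _ HN].
  exists N; have := HN N (leqnn N); rewrite sub0r normrN => H.
  by apply: le_trans H; exact: ler_norm.
have itr : mu.-integrable cell (EFin \o tr K) by exact: bounded_integrable_cell (trn K).
have [g_ [cg ig gcvg]] := approximation_continuous_integrable measurable_cell fundamental_cell_fin itr.
pose b : R := e / 9 / (2 * K%:R + 1).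
have b0 : 0 < b by rewrite divr_gt0// ltr_pwDr// mulr_ge0.
have [n Hn] : exists n, (\int[mu]_(z in cell) `|(tr K z - g_ n z)%:E| <= b%:E)%E.
  move/fine_cvgP : gcvg => [fn /cvgrPdist_le /(_ _ b0)] H.
  have [N _ HN] := filterI fn H; exists N; have [/= H1 H2] := HN N (leqnn N).
  rewrite -(fineK H1) lee_fin; move: H2; rewrite sub0r normrN.
  by apply: le_trans; exact: ler_norm.
pose g u := clamp K%:R (g_ n u).
have cg' : continuous g by move=> u; apply: (@continuous_comp _ _ _ (g_ n) (clamp K%:R)); [exact: (cg n u)|exact: clamp_continuous].
have gK u : `|g u| <= K%:R by exact: clamp_bound.
have mg : measurable_fun setT g by exact: continuous_measurable_fun.
have mgn : measurable_fun setT (g_ n) by exact: continuous_measurable_fun.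
have [r [c [r0 cK Hc]]] := grid_continuous cg' gK e90.
have igs : mu.-integrable cell (EFin \o (fun u => `|tr K u - g_ n u|)).
  by apply: integrable_norm; exact: (@RintegrableB _ _ _ mu _ _ _ measurable_cell itr (ig n)).
have Hg : \int[mu]_(u in cell) (tr K u - g u) ^+ 2 <= e / 9.
  apply: (@le_trans _ _ (\int[mu]_(u in cell) ((2 * K%:R) * `|tr K u - g_ n u|))).
    apply: le_Rintegral => //.
    - apply: (@bounded_integrable_cell _ ((2 * K%:R) ^+ 2)) => [|u].
        by apply: measurable_funX; exact: measurable_funB.
      rewrite normrX lerXn2r ?nnegrE ?mulr_ge0//.
      by rewrite (le_trans (ler_normB _ _))// mulr_natl mulr2n lerD.
    - exact: (@RintegrableZl _ _ _ mu).
    - move=> u _; rewrite -real_normK ?num_real// expr2 ler_pM// ?clamp_contract//.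
      by rewrite (le_trans (ler_normB _ _))// mulr_natl mulr2n lerD.
  rewrite RintegralZl//.
  have : \int[mu]_(u in cell) `|tr K u - g_ n u| <= b.
    rewrite -lee_fin /Rintegral fineK; first exact: Hn.
    exact: (@integrable_fin_num _ _ _ mu _ measurable_cell _ igs).
  have K0 : 0 <= 2 * K%:R :> R by rewrite mulr_ge0.
  move=> /(ler_wpM2l K0) /le_trans; apply.
  rewrite /b mulrCA; apply: ler_piMr; first exact: ltW.
  by rewrite ler_pdivrMr ?mul1r ?lerDl// ltr_pwDr.
exists r, c; split => //.
have igr : mu.-integrable cell (EFin \o (fun u => (g u - grid_step r c u) ^+ 2)).
  apply: (@bounded_integrable_cell _ ((2 * K%:R) ^+ 2)) => [|u].
    by apply: measurable_funX; apply: measurable_funB => //; exact: measurable_grid_step.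
  rewrite normrX lerXn2r ?nnegrE ?mulr_ge0//.
  by rewrite (le_trans (ler_normB _ _))// mulr_natl mulr2n lerD// grid_step_bound.
have itg : mu.-integrable cell (EFin \o (fun u => (tr K u - g u) ^+ 2)).
  apply: (@bounded_integrable_cell _ ((2 * K%:R) ^+ 2)) => [|u].
    by apply: measurable_funX; exact: measurable_funB.
  rewrite normrX lerXn2r ?nnegrE ?mulr_ge0//.
  by rewrite (le_trans (ler_normB _ _))// mulr_natl mulr2n lerD.
have ipt : mu.-integrable cell (EFin \o (fun u => (psi u - tr K u) ^+ 2)).
  apply: (@le_Rintegrable _ _ _ mu _ _ _ measurable_cell _ ipsi) => [|u _].
    by apply: measurable_funTS; apply: (measurable_funX 2 (measurable_funB mpsi (mtr K))).
  rewrite ger0_norm ?sqr_ge0// /tr; case: ifP => // _.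
    by rewrite subrr expr0n/= sqr_ge0.
  by rewrite subr0.
have i12 := @RintegrableD _ _ _ mu _ _ _ measurable_cell ipt itg.
have i123 := @RintegrableD _ _ _ mu _ _ _ measurable_cell i12 igr.
have i3 := @RintegrableZl _ _ _ mu _ 3 _ measurable_cell i123.
apply: (@le_trans _ _ (\int[mu]_(u in cell) (3 * ((psi u - tr K u) ^+ 2 + (tr K u - g u) ^+ 2
    + (g u - grid_step r c u) ^+ 2)))).
  apply: le_Rintegral => //.
    apply: (@le_Rintegrable _ _ _ mu _ _ _ measurable_cell _ i3) => [|u _].
      apply: measurable_funTS; apply: measurable_funX; apply: measurable_funB => //.
      exact: measurable_grid_step.
    rewrite ger0_norm ?sqr_ge0//.
rewrite (@RintegralZl _ _ _ mu)// (@RintegralD _ _ _ mu)// (@RintegralD _ _ _ mu)//.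
exact: ninths_le.
Unshelve. all: by end_near. Qed.

Lemma Rintegral_grid_step r c : (0 < r)%N ->
  \int[mu]_(u in cell) grid_step r c u = \sum_(m < r) c m * (Delta / r%:R).
Proof.
move=> r0; have r0' : 0 < r%:R :> R by rewrite ltr0n.
have mg (m : nat) : measurable (grid_cell r m) by exact: measurable_itv.
have ii (m : nat) : mu.-integrable cell (EFin \o (\1_(grid_cell r m) : R -> R)).
  apply: (@bounded_integrable_cell _ 1) => [|u]; first exact: measurable_indic.
  by rewrite indicE; case: (_ \in _); rewrite ?normr1 ?normr0.
rewrite /grid_step (@Rintegral_sum _ _ _ mu _ _ _ _ measurable_cell
  (fun i : 'I_r => @RintegrableZl _ _ _ mu _ (c i) _ measurable_cell (ii i))).2.
apply: eq_bigr => m _; rewrite (@RintegralZl _ _ _ mu)//; congr (_ * _).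
rewrite /Rintegral integral_indic//; last exact: mg.
rewrite (_ : grid_cell r m `&` cell = grid_cell r m).
  have := @lebesgue_measure_itv R `[m%:R * Delta / r%:R, m.+1%:R * Delta / r%:R[.
  rewrite /= => ->; rewrite lte_fin ltr_pM2r ?invr_gt0// ltr_pM2r// ltr_nat ltnSn.
  by rewrite -EFinB/= -mulrBl -mulrBl -natrB// subSnn mul1r.
by apply/setIidPl; exact: grid_cell_sub.
Qed.

End grid_approximation.

(** * Correlations after subtraction of a grid step *)

Lemma esum_abs_bilateral_summable (R : realType) (a : int -> R) :
  (\esum_(j in [set: int]) `|a j|%:E < +oo)%E -> bilateral_summable a.
Proof.
move=> /bilateral_sum_esum [] // [sp sn] _.
by split; exact: normed_cvg.
Qed.

Lemma bilateral_sum_single (R : realType) (a : int -> R) :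
  (forall j, j != 0 -> a j = 0) -> bilateral_summable a /\ bilateral_sum a = a 0.
Proof.
move=> a0.
have cp : series (fun n => a (Posz n)) @ \oo --> a 0.
  rewrite -(cvg_shiftn 1)/= (_ : (fun n => _) = cst (a 0)); first exact: cvg_cst.
  apply/funext => n; rewrite /= /series/= addn1 big_nat_recl// big1 ?addr0// => i _.
  exact: a0.
have cn : series (fun n => a (Negz n)) @ \oo --> (0 : R).
  rewrite (_ : series _ = cst 0); first exact: cvg_cst.
  apply/funext => n; rewrite /series/= big1// => i _; exact: a0.
split; first by split; apply/cvg_ex; eexists; [exact: cp|exact: cn].
by rewrite /bilateral_sum (cvg_lim _ cp)// (cvg_lim _ cn)// addr0.
Qed.

Section residual_kernel.
Context (R : realType) (Delta : R) (Delta_gt0 : 0 < Delta).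
Notation mu := (@lebesgue_measure R).
Notation cell := (fundamental_cell Delta).
Notation period_sum := (@period_sum R Delta).
Variables (f q : R -> R) (M : R).
Hypotheses (sf : sqint mu f)
  (F2 : (\int[mu]_(u in cell) period_sum (fun x => `|f x|%R) u ^+ 2 < +oo)%E)
  (mq : measurable_fun setT q) (qM : forall x, `|q x| <= M)
  (q_cell : forall x, x \notin cell -> q x = 0).

Let measurable_cell : measurable cell. Proof. exact: measurable_itv. Qed.

Let translate_cell u (j : int) : cell u -> j != 0 -> q (u + j%:~R * Delta) = 0.
Proof.
move=> cu j0; apply: q_cell; apply/negP.
have := in_cell Delta_gt0 u (- j); rewrite rmorphN/= mulNr opprK => ->.
have := in_cell Delta_gt0 u 0; rewrite mul0r subr0 mem_set// => /esym/eqP <-.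
by rewrite eqr_oppLR oppr0; exact/negP.
Qed.

Lemma sqint_cell_bounded : sqint mu q.
Proof.
apply: (@le_sqint _ _ _ mu _ (fun x => M * \1_cell x)) => //; last first.
  move=> x; rewrite indicE; case: (boolP (x \in cell)) => xc.
    by rewrite mulr1 (le_trans (qM x))// ler_norm.
  by rewrite q_cell// normr0.
apply: sqintZ; split; first exact: measurable_indic.
have := @integrable_indic_itv R 0 Delta true true.
apply: eq_integrable => // x _ /=.
by rewrite indicE; case: (_ \in _); rewrite ?expr1n ?expr0n.
Qed.

Lemma sqint_residual : sqint mu (fun x => f x - q x).
Proof. by apply: sqintB => //; exact: sqint_cell_bounded. Qed.

(** On the cell q has a single nonzero translate, so that the periodization of
    |f - q| exceeds that of |f| by at most M. *)
Lemma period_sum_residual :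
  (\int[mu]_(u in cell) period_sum (fun x => `|f x - q x|%R) u ^+ 2 < +oo)%E.
Proof.
have mF : measurable_fun setT (period_sum (fun x => `|f x|)).
  by apply: measurable_period_sum => //; apply: measurableT_comp => //; exact: sf.1.
have F0 u : (0 <= period_sum (fun x => `|f x|%R) u)%E by apply: period_sum_ge0.
have M0 : 0 <= M by apply: le_trans (qM 0).
apply: (@le_lt_trans _ _ (\int[mu]_(u in cell) (2%:E * (period_sum (fun x => `|f x|%R) u ^+ 2)
    + (2 * M ^+ 2)%:E))%E).
  apply: ge0_le_integral => //.
  - by move=> u _; rewrite mule_ge0// period_sum_ge0.
  - apply: measurable_funTS; apply: emeasurable_funM; apply: measurable_period_sum => //;
      by apply: measurableT_comp => //; apply: measurable_funB => //; exact: sf.1.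
  - apply: measurable_funTS; apply: emeasurable_funD => //; apply: emeasurable_funM => //.
    exact: emeasurable_funM.
  move=> u cu.
  have le1 : (period_sum (fun x => `|f x - q x|%R) u <= period_sum (fun x => `|f x|%R) u + M%:E)%E.
    apply: (@le_trans _ _ (\esum_(j in [set: int]) ((`|f (u + j%:~R * Delta)|%R)%:E + (`|q (u + j%:~R * Delta)|%R)%:E))%E).
      by apply: le_esum => j _; rewrite -EFinD lee_fin ler_normB.
    rewrite esumD//; try by move=> j _; rewrite lee_fin.
    apply: leeD => //; rewrite (@esum_single _ _ 0) ?lee_fin//.
    by move=> j j0; rewrite translate_cell// normr0.
  apply: (@le_trans _ _ ((period_sum (fun x => `|f x|%R) u + M%:E) ^+ 2)%E).
    by rewrite !expe2; apply: lee_pmul => //; rewrite period_sum_ge0.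
  move: (F0 u); case: (period_sum _ u) => [x| |] // x0.
    suff : (((x + M) ^+ 2)%:E <= (2 * x ^+ 2 + 2 * M ^+ 2)%:E)%E by [].
    by rewrite lee_fin; have := sqr_ge0 (x - M); rewrite sqrrB sqrrD; lra.
  by rewrite expe2 mulyy gt0_muley ?lte_fin// addye// leey.
rewrite ge0_integralD//; last 3 first.
- by move=> u _; rewrite mule_ge0// mule_ge0.
- by apply: measurable_funTS; apply: emeasurable_funM => //; exact: emeasurable_funM.
- by move=> u _; rewrite lee_fin mulr_ge0// sqr_ge0.
rewrite ge0_integralZl//; last 2 first.
- by apply: measurable_funTS; exact: emeasurable_funM.
- by move=> u _; rewrite mule_ge0.
apply: lte_add_pinfty; first by apply: lte_mul_pinfty.
rewrite integral_cst//; apply: lte_mul_pinfty => //.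
  by rewrite lee_fin mulr_ge0// sqr_ge0.
by have := @lebesgue_measure_itv R `[0, Delta[; rewrite /= => ->; case: ifP => // _; rewrite -EFinB ltry.
Qed.

Lemma periodized_residual :
  {ae mu, forall u, cell u ->
    periodized (fun x => f x - q x) Delta u = periodized f Delta u - q u}.
Proof.
apply: (ae_imply _ (ae_period_sum_fin sf F2)) => u Fu cu.
have sfu : bilateral_summable (fun j => f (u + j%:~R * Delta)).
  by apply: esum_abs_bilateral_summable; exact: Fu.
have [squ Equ] := @bilateral_sum_single R (fun j => q (u + j%:~R * Delta))
  (fun j => translate_cell cu).
rewrite /periodized (bilateral_sumB sfu squ).2; congr (_ - _).
by rewrite Equ mul0r addr0.
Qed.

(** What makes the replacement of f by q possible: only the distance between the
    periodizations matters, and q is its own periodization on the cell. *)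
Theorem residual_correlation_sum :
  bilateral_summable (correlation Delta (fun x => f x - q x)) /\
  bilateral_sum (correlation Delta (fun x => f x - q x)) =
  \int[mu]_(u in cell) (periodized f Delta u - q u) ^+ 2.
Proof.
have [s i ->] := correlation_sum Delta_gt0 sqint_residual period_sum_residual; split=> //.
rewrite /Rintegral; congr fine; apply: ae_eq_integral => //.
- exact: measurable_int i.
- apply: measurable_funTS; apply/measurable_EFinP; apply: measurable_funX.
  by apply: measurable_funB => //; exact: measurable_periodized.
- by apply: (ae_imply _ periodized_residual) => u E cu; rewrite E.
Qed.

End residual_kernel.

Lemma half_bound (R : realFieldType) (e A : R) : 0 < e -> 0 <= A ->
  e * A <= e / 2 * (2 * (A + 1)).
Proof. nra. Qed.

Section grid_kernels.
Context (R : realType) (Delta : R) (Delta_gt0 : 0 < Delta).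
Notation mu := (@lebesgue_measure R).
Notation cell := (fundamental_cell Delta).
Variables (psi : R -> R).
Hypotheses (mpsi : measurable_fun setT psi)
  (ipsi : mu.-integrable cell (EFin \o (fun u => psi u ^+ 2))).

Let measurable_cell : measurable cell. Proof. exact: measurable_itv. Qed.

(** From |b^2 - a^2| <= eta a^2 + (1 + 1 / eta) (a - b)^2, closeness in mean square
    gives closeness of the integrals of squares. *)
Lemma grid_norm_dense (e : R) : 0 < e -> exists r c, [/\ (0 < r)%N,
  \int[mu]_(u in cell) (psi u - grid_step Delta r c u) ^+ 2 <= e &
  `|\int[mu]_(u in cell) grid_step Delta r c u ^+ 2 - \int[mu]_(u in cell) psi u ^+ 2| <= e].
Proof.
move=> e0; pose A := \int[mu]_(u in cell) psi u ^+ 2.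
have A0 : 0 <= A by apply: Rintegral_ge0 => u _; exact: sqr_ge0.
pose eta := e / (2 * (A + 1)).
have eta0 : 0 < eta by rewrite divr_gt0// mulr_gt0// ltr_pwDr.
pose k := 1 + eta^-1; have k1 : 1 <= k by rewrite lerDl invr_ge0 ltW.
have k0 : 0 < k by apply: lt_le_trans k1.
have e'0 : 0 < e / (2 * k) by rewrite divr_gt0// mulr_gt0.
have [r [c [r0 Hc]]] := grid_dense Delta_gt0 mpsi ipsi e'0.
exists r, c; split=> //.
  by rewrite (le_trans Hc)// ler_pdivrMr ?mulr_gt0// ler_peMr ?ltW//; lra.
pose q := grid_step Delta r c.
have mq : measurable_fun setT q by exact: measurable_grid_step.
have bound a b : `|b ^+ 2 - a ^+ 2| <= eta * a ^+ 2 + k * (a - b) ^+ 2.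
  have -> : b ^+ 2 - a ^+ 2 = (a - b) ^+ 2 - 2 * a * (a - b) by ring.
  have H1 := sqr_ge0 (eta * a - (a - b)); have H2 := sqr_ge0 (eta * a + (a - b)).
  have I : eta^-1 * eta = 1 by rewrite mulVf// gt_eqF.
  have J := sqr_ge0 (a - b).
  have E1 : eta^-1 * (eta * a - (a - b)) ^+ 2 = eta * a ^+ 2 - 2 * a * (a - b) + eta^-1 * (a - b) ^+ 2.
    by field; rewrite gt_eqF.
  have E2 : eta^-1 * (eta * a + (a - b)) ^+ 2 = eta * a ^+ 2 + 2 * a * (a - b) + eta^-1 * (a - b) ^+ 2.
    by field; rewrite gt_eqF.
  have P1 : 0 <= eta^-1 * (eta * a - (a - b)) ^+ 2 by rewrite mulr_ge0// invr_ge0 ltW.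
  have P2 : 0 <= eta^-1 * (eta * a + (a - b)) ^+ 2 by rewrite mulr_ge0// invr_ge0 ltW.
  rewrite /k mulrDl mul1r ler_norml; move: P1 P2; rewrite E1 E2.
  by move=> P1 P2; apply/andP; split; lra.
have qB u : `|q u| <= \sum_(m < r) `|c m| by exact: grid_step_le_sum.
pose B := \sum_(m < r) `|c m|.
have iqq : mu.-integrable cell (EFin \o (fun u => q u ^+ 2)).
  apply: (@bounded_integrable_cell _ _ Delta_gt0 _ (B ^+ 2)) => [|u]; first exact: measurable_funX.
  by rewrite normrX lerXn2r ?nnegrE// (le_trans _ (qB 0)).
have mpq : measurable_fun setT (fun u => (psi u - q u) ^+ 2).
  by apply: measurable_funX; exact: measurable_funB.
have i2 := @RintegrableD _ _ _ mu _ _ _ measurable_cell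
  (@RintegrableZl _ _ _ mu _ 2 _ measurable_cell ipsi)
  (@RintegrableZl _ _ _ mu _ 2 _ measurable_cell iqq).
have ipq : mu.-integrable cell (EFin \o (fun u => (psi u - q u) ^+ 2)).
  apply: (@le_Rintegrable _ _ _ mu _ _ _ measurable_cell _ i2) => [|u _].
    exact: measurable_funTS.
  by rewrite ger0_norm ?sqr_ge0//; have := sqr_ge0 (psi u + q u); rewrite sqrrB sqrrD; lra.
have iB := @RintegrableB _ _ _ mu _ _ _ measurable_cell iqq ipsi.
have iD := @RintegrableD _ _ _ mu _ _ _ measurable_cell
  (@RintegrableZl _ _ _ mu _ eta _ measurable_cell ipsi)
  (@RintegrableZl _ _ _ mu _ k _ measurable_cell ipq).
rewrite -(@RintegralB _ _ _ mu)//.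
rewrite (le_trans (@le_normr_Rintegral _ _ _ mu _ _ measurable_cell iB))//.
apply: (@le_trans _ _ (\int[mu]_(u in cell) (eta * psi u ^+ 2 + k * (psi u - q u) ^+ 2))).
  apply: le_Rintegral => //.
  exact: integrable_norm.
rewrite (@RintegralD _ _ _ mu)//; last 2 first.
- exact: (@RintegrableZl _ _ _ mu).
- exact: (@RintegrableZl _ _ _ mu).
rewrite !(@RintegralZl _ _ _ mu)// -/A.
have h1 : eta * A <= e / 2.
  by rewrite /eta mulrAC ler_pdivrMr ?mulr_gt0 ?ltr_pwDr//; exact: half_bound.
have h2 : k * \int[mu]_(u in cell) (psi u - q u) ^+ 2 <= e / 2.
  apply: (le_trans (ler_wpM2l (ltW k0) Hc)).
  by rewrite le_eqVlt; apply/orP; left; apply/eqP; field; rewrite gt_eqF.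
by rewrite [leRHS]splitr lerD.
Qed.

End grid_kernels.

(** * The normal law *)

(** normal_prob is defined by its density on sets; the Radon-Nikodym theorem
    identifies the integrals of functions. *)
Lemma Rintegral_normal_prob (R : realType) (s : R) (h : R -> R) (M : R) :
  measurable_fun setT h -> (forall x, `|h x| <= M) ->
  \int[normal_prob 0 s]_x h x = \int[@lebesgue_measure R]_y (h y * normal_pdf 0 s y).
Proof.
move=> mh hM; rewrite /Rintegral; congr fine.
have dom := normal_prob_dominates (0 : R) s.
rewrite -(Radon_Nikodym_change_of_variables dom)//=; last first.
  exact: (@bounded_integrable _ _ _ (normal_prob 0 s) h M).
apply: ae_eq_integral => //.
- apply: emeasurable_funM; first exact/measurable_EFinP.
  apply: (measurable_int (@lebesgue_measure R)).
  by apply: Radon_Nikodym_integrable.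
- by apply/measurable_EFinP; apply: measurable_funM => //; exact: measurable_normal_pdf.
- have ae : ae_eq (@lebesgue_measure R) setT (Radon_Nikodym (charge_of_finite_measure (normal_prob (0 : R) s)) (@lebesgue_measure R))%E
      (fun y => (normal_pdf 0 s y)%:E).
    rewrite Radon_NikodymE.
    case: cid => /= g [g1 g2 g3].
    apply: integral_ae_eq => //=.
      by apply/measurable_EFinP; exact: measurable_normal_pdf.
    by move=> E _ mE; rewrite -g3.
  by apply: (ae_imply _ ae) => y /= E _; rewrite E// EFinM.
Qed.

Lemma normal_law_cos (R : realType) (v l th : R) : 0 <= v ->
  \int[normal_law 0 v]_x cos (l * x + th) = expR (- (l ^+ 2 * v / 2)) * cos th.
Proof.
have mc : measurable_fun [set: measurableTypeR R] (fun x => cos (l * x + th)).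
  by apply: measurable_fun_cos; apply: measurable_funD => //; exact: measurable_funM.
move=> v0; rewrite /normal_law; case: eqVneq => [->|vn0].
  rewrite /Rintegral integral_dirac//=; last exact/measurable_EFinP.
  by rewrite indicT mul1r !mulr0 add0r mul0r oppr0 expR0 mul1r.
have vp : 0 < v by rewrite lt_neqAle eq_sym vn0.
rewrite /= (@Rintegral_normal_prob _ _ _ 1)//; last by move=> x; rewrite cos_max.
by rewrite normal_characteristic ?sqrtr_gt0// sqr_sqrtr// [v * _]mulrC.
Qed.

(** * Integrals of grid steps *)

Lemma sum_blocks (V : nmodType) (F : nat -> V) n r :
  \sum_(l < n * r) F l = \sum_(k < n) \sum_(m < r) F (k * r + m)%N.
Proof.
elim: n => [|n IH]; first by rewrite mul0n !big_ord0.
by rewrite mulSnr big_split_ord/= IH big_ord_recr.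
Qed.

Section reflected_kernels.
Context (R : realType).
Notation mu := (@lebesgue_measure R).

Lemma sqint_opp (h : R -> R) : sqint mu h -> sqint mu (fun x => h (- x)).
Proof.
move=> [mh ih]; have mt := measurableT_comp mh (@oppr_measurable R setT); split=> //.
apply/integrableP; split; first by apply/measurable_EFinP; exact: measurable_funX.
case/integrableP : ih => _.
rewrite -(ge0_integral_opp (f := fun x => `|(h x ^+ 2)%:E|%E))//.
by apply: measurableT_comp => //; apply/measurable_EFinP; exact: measurable_funX.
Qed.

Lemma sqint_reflect (h : R -> R) (t : R) : sqint mu h -> sqint mu (fun s => h (t - s)).
Proof.
move=> sh; have := sqint_translate (- t) (sqint_opp sh).
by congr sqint; apply/funext => s; congr h; ring.
Qed.

(** Reflect and translate the variable of integration. *)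
Lemma ip_reflect (Delta : R) (h : R -> R) (i k : int) : sqint mu h ->
  ip mu (fun s => h (i%:~R * Delta - s)) (fun s => h (k%:~R * Delta - s)) =
  correlation Delta h (i - k).
Proof.
move=> sh; have mh := sh.1.
have mt (c : R) : measurable_fun setT (fun x : R => h (x + c)).
  by apply: (measurableT_comp mh); exact: measurable_funD.
rewrite /correlation /ip.
rewrite -(@Rintegral_opp _ (fun x => h x * h (x + (i - k)%:~R * Delta))); last first.
  exact: measurable_funM.
rewrite -(@Rintegral_shift _ (- (k%:~R * Delta))
  (fun x => h (- x) * h (- x + (i - k)%:~R * Delta))); last first.
  have mo := @oppr_measurable R setT.
  have m1 := measurableT_comp mh mo.
  have m2 := measurableT_comp (mt ((i - k)%:~R * Delta)) mo.
  exact: (measurable_funM m1 m2).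
apply: eq_Rintegral => s _; rewrite mulrC; congr (h _ * h _); rewrite ?intrB; ring.
Qed.

End reflected_kernels.

Section grid_integrals.
Context d (T : measurableType d) (R : realType) (P : probability T R).
Variables (L : R -> {RV P >-> R}) (sigma Delta : R).
Hypotheses (HL : two_sided_levy_process L)
  (L_mean : ('E_P[L 1%R] = 0)%E)
  (L_var : ('E_P[fun w => (L 1 w ^+ 2)%R] = (sigma ^+ 2)%:E)%E)
  (Delta_gt0 : 0 < Delta).
Notation mu := (@lebesgue_measure R).
Notation cell := (fundamental_cell Delta).
Variables (r : nat) (c : nat -> R).
Hypothesis r_gt0 : (0 < r)%N.

Let r0 : 0 < r%:R :> R. Proof. by rewrite ltr0n. Qed.
Let rn0 : r%:R != 0 :> R. Proof. by rewrite gt_eqF. Qed.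

(** The integral of s |-> grid_step Delta r c (t - s): reflection turns the cell of
    index m, closed on the left, into an interval closed on the right, as the
    increments of the process require. *)
Definition grid_integral (t : R) (w : T) : R :=
  \sum_(m < r) c m *
    increment L (t - m.+1%:R * Delta / r%:R) (t - m%:R * Delta / r%:R) w.

Lemma grid_integral_step t :
  step_integral L (fun s => grid_step Delta r c (t - s)) (grid_integral t).
Proof.
exists r, (fun m => t - m.+1%:R * Delta / r%:R), (fun m => t - m%:R * Delta / r%:R), (fun m => c m).
split => //.
- by move=> m; rewrite lerB// ler_pM2r ?invr_gt0// ler_pM2r// ler_nat.
- move=> s; rewrite /grid_step; apply: eq_bigr => m _; congr (_ * _); rewrite !indicE.
  congr (nat_of_bool _)%:R; apply/idP/idP; rewrite !inE /grid_cell /= !in_itv/=;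
    by move=> /andP[h1 h2]; apply/andP; split; lra.
Qed.

Let xi (l : nat) : T -> R :=
  increment L (l%:R * (Delta / r%:R)) (l.+1%:R * (Delta / r%:R)).
Let b (l : nat) : R := c (r - (l %% r).+1)%N.

(** At time (k + 1) Delta the integral uses the r grid increments over
    [k Delta, (k + 1) Delta], in reversed order; consecutive times use disjoint
    blocks. *)
Lemma grid_integral_sum n w :
  \sum_(k < n) grid_integral (k.+1%:R * Delta) w = \sum_(l < n * r) b l * xi l w.
Proof.
rewrite (sum_blocks (fun l => b l * xi l w)); apply: eq_bigr => k _.
rewrite /grid_integral (reindex_inj rev_ord_inj)/=; apply: eq_bigr => m _.
have mr := ltn_ord m.
rewrite /b modnMDl modn_small// /xi; congr (_ * increment L _ _ w).
  rewrite subnSK// natrB 1?ltnW// natrD natrM -natr1; field; exact: rn0.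
rewrite natrB// -!natr1 natrD natrM; field; exact: rn0.
Qed.

Let mutually_independent_xi n : mutually_independent P (fun i : 'I_n => xi i).
Proof.
apply: (@levy_independent_increments _ _ _ _ _ HL n (fun l => l%:R * (Delta / r%:R))).
by move=> i j ij; rewrite ltr_pM2r ?divr_gt0// ltr_nat.
Qed.

Let identically_distributed_xi i : identically_distributed P (xi i) (xi 0).
Proof.
move=> A mA; apply/esym.
have := levy_stationary_increments HL (s := 0) (t := Delta / r%:R) (i%:R * (Delta / r%:R)).
move=> /(_ (ltW (divr_gt0 Delta_gt0 r0)) A mA).
by rewrite /xi mul0r mul1r add0r -natr1 mulrDl mul1r addrC.
Qed.

(** The blocks make the normalized sum one of n r independent and identically
    distributed increments, with periodic weights. *)
Theorem grid_integral_central_limit l th :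
  \int[P]_w cos (l * ((Num.sqrt n%:R)^-1 * \sum_(k < n) grid_integral (k.+1%:R * Delta) w) + th)
    @[n --> \oo] -->
  expR (- (l ^+ 2 * (sigma ^+ 2 * \int[mu]_(u in cell) grid_step Delta r c u ^+ 2) / 2)) * cos th.
Proof.
have xi0 : 0%:R * (Delta / r%:R) <= 1%:R * (Delta / r%:R).
  by rewrite ler_pM2r ?divr_gt0// ler_nat.
have [sx mx ix] := increment_moments HL L_mean L_var xi0.
have -> : (fun n => \int[P]_w cos (l * ((Num.sqrt n%:R)^-1 *
    \sum_(k < n) grid_integral (k.+1%:R * Delta) w) + th)) =
  (fun n => \int[P]_w cos (l * ((Num.sqrt n%:R)^-1 * \sum_(i < n * r) b i * xi i w) + th)).
  by apply/funext => n; apply: eq_Rintegral => w _; rewrite grid_integral_sum.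
apply: (@central_limit_cos _ _ _ _ xi _ _ (sigma ^+ 2 * (Delta / r%:R)) _ _ _ _ b (\sum_(m < r) `|c m|)) => //.
- by move=> i; exact: measurable_increment.
- by rewrite ix; ring.
- move=> i; have im : (r - (i %% r).+1 < r)%N by rewrite ltn_subrL.
  by rewrite /b (bigD1 (Ordinal im))//= lerDl sumr_ge0.
- move=> n; rewrite (sum_blocks (fun i => b i ^+ 2 * (sigma ^+ 2 * (Delta / r%:R)))).
  have -> : \int[mu]_(u in cell) grid_step Delta r c u ^+ 2 =
      \int[mu]_(u in cell) grid_step Delta r (fun m => c m ^+ 2) u.
    by apply: eq_Rintegral => u _; exact: grid_step_sqr.
  rewrite Rintegral_grid_step// mulr_sumr.
  transitivity (\sum_(k < n) \sum_(m < r) c m ^+ 2 * (sigma ^+ 2 * (Delta / r%:R))).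
    apply: eq_bigr => k _; rewrite (reindex_inj rev_ord_inj)/=; apply: eq_bigr => m _.
    by rewrite /b modnMDl modn_small ?ltn_subrL// subnSK// subKn// ltnW.
  rewrite sumr_const card_ord mulr_natl; congr (_ *+ _); apply: eq_bigr => m _; ring.
Qed.

End grid_integrals.

(** * Normalized sums *)

Lemma normr_cosB_le (R : realType) (x y : R) : `|cos x - cos y| <= `|x - y|.
Proof.
have -> : cos x - cos y = - 2 * (sin ((x - y) / 2) * sin ((x + y) / 2)).
  have -> : cos x = cos ((x - y) / 2 + (x + y) / 2) by congr cos; field.
  have -> : cos y = cos ((x + y) / 2 - (x - y) / 2) by congr cos; field.
  by rewrite cosD cosB; ring.
rewrite normrM normrN normr_nat normrM.
have h := normr_sin_le ((x - y) / 2).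
have s1 : `|sin ((x + y) / 2)| <= 1 by rewrite sin_max.
have -> : `|x - y| = 2 * `|(x - y) / 2| by rewrite normrM normfV normr_nat; field.
by rewrite ler_pM2l// -[leRHS]mulr1 ler_pM.
Qed.

Section normalized_sums.
Context d (T : measurableType d) (R : realType) (P : probability T R).

Definition normalized_sum (Y : nat -> T -> R) (n : nat) (w : T) : R :=
  (Num.sqrt n%:R)^-1 * \sum_(k < n) Y k w.

Lemma sqint_normalized_sum Y n : (forall k, sqint P (Y k)) -> sqint P (normalized_sum Y n).
Proof. by move=> sY; apply: sqintZ; exact: sqint_sum. Qed.

(** The double sum of covariances is a Cesaro mean. *)
Lemma normalized_sum_ip Y (s2 : R) (a : int -> R) : (forall k, sqint P (Y k)) ->
  (forall i k, ip P (Y i) (Y k) = s2 * a (Posz i - Posz k)) -> bilateral_summable a ->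
  ip P (normalized_sum Y n) (normalized_sum Y n) @[n --> \oo] --> s2 * bilateral_sum a.
Proof.
move=> sY ipY sa.
have -> : (fun n => ip P (normalized_sum Y n) (normalized_sum Y n)) =
    (fun n => s2 * (n%:R^-1 * \sum_(i < n) \sum_(k < n) a (Posz i - Posz k))).
  apply/funext => n.
  have ss : sqint P (fun w => \sum_(k < n) Y k w) by exact: sqint_sum.
  rewrite /normalized_sum ipZl//; last exact: sqintZ.
  rewrite ipZr// mulrA -expr2 exprVn sqr_sqrtr// mulrCA; congr (_ * _).
  rewrite ip_suml// mulr_sumr; apply: eq_bigr => i _.
  rewrite ip_sumr// mulr_sumr; apply: eq_bigr => k _; exact: ipY.
by apply: cvgM; [exact: cvg_cst|exact: cesaro_bilateral].
Qed.

(** The cosine is 1-Lipschitz, and the L^1-norm is bounded by the L^2-norm. *)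
Lemma cos_Rintegral_dist (A B : T -> R) (l th : R) : sqint P A -> sqint P B ->
  `|\int[P]_w cos (l * A w + th) - \int[P]_w cos (l * B w + th)| <=
  `|l| * Num.sqrt (ip P (fun w => A w - B w) (fun w => A w - B w)).
Proof.
move=> sA sB; have mA := sA.1; have mB := sB.1.
have mc (C : T -> R) : measurable_fun setT C -> measurable_fun setT (fun w => cos (l * C w + th)).
  by move=> mC; apply: measurable_fun_cos; apply: measurable_funD => //; exact: measurable_funM.
have ic (C : T -> R) : measurable_fun setT C -> P.-integrable setT (EFin \o (fun w => cos (l * C w + th))).
  by move=> mC; apply: (@bounded_integrable _ _ _ _ _ 1) => [|w]; [exact: mc|rewrite cos_max].
have sAB := sqintB sA sB; have iAB := sqint_integrable sAB.
have iD := RintegrableB measurableT (ic _ mA) (ic _ mB).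
rewrite -RintegralB//; [|exact: ic|exact: ic].
apply: (le_trans (le_normr_Rintegral measurableT iD)).
apply: (le_trans _ (ler_wpM2l (normr_ge0 l) (Rintegral_norm_le_ip sAB))).
rewrite -RintegralZl//; last exact: integrable_norm.
apply: le_Rintegral => //.
- exact: integrable_norm.
- by apply: RintegrableZl => //; exact: integrable_norm.
- move=> w _; rewrite (le_trans (normr_cosB_le _ _))// -normrM.
  by rewrite le_eqVlt; apply/orP; left; apply/eqP; congr (`|_|); ring.
Qed.

End normalized_sums.

(** Interchange of limits: a n is approximated by sequences z whose limits phi v'
    tend to phi v, the approximation being uniform for large n. *)
Lemma cvg_approximation (R : realType) (a : R^nat) (phi : R -> R) (v : R) :
  {for v, continuous phi} ->
  (forall e : R, 0 < e -> exists (v' : R) (z D : R^nat) (D' : R),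
    [/\ `|v' - v| <= e, z @ \oo --> phi v', forall n, `|a n - z n| <= D n,
       D @ \oo --> D' & D' <= e]) ->
  a @ \oo --> phi v.
Proof.
move=> cphi H; apply/cvgrPdist_le => e e0; have e40 : 0 < e / 4 by rewrite divr_gt0.
have /cvgrPdist_le /(_ _ e40) := cphi.
move=> /nbhs_ballP[dl /= dl0 Hdl].
pose e' := Num.min (e / 4) (dl / 2).
have e'0 : 0 < e' by rewrite lt_min e40 divr_gt0.
have [v' [z [D [D' [vv' cz aD cD D'e]]]]] := H _ e'0.
have vball : `|phi v - phi v'| <= e / 4.
  apply: Hdl; rewrite /ball/= distrC (le_lt_trans vv')//.
  by rewrite gt_min; apply/orP; right; rewrite ltr_pdivrMr// ltr_pMr// ltr1n.
have De : D' <= e / 4 by rewrite (le_trans D'e)// ge_min lexx.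
move: cz cD => /cvgrPdist_le /(_ _ e40) cz /cvgrPdist_le /(_ _ e40) cD.
near=> n.
have h1 : `|phi v' - z n| <= e / 4 by near: n.
have h2 : `|D' - D n| <= e / 4 by near: n.
have h3 := aD n.
have -> : phi v - a n = (phi v - phi v') + (phi v' - z n) - (a n - z n) by ring.
have h4 : D n <= D' + e / 4 by move: h2; rewrite ler_norml => /andP[]; lra.
rewrite (le_trans (ler_normB _ _))// (le_trans (lerD (ler_normD _ _) (lexx _)))//.
lra.
Unshelve. all: by end_near. Qed.

(** * The moving average *)

Section moving_average.
Context d (T : measurableType d) (R : realType) (P : probability T R).
Variables (L : R -> {RV P >-> R}) (sigma m Delta : R) (f : R -> R) (X : R -> {RV P >-> R}).
Hypotheses (HL : two_sided_levy_process L)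
  (L_mean : ('E_P[L 1%R] = 0)%E)
  (L_var : ('E_P[fun w => (L 1 w ^+ 2)%R] = (sigma ^+ 2)%:E)%E)
  (Delta_gt0 : 0 < Delta).
Notation mu := (@lebesgue_measure R).
Notation cell := (fundamental_cell Delta).
Hypotheses (sf : sqint mu f)
  (X_def : forall t, levy_integral L (fun s => f (t - s)) (fun w => X t w - m))
  (F2 : (\int[mu]_(u in cell) period_sum Delta (fun x => `|f x|%R) u ^+ 2 < +oo)%E).

Let Y (t : R) (w : T) : R := X t w - m.

Let intY t : mean_square_integral L (fun s => f (t - s)) (Y t).
Proof. exact: (levy_integral_mean_square HL L_mean L_var (sqint_reflect t sf) (X_def t)). Qed.

Let sY t : sqint P (Y t). Proof. by have [] := intY t. Qed.

Let ipY (i k : int) : ip P (Y (i%:~R * Delta)) (Y (k%:~R * Delta)) =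
  sigma ^+ 2 * correlation Delta f (i - k).
Proof. by rewrite (ito_isometry HL L_mean L_var (intY _) (intY _)) ip_reflect. Qed.

Lemma moving_average_mean t : \int[P]_w X t w = m.
Proof.
have -> : \int[P]_w X t w = \int[P]_w (Y t w + m) by apply: eq_Rintegral => w _; rewrite subrK.
rewrite RintegralD//; last 2 first.
- exact: sqint_integrable.
- by apply: sqint_integrable; exact: sqint_cst.
by rewrite (mean_square_integral_mean HL L_mean L_var (intY t)) Rintegral_cstP add0r.
Qed.

(** Both variables are centred, so that the covariance is an inner product, which
    the isometry evaluates. *)
Lemma autocovariance_correlation (j : int) :
  autocovariance X (Delta * j%:~R) = (sigma ^+ 2 * correlation Delta f j)%:E.
Proof.
rewrite /autocovariance covarianceC unlock.
have E t : fine 'E_P[X t] = m by rewrite unlock; exact: moving_average_mean.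
rewrite !E unlock.
rewrite -[in RHS](subr0 j) -ipY /ip /Rintegral mul0r fineK; last first.
  by apply: integrable_fin_num => //; exact: sqint_mul.
by apply: eq_integral => w _; rewrite /Y [Delta * _]mulrC.
Qed.

Let G := periodized f Delta.

Lemma autocovariance_esum_lty :
  (\esum_(j in [set: int]) `|autocovariance X (Delta * j%:~R)%R| < +oo)%E.
Proof.
under eq_esum do rewrite autocovariance_correlation abse_EFin normrM EFinM.
by rewrite esum_intZ// lte_mul_pinfty ?correlation_esum_lty//.
Qed.

Lemma autocovariance_bilateral_sum :
  bilateral_sum (fun j => fine (autocovariance X (Delta * j%:~R)%R)) =
  sigma ^+ 2 * \int[mu]_(u in cell) G u ^+ 2.
Proof.
have [s _ <-] := correlation_sum Delta_gt0 sf F2.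
rewrite -(bilateral_sumZ _ s).2; congr bilateral_sum; apply/funext => j.
by rewrite autocovariance_correlation.
Qed.

Let v := sigma ^+ 2 * \int[mu]_(u in cell) G u ^+ 2.

Let v_ge0 : 0 <= v.
Proof. by rewrite mulr_ge0 ?sqr_ge0//; apply: Rintegral_ge0 => u _; exact: sqr_ge0. Qed.

Let S := normalized_sum (fun k => Y (k.+1%:R * Delta)).

Let sS n : sqint P (S n). Proof. by apply: sqint_normalized_sum => k. Qed.

Let succB (i k : nat) : Posz i.+1 - Posz k.+1 = Posz i - Posz k.
Proof. by rewrite !intS opprD addrACA subrr add0r. Qed.

Let ipS : ip P (S n) (S n) @[n --> \oo] --> v.
Proof.
have [s _ e] := correlation_sum Delta_gt0 sf F2.
rewrite /v -e; apply: normalized_sum_ip => // i k.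
by rewrite (ipY (Posz i.+1) (Posz k.+1)) succB.
Qed.

Section grid_comparison.
Variables (r : nat) (c : nat -> R).
Hypothesis r_gt0 : (0 < r)%N.
Let q := grid_step Delta r c.
Let Z (k : nat) := grid_integral L Delta r c (k.+1%:R * Delta).

Let intZ k : mean_square_integral L (fun s => q (k.+1%:R * Delta - s)) (Z k).
Proof. by apply: (step_mean_square HL L_mean L_var); exact: grid_integral_step. Qed.

Let sZ k : sqint P (Z k). Proof. by have [] := intZ k. Qed.

Let mq : measurable_fun setT q. Proof. exact: measurable_grid_step. Qed.

(** The residual X - mu - Z is the integral of the kernel f - q, at the level of
    covariances. *)
Let ipYZ (i k : nat) :
  ip P (fun w => Y (i.+1%:R * Delta) w - Z i w) (fun w => Y (k.+1%:R * Delta) w - Z k w) =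
  sigma ^+ 2 * correlation Delta (fun x => f x - q x) (Posz i - Posz k).
Proof.
have sq := sqint_cell_bounded mq (grid_step_le_sum Delta r c) (@grid_step_out _ _ Delta_gt0 r c).
have sfr t := sqint_reflect t sf; have sqr t := sqint_reflect t sq.
have sh : sqint mu (fun x => f x - q x) by exact: sqintB.
rewrite -succB -ip_reflect//.
have dYZ := sqintB (sY (k.+1%:R * Delta)) (sZ k).
have dfq := sqintB (sfr (k.+1%:R * Delta)) (sqr (k.+1%:R * Delta)).
rewrite (ipBl (sY _) (sZ _) dYZ) !(ipBr (sY _) (sZ _)) //.
rewrite !(ito_isometry HL L_mean L_var (intY _) (intY _)) !(ito_isometry HL L_mean L_var (intY _) (intZ _)).
rewrite !(ito_isometry HL L_mean L_var (intZ _) (intY _)) !(ito_isometry HL L_mean L_var (intZ _) (intZ _)).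
rewrite (ipBl (sfr _) (sqr _) dfq) !(ipBr (sfr _) (sqr _)) //.
by rewrite -!mulrBr.
Qed.

Lemma grid_residual_ip :
  ip P (fun w => S n w - normalized_sum Z n w) (fun w => S n w - normalized_sum Z n w)
    @[n --> \oo] --> sigma ^+ 2 * \int[mu]_(u in cell) (G u - q u) ^+ 2.
Proof.
have [s <-] := residual_correlation_sum Delta_gt0 sf F2 mq (grid_step_le_sum Delta r c)
  (@grid_step_out _ _ Delta_gt0 r c).
pose D (k : nat) w := Y (k.+1%:R * Delta) w - Z k w.
have E n : (fun w => S n w - normalized_sum Z n w) = normalized_sum D n.
  by apply/funext => w; rewrite /S /normalized_sum -mulrBr -sumrB.
under eq_fun do rewrite E.
apply: normalized_sum_ip => // k; exact: sqintB.
Qed.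

End grid_comparison.

(** Approximate the periodization G by a grid step q. The sums with kernel q satisfy
    the central limit theorem with variance sigma^2 int q^2, close to v, and the
    residual sums have asymptotic variance sigma^2 int (G - q)^2, which is small. *)
Lemma normalized_sum_characteristic l th :
  \int[P]_w cos (l * S n w + th) @[n --> \oo] --> \int[normal_law 0 v]_x cos (l * x + th).
Proof.
rewrite normal_law_cos//.
apply: (@cvg_approximation _ _ (fun v => expR (- (l ^+ 2 * v / 2)) * cos th)).
  rewrite /prop_for /=; apply: cvgM; last exact: cvg_cst.
  apply: (@continuous_cvg _ _ _ _ _ (fun v => - (l ^+ 2 * v / 2)) expR); first exact: continuous_expR.
  apply: cvgN; apply: cvgM; last exact: cvg_cst.
  by apply: cvgM; [exact: cvg_cst|exact: cvg_id].
move=> e e0; pose K := sigma ^+ 2 + l ^+ 2 * sigma ^+ 2 + 1.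
have K1 : 1 <= K by rewrite lerDr addr_ge0 ?sqr_ge0// mulr_ge0 ?sqr_ge0//.
have K0 : 0 < K by apply: lt_le_trans K1.
(* The first bound controls the variance of the limit; the second one the square
   of |l| times the L^2-distance of the normalized sums. *)
pose e' := Num.min (e / K) (e ^+ 2 / K).
have e'0 : 0 < e' by rewrite lt_min !divr_gt0// exprn_gt0.
have [_ iG _] := correlation_sum Delta_gt0 sf F2.
have mG : measurable_fun setT G by apply: measurable_periodized.
have [r [c [r0 Hd Hn]]] := grid_norm_dense Delta_gt0 mG iG e'0.
exists (sigma ^+ 2 * \int[mu]_(u in cell) grid_step Delta r c u ^+ 2).
pose Z (k : nat) := grid_integral L Delta r c (k.+1%:R * Delta).
exists (fun n => \int[P]_w cos (l * normalized_sum Z n w + th)).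
exists (fun n => `|l| * Num.sqrt (ip P (fun w => S n w - normalized_sum Z n w)
  (fun w => S n w - normalized_sum Z n w))).
exists (`|l| * Num.sqrt (sigma ^+ 2 * \int[mu]_(u in cell) (G u - grid_step Delta r c u) ^+ 2)).
have sZ n : sqint P (normalized_sum Z n).
  apply: sqint_normalized_sum => k; have := grid_integral_step L Delta_gt0 c r0 (k.+1%:R * Delta).
  by move=> /(step_mean_square HL L_mean L_var) [].
split.
- rewrite -mulrBr normrM ger0_norm ?sqr_ge0//.
  have s1 : sigma ^+ 2 <= K by rewrite /K -addrA lerDl addr_ge0// mulr_ge0// sqr_ge0.
  rewrite (le_trans (ler_pM (sqr_ge0 _) (normr_ge0 _) s1 Hn))//.
  rewrite mulrC -ler_pdivlMr// ge_min lexx//.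
- exact: grid_integral_central_limit.
- by move=> n; exact: cos_Rintegral_dist.
- apply: cvgM; first exact: cvg_cst.
  apply: continuous_cvg; first exact: sqrt_continuous.
  exact: grid_residual_ip.
- rewrite -[leRHS](ger0_norm (ltW e0)) -!sqrtr_sqr -sqrtrM ?sqr_ge0// ler_wsqrtr//.
  have s2 : l ^+ 2 * sigma ^+ 2 <= K by rewrite /K addrAC lerDr addr_ge0// sqr_ge0.
  have D0 : 0 <= \int[mu]_(u in cell) (G u - grid_step Delta r c u) ^+ 2.
    by apply: Rintegral_ge0 => u _; exact: sqr_ge0.
  have ls0 : 0 <= l ^+ 2 * sigma ^+ 2 by rewrite mulr_ge0// sqr_ge0.
  rewrite mulrA (le_trans (ler_pM ls0 D0 s2 Hd))//.
  by rewrite mulrC -ler_pdivlMr// ge_min lexx orbT.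
Qed.

(** The second moments of the normalized sums converge, hence are bounded, which
    is the tightness that levy_continuity asks for. *)
Lemma moving_average_central_limit (g : R -> R) : continuous g ->
  (exists M, forall x, `|g x| <= M) ->
  \int[P]_w g (S n w) @[n --> \oo] --> \int[normal_law 0 v]_x g x.
Proof.
apply: levy_continuity.
- by move=> n; exact: (sS n).1.
- exact: normalized_sum_characteristic.
- have [C HC] : exists C, forall n, ip P (S n) (S n) <= C.
    have /cvg_seq_bounded [M [_ HM]] : cvgn (fun n => ip P (S n) (S n)) by apply/cvg_ex; exists v.
    exists (M + 1) => n; apply: le_trans (ler_norm _) _; apply: (HM (M + 1)) => //.
    by rewrite ltrDl.
  by exists C.
Qed.

Lemma normalized_sum_sample_mean n w :
  Num.sqrt n%:R * (sample_mean X Delta n w - m) = S n w.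
Proof.
rewrite /sample_mean /S /normalized_sum big_add1/= big_mkord.
have [->|n0] := posnP n; first by rewrite !big_ord0 sqrtr0 mul0r mulr0.
have sn0 : Num.sqrt n%:R != 0 :> R by rewrite sqrtr_eq0 -ltNge ltr0n.
rewrite sumrB sumr_const card_ord -[m *+ n]mulr_natl.
move: (Num.sqrt n%:R) sn0 (sqr_sqrtr (ler0n R n)) => s s0 <-.
by field.
Qed.

End moving_average.

Theorem theorem2p1 (d : measure_display) (T : measurableType d) (R : realType)
    (P : probability T R) (L : R -> {RV P >-> R}) (sigma mu Delta : R)
    (f : R -> R) (X : R -> {RV P >-> R})
    (L_levy : two_sided_levy_process L)
    (L_mean : ('E_P[L 1%R] = 0)%E)
    (L_var : ('E_P[fun w => (L 1 w ^+ 2)%R] = (sigma ^+ 2)%:E)%E)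
    (Delta_gt0 : 0 < Delta)
    (f_L2 : f \in Lfun (@lebesgue_measure R) 2%:E)
    (X_def : forall t : R,
      levy_integral L (fun s => f (t - s)) (fun w => X t w - mu))
    (F_L2 : (\int[@lebesgue_measure R]_(u in `[0%R, Delta])
               periodized_abs f Delta u ^+ 2 < +oo)%E) :
  let v := sigma ^+ 2 *
           \int[@lebesgue_measure R]_(u in `[0, Delta])
             periodized f Delta u ^+ 2 in
  [/\ (\esum_(j in [set: int])
         `|autocovariance X (Delta * j%:~R)%R| < +oo)%E,
      bilateral_sum (fun j => fine (autocovariance X (Delta * j%:~R)%R)) = v &
      cvg_in_distribution P
        (fun n w => Num.sqrt n%:R * (sample_mean X Delta n w - mu))
        (normal_law 0 v)].
Proof.
have sf := Lfun2_sqint f_L2.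
have mF : measurable_fun setT (fun u => (period_sum Delta (fun x => `|f x|%R) u ^+ 2)%E).
  by apply: emeasurable_funM; apply: measurable_period_sum => //;
    apply: measurableT_comp => //; exact: sf.1.
have F2 : (\int[@lebesgue_measure R]_(u in fundamental_cell Delta)
    period_sum Delta (fun x => `|f x|%R) u ^+ 2 < +oo)%E.
  rewrite /fundamental_cell integral_itv_bndo_bndc//.
  exact: measurable_funTS.
move=> v.
have vE : v = sigma ^+ 2 * \int[@lebesgue_measure R]_(u in fundamental_cell Delta)
    periodized f Delta u ^+ 2.
  rewrite /v /fundamental_cell Rintegral_itv_bndo_bndc//.
  by have [] := correlation_sum Delta_gt0 sf F2.
split.
- exact: autocovariance_esum_lty L_levy L_mean L_var Delta_gt0 sf X_def F2.
- rewrite vE; exact: autocovariance_bilateral_sum L_levy L_mean L_var Delta_gt0 sf X_def F2.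
- split=> [n|g cg gb].
    apply: measurable_funM => //; apply: measurable_funB => //.
    by apply: measurable_funM => //; apply: measurable_sum => i.
  have key := moving_average_central_limit L_levy L_mean L_var Delta_gt0 sf X_def F2 cg gb.
  have mg : measurable_fun setT g by exact: continuous_measurable_fun.
  have [M gM] := gb.
  rewrite vE -[X in _ --> X]fineK; last first.
    by apply: integrable_fin_num => //; exact: (@bounded_integrable _ _ _ (normal_law 0 _) g M mg gM).
  have E n w : g (Num.sqrt n%:R * (sample_mean X Delta n w - mu)) =
      g (normalized_sum (fun k w => X (k.+1%:R * Delta) w - mu) n w).
    by rewrite normalized_sum_sample_mean.
  have mS n : measurable_fun setT (fun w => g (normalized_sum (fun k w => X (k.+1%:R * Delta) w - mu) n w)).
    apply: measurableT_comp => //; apply: measurable_funM => //.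
    by apply: measurable_sum => i; apply: measurable_funB.
  have EE n : ('E_P[g \o (fun w => Num.sqrt n%:R * (sample_mean X Delta n w - mu))%R] =
      (\int[P]_w g (normalized_sum (fun k w => X (k.+1%:R * Delta) w - mu) n w))%R%:E)%E.
    rewrite /Rintegral fineK; last first.
      apply: integrable_fin_num => //; apply: (bounded_integrable _ (mS n)) => w; exact: gM.
    by rewrite unlock; apply: eq_integral => w _; rewrite /= E.
  under eq_fun do rewrite EE.
  by apply: cvg_EFin; [exact: nearW|exact: key].
Qed.
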